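(* Let $f_0=\sum_{i\ge1}f_i\phi_i$ and suppose $\sum_{i\ge1}f_i^2/\mu_i^{2r}<\infty$ for some $0<r\le1/2$. Suppose $\lambda=\lambda_n>0$ is chosen such that $n^{-1}\sum_{i=1}^n\frac{u_i}{n\lambda+u_i}=o(1)$ in $\mathbb P_0^{(n)}$-probability and $\|f_\lambda-f_0\|_\infty=o(1)$. Then $$\hat\sigma_n^2\to\sigma_0^2\quad\text{in }\mathbb P_0^{(n)}\text{-probability}.$$ Furthermore, let $k\in\mathbb N_0$, $f_0\in C^k[0,1]$, $K\in C^{2k}([0,1],[0,1])$, let $\epsilon_n$ satisfy $\epsilon_n\to0$ and $n\epsilon_n^2\to\infty$, let $p\in\{2,\infty\}$, and suppose in addition that: (A) there exists $C_{k,\phi}>0$ with $\|\phi_i^{(k)}\|_\infty\le C_{k,\phi}i^k$ for all $i\in\mathbb N$; (B) there exists $L_{k,\phi}>0$ with $|\phi_i^{(k)}(x)-\phi_i^{(k)}(x')|\le L_{k,\phi}i^{k+1}|x-x'|$ for all $i\in\mathbb N$, $x,x'\in[0,1]$; (C) $\lambda$ is such that $\tilde\kappa^2=o(\sqrt{n/\log n})$, $\tilde\kappa_k^2=O(n\epsilon_n^2/\log n)$, $\hat\kappa_{k+1}^2=O(n)$; (D) $\|\hat f_n^{(k)}-f_0^{(k)}\|_p\lesssim\epsilon_n$ with $\mathbb P_0^{(n)}$-probability tending to $1$. Then $\epsilon_n$ is a posterior contraction rate of the empirical Bayes posterior $\Pi_{n,k}(\cdot\mid\mathbb D_n)|_{\sigma^2=\hat\sigma_n^2}$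 at $f_0^{(k)}$, i.e., for any $M_n\to\infty$, $$\Pi_{n,k}\left(\|f^{(k)}-f_0^{(k)}\|_p>M_n\epsilon_n\,\big|\,\mathbb D_n\right)\Big|_{\sigma^2=\hat\sigma_n^2}\to0\quad\text{in }\mathbb P_0^{(n)}\text{-probability}.$$
   Context: Model: $\mathbb D_n=\{(X_i,Y_i)\}_{i=1}^n$ are i.i.d. with $X_i\sim\mathbb P_X$ on $[0,1]$ (with density $p_X$ with respect to Lebesgue measure) and $Y_i=f_0(X_i)+\varepsilon_i$, $\varepsilon_i\sim N(0,\sigma_0^2)$ independent of $X_i$, where $\sigma_0^2$ is the true unknown variance; $\mathbb P_0^{(n)}$ is the law of $\mathbb D_n$. $X=(X_1,\dots,X_n)^T$, $Y=(Y_1,\dots,Y_n)^T$. $\|\cdot\|_\infty$ is the supremum norm, $\|f\|_2=(\int f^2d\mathbb P_X)^{1/2}$. $a_n\lesssim b_n$ means $a_n\le Cb_n$ for a constant $C>0$ not depending on $n$. Standing assumption: $f_0\in C^k[0,1]$ and $K\in C^{2k}([0,1],[0,1])$ for the order $k\in\mathbb N_0$ considered (so $f_0$ and $K$ are at least continuous); $K\in C^{2k}$ means $\partial_x^j\partial_{x'}^jK$ is continuous for $0\le j\le k$. Kernel: $K$ is a continuous, symmetric, positive definite kernel on $[0,1]$ with Mercer decomposition $K(x,x')=\sum_{i\ge1}\mu_i\phi_i(x)\phi_i(x')$, $\mu_1\ge\mu_2\ge\cdots>0$, $\mu_i\downarrow0$, $\{\phi_i\}$ an orthonormal basis of $L^2_{p_X}[0,1]$.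 $u_1\ge\cdots\ge u_n$ are the eigenvalues of the matrix $K(X,X)=(K(X_i,X_j))_{i,j}$. $f_\lambda=(L_K+\lambda I)^{-1}L_Kf_0=\sum_i\frac{\mu_i}{\lambda+\mu_i}f_i\phi_i$, where $L_Kf(x)=\int K(x,x')f(x')\,d\mathbb P_X(x')$. Variance estimator: $\hat\sigma_n^2=\lambda Y^T[K(X,X)+n\lambda I_n]^{-1}Y$, the maximum marginal likelihood estimator of $\sigma^2$. Posterior: under the prior $f\sim\mathrm{GP}(0,\sigma^2(n\lambda)^{-1}K)$ and noise variance $\sigma^2$, the posterior $\Pi_{n,k}(\cdot\mid\mathbb D_n)$ of $f^{(k)}$ is $\mathrm{GP}(\hat f_n^{(k)},\tilde V_n^k)$ with $$\hat f_n^{(k)}(x)=K_{k0}(x,X)[K(X,X)+n\lambda I_n]^{-1}Y,$$ $$\tilde V_n^k(x,x')=\sigma^2(n\lambda)^{-1}\{K_{kk}(x,x')-K_{k0}(x,X)[K(X,X)+n\lambda I_n]^{-1}K_{0k}(X,x')\},$$ where $K_{k0}(x,X)=(\partial_x^kK(x,X_i))_{i=1}^n$ (row), $K_{0k}(X,x')=(\partial_{x'}^kK(X_i,x'))_{i=1}^n$ (column), $K_{kk}=\partial_x^k\partial_{x'}^kK$. $\Pi_{n,k}(\cdot\mid\mathbb D_n)|_{\sigma^2=\hat\sigma_n^2}$ is this law with $\sigma^2$ replaced by $\hat\sigma_n^2$. Effective dimensions: $\tilde\kappa_m^2=\sup_{x\in[0,1]}\sum_{i\ge1}\frac{\mu_i}{\lambda+\mu_i}\phi_i^{(m)}(x)^2$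 for $0\le m\le k$, $\tilde\kappa^2=\tilde\kappa_0^2$, and $\hat\kappa_m^2=\sum_{i\ge1}\frac{i^{2m}\mu_i}{\lambda+\mu_i}$. *)

(* Defs.v *)
(* Functions on [0,1] are total functions on R, of which only the values on
   [0,1] matter.
   Sequences indexed by i >= 1 in the mathematics are 0-based here: [mu i] and
   [phi i] stand for mu_{i+1} and phi_{i+1}. *)
From HB Require Import structures.
From mathcomp Require Import all_boot all_order all_algebra.
From mathcomp Require Import all_classical all_reals all_analysis.

Set Implicit Arguments.
Unset Strict Implicit.
Unset Printing Implicit Defensive.

Import Order.TTheory GRing.Theory Num.Theory.
Import numFieldNormedType.Exports.

Local Open Scope classical_set_scope.
Local Open Scope ring_scope.

Section Smoothness.
Context {R : realType}.
Implicit Types (f : R -> R) (K : R -> R -> R) (k j : nat) (x : R).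

(* The limit is taken within [0,1], hence one-sided at 0 and 1. *)
Definition quot01 f x : set_system R :=
  (fun y => (f y - f x) / (y - x)) @ within `[0, 1] x^'.

Definition derivable01 f x : Prop := cvg (quot01 f x).
Definition D01 f : R -> R := fun x => lim (quot01 f x).
Definition Dn k f : R -> R := iter k D01 f.

Definition derivable01n k f : Prop :=
  forall j x, (j < k)%N -> 0 <= x <= 1 -> derivable01 (Dn j f) x.

Definition Ck01 k f : Prop :=
  derivable01n k f /\
  forall j, (j <= k)%N -> {within `[0, 1], continuous (Dn j f)}.

Definition partial01 j K x x' : R := Dn j (fun y => K y x') x.
Definition partial02 j K x x' : R := Dn j (K x) x'.
Definition partial12 j K : R -> R -> R := partial01 j (partial02 j K).

Definition C2k01 k K : Prop := forall j, (j <= k)%N ->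
  [/\ forall x, 0 <= x <= 1 -> derivable01n j (K x),
      forall x', 0 <= x' <= 1 -> derivable01n j (partial02 j K ^~ x') &
      {within `[0, 1] `*` `[0, 1],
         continuous (fun z : R * R => partial12 j K z.1 z.2)}].

End Smoothness.

Section Norms.
Context {R : realType}.
Local Open Scope ereal_scope.

(* The genuine supremum over [0,1], not an essential supremum. *)
Definition sup_norm (f : R -> R) : \bar R :=
  ereal_sup [set `|f x|%:E | x in `[0%R, 1%R]].

Definition L2_norm (PX : probability (measurableTypeR R) R) (f : R -> R) : \bar R :=
  (\int[PX]_(x in `[0%R, 1%R]) ((f x) ^+ 2)%:E) `^ 2^-1.

(* Only used for p = 2 and p = +oo. *)
Definition pnorm (PX : probability (measurableTypeR R) R) (p : \bar R) (f : R -> R) : \bar R :=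
  if p == +oo then sup_norm f else L2_norm PX f.

Definition little_o (a : nat -> \bar R) (b : nat -> R) : Prop :=
  forall e : R, (0 < e)%R -> \forall n \near \oo, a n <= (e * b n)%:E.

Definition big_O (a : nat -> \bar R) (b : nat -> R) : Prop :=
  exists2 C : R, (0 < C)%R & \forall n \near \oo, a n <= (C * b n)%:E.

End Norms.

Section Probability.
Local Open Scope ereal_scope.
Context {R : realType}.

(* Probabilities of events are read as outer probabilities [P^*], which agree
   with P on measurable events; no measurability side condition is then
   needed to speak of the events below. *)
Definition cvg_in_prob d (T : measurableType d) (P : probability T R)
    (Z : nat -> T -> \bar R) (c : \bar R) : Prop :=
  forall e : R, (0 < e)%R ->
    (fun n => (P^*)%mu [set w | e%:E <= `|Z n w - c|]) @ \oo --> 0.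

Definition with_prob_to_1 d (T : measurableType d) (P : probability T R)
    (A : nat -> set T) : Prop :=
  (fun n => (P^*)%mu (~` A n)) @ \oo --> 0.

Definition mutually_independent d d' (T : measurableType d)
    (T' : measurableType d') (P : probability T R) (W : nat -> T -> T') :=
  forall (s : seq nat) (B : nat -> set T'), uniq s ->
    (forall i, measurable (B i)) ->
    P (\bigcap_(i in [set` s]) (W i @^-1` B i)) =
    \prod_(i <- s) P (W i @^-1` B i).

(* N(m, v) parametrized by its variance; a Dirac mass when v = 0, a case that
   [normal_prob] treats as a junk value. *)
Definition gaussian (m v : R) (B : set R) : \bar R :=
  if v == 0%R then \d_m B else normal_prob m (Num.sqrt v) B.

(* A version of GP(m, V) with continuous paths on [0,1], so that the norms of
   its paths are determined by its law. *)
Record gaussian_process d (S : measurableType d) (Q : probability S R)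
    (Z : R -> S -> R) (m : R -> R) (V : R -> R -> R) : Prop := {
  gp_measurable : forall x, (0 <= x <= 1)%R -> measurable_fun setT (Z x) ;
  gp_continuous : forall s, {within `[0%R, 1%R], continuous (Z ^~ s)} ;
  gp_gaussian : forall (l : nat) (a t : 'I_l -> R) (B : set R),
    (forall i, (0 <= t i <= 1)%R) -> measurable B ->
    Q ((fun s => \sum_(i < l) a i * Z (t i) s)%R @^-1` B) =
    gaussian (\sum_(i < l) a i * m (t i))%R
             (\sum_(i < l) \sum_(j < l) a i * a j * V (t i) (t j))%R B }.

End Probability.

Section Model.
Context {R : realType}.

Definition has_density01 (PX : probability (measurableTypeR R) R) (pX : R -> R) : Prop :=
  [/\ measurable_fun (`[0, 1] : set R) pX,
      forall x, 0 <= x <= 1 -> 0 <= pX x &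
      forall B : set R, measurable B ->
        PX B = (\int[lebesgue_measure]_(x in B `&` `[0%R, 1%R]) (pX x)%:E)%E].

(* Independence is required of the pairs (X_i, Y_i) across i, and of X_i and
   eps_i for each i. *)
Record regression_model d (T : measurableType d) (P : probability T R)
    (PX : probability (measurableTypeR R) R) (f0 : R -> R) (sigma0 : R)
    (X Y eps : nat -> {RV P >-> R}) : Prop := {
  model_X01 : forall i w, 0 <= X i w <= 1 ;
  model_X_law : forall i (B : set R), measurable B -> distribution P (X i) B = PX B ;
  model_eps_law : forall i (B : set R), measurable B ->
    distribution P (eps i) B = normal_prob 0 sigma0 B ;
  model_X_eps : forall i (B C : set R), measurable B -> measurable C ->
    P ((X i @^-1` B) `&` (eps i @^-1` C)) =
    (P (X i @^-1` B) * P (eps i @^-1` C))%E ;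
  model_Y : forall i w, Y i w = f0 (X i w) + eps i w ;
  model_indep : mutually_independent P (fun i w => (X i w, Y i w)) }.

Record psd_kernel (K : R -> R -> R) : Prop := {
  kernel_continuous : {within `[0, 1] `*` `[0, 1],
    continuous (fun z : R * R => K z.1 z.2)} ;
  kernel_sym : forall x x', 0 <= x <= 1 -> 0 <= x' <= 1 -> K x x' = K x' x ;
  kernel_psd : forall (l : nat) (a t : 'I_l -> R),
    (forall i, 0 <= t i <= 1) ->
    0 <= \sum_(i < l) \sum_(j < l) a i * a j * K (t i) (t j) }.

Section Mercer.
Variables (PX : probability (measurableTypeR R) R) (mu : nat -> R) (phi : nat -> R -> R).

Definition coef (f : R -> R) (i : nat) : R :=
  \int[PX]_(x in `[0, 1]) (f x * phi i x).

Record orthonormal_basis : Prop := {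
  onb_measurable : forall i, measurable_fun (`[0, 1] : set R) (phi i) ;
  onb_L2 : forall i, (L2_norm PX (phi i) < +oo)%E ;
  onb_orthonormal : forall i j, coef (phi i) j = (i == j)%:R ;
  onb_complete : forall f : R -> R, measurable_fun (`[0, 1] : set R) f ->
    (L2_norm PX f < +oo)%E ->
    (fun N => L2_norm PX (fun x => f x - \sum_(i < N) coef f i * phi i x))
      @ \oo --> 0%E }.

Record mercer_decomposition (K : R -> R -> R) : Prop := {
  mercer_basis : orthonormal_basis ;
  mercer_gt0 : forall i, 0 < mu i ;
  mercer_noninc : nonincreasing_seq mu ;
  mercer_to0 : mu @ \oo --> 0 ;
  mercer_sum : forall x x', 0 <= x <= 1 -> 0 <= x' <= 1 ->
    (fun N => \sum_(i < N) mu i * phi i x * phi i x') @ \oo --> K x x' }.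

(* The Mercer expansion of (L_K + lam I)^-1 L_K f0. *)
Definition f_lambda (f0 : R -> R) (lam x : R) : R :=
  limn (fun N => \sum_(i < N) mu i / (lam + mu i) * coef f0 i * phi i x).

Local Open Scope ereal_scope.

Definition kappa_tilde2 (m : nat) (lam : R) : \bar R :=
  ereal_sup [set \sum_(i <oo) (mu i / (lam + mu i) * (Dn m (phi i) x) ^+ 2)%:E
            | x in `[0%R, 1%R]].

Definition kappa_hat2 (m : nat) (lam : R) : \bar R :=
  \sum_(i <oo) (i.+1%:R ^+ (2 * m) * mu i / (lam + mu i))%:E.

End Mercer.

Section Estimators.
Variables (n : nat) (K : R -> R -> R) (lam : R) (x : 'I_n -> R) (y : 'I_n -> R).

Definition gram : 'M[R]_n := \matrix_(i, j) K (x i) (x j).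
Definition ridge_inv : 'M[R]_n := invmx (gram + (n%:R * lam)%:M).

Definition sigma2_hat : R :=
  lam * ((\row_i y i) *m ridge_inv *m (\col_i y i)) 0 0.

Definition post_mean (k : nat) (t : R) : R :=
  ((\row_i partial01 k K t (x i)) *m ridge_inv *m (\col_i y i)) 0 0.

Definition post_cov (k : nat) (s2 t t' : R) : R :=
  s2 * (n%:R * lam)^-1 *
  (partial12 k K t t' -
   ((\row_i partial01 k K t (x i)) *m ridge_inv *m
    (\col_i partial02 k K (x i) t')) 0 0).

End Estimators.

(* Eigenvalues with multiplicity, in nonincreasing order. *)
Definition ordered_eigenvalues (n : nat) (A : 'M[R]_n) (u : 'I_n -> R) : Prop :=
  (forall i j : 'I_n, (i <= j)%N -> u j <= u i) /\
  char_poly A = \prod_(i < n) ('X - (u i)%:P).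

End Model.

(* Main.v *)
Require Import Defs.
From HB Require Import structures.
From mathcomp Require Import all_boot all_order all_algebra.
From mathcomp Require Import all_classical all_reals all_analysis.
From mathcomp Require Import measurable_realfun ring lra.

Set Implicit Arguments.
Unset Strict Implicit.
Unset Printing Implicit Defensive.

Import Order.TTheory GRing.Theory Num.Theory.
Import numFieldNormedType.Exports.
Local Open Scope classical_set_scope.
Local Open Scope ring_scope.

(** The estimator is [lam * Y^T (G + n lam)^-1 Y], where [G] is the kernel matrix
    of the sample, and [Y = f0(X) + eps].

    Consistency of the variance estimator.  The quadratic form splits into a
    signal part, a noise part and a cross term.  For the signal, [f0] is replaced
    by [f_lambda]: on the sample, the ridge form of a function is at most its
    squared norm in the reproducing kernel space, and the normal equations give
    [lam |f_lambda|_K^2 = <f_lambda, f0 - f_lambda>], which is at most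
    [|f0|_2 |f0 - f_lambda|_oo]; the remaining [f0 - f_lambda] contributes at
    most its squared sup norm ([signal_bound]).  The noise part is [|eps|^2 / n]
    minus [eps^T H eps / n], with [H] the smoother [G (G + n lam)^-1].  The first
    term tends to the variance by the weak law of large numbers ([noise_wlln]).
    The second is nonnegative with mean [sigma0^2 E (tr H) / n], since the noise
    is independent of the design; the trace is the sum of
    [u_i / (n lam + u_i)], which is small in probability and bounded by [n]
    ([smoother_noise_outer]).  Cauchy-Schwarz handles the cross term
    ([variance_decomposition]).

    Contraction.  The posterior mean of the derivative is close to the truth by
    assumption, so that only the fluctuations of the posterior around its mean
    have to be controlled.  Their variance at [t] is a ridge residual.  Expanding
    the kernel in the Mercer basis, it is compared with the series of
    [mu_i / (lam + mu_i) phi_i^(k)(t)^2]: the two differ by a factor 2 at most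
    as soon as the Gram matrix of the functions
    [sqrt (mu_i / (lam + mu_i)) phi_i] on the sample is within [1/2] of its mean
    in Frobenius norm ([posterior_variance_le]).  By Chebyshev's inequality this
    holds with high probability when the squared effective dimension is small
    compared with [n] ([gram_error_outer]).  Hence the posterior variances are of
    order [epsilon_n^2 / ln n].  The same comparison applied to increments, and
    the Lipschitz bounds on [phi_i^(k)], show that increments over a distance [h]
    have standard deviations of order [h].  A Gaussian tail bound on a dyadic
    grid of about [n] points, and a chaining argument over the finer dyadic levels
    ([chaining]), bound the supremum of the fluctuations; continuity of the paths
    extends the bound from dyadic points to the interval.  The norm for [p = 2]
    is at most the supremum norm, so that both values of [p] follow.

    Using the Mercer series of derivatives requires that the eigenfunctions be
    differentiable and that the kernel may be differentiated term by term.  Both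
    come from finite differences: a finite difference quotient is a finite
    combination of values, so it passes through sums and integrals, and mean
    value theorems compare it with derivatives.  Cauchy-Schwarz in the Mercer
    series bounds the derivatives of [K] in one variable by the mixed derivative
    ([Dn_kernel_bounded]); differentiating [mu_i phi_i = L_K phi_i] under the
    integral gives smooth eigenfunctions ([phi_deriv]); dominated convergence of
    series gives the derivatives of [K] ([partial01_mercer],
    [partial12_mercer]). *)

(** * Derivatives relative to an interval *)

Section Calculus.
Context {R : realType}.
Implicit Types (f g : R -> R) (F : nat -> R -> R).

(** The derivative is taken relative to [[a, b]] and with an explicit error
    bound: restriction to a subinterval and translation, which finite
    differences call for, are then immediate, and end points are no special
    case. *)
Definition deriv_on (a b : R) f g := forall x, a <= x <= b ->
  forall e, 0 < e -> exists2 d : R, 0 < d & forall y : R, a <= y <= b ->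
    `|y - x| < d -> `|f y - f x - g x * (y - x)| <= e * `|y - x|.

Lemma deriv_on_sub a b a' b' f g : a <= a' -> b' <= b ->
  deriv_on a b f g -> deriv_on a' b' f g.
Proof.
move=> aa bb H x /andP[x1 x2] e e0.
have [|d d0 Hd] := H x _ e e0; first by rewrite (le_trans aa)// (le_trans x2).
exists d => // y /andP[y1 y2]; apply: Hd.
by rewrite (le_trans aa)// (le_trans y2).
Qed.

Lemma deriv_onB a b f g f' g' : deriv_on a b f f' -> deriv_on a b g g' ->
  deriv_on a b (fun x => f x - g x) (fun x => f' x - g' x).
Proof.
move=> Hf Hg x xab e e0.
have e2 : 0 < e / 2 by rewrite divr_gt0.
have [d d0 Hd] := Hf x xab _ e2; have [d' d'0 Hd'] := Hg x xab _ e2.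
exists (Num.min d d'); first by rewrite lt_min d0.
move=> y yab; rewrite lt_min => /andP[y1 y2].
have := Hd y yab y1; have := Hd' y yab y2 => H1 H2.
rewrite (_ : _ - _ - _ = (f y - f x - f' x * (y - x)) - (g y - g x - g' x * (y - x))); last by ring.
apply: le_trans (ler_normB _ _) _.
by rewrite (_ : e * _ = e / 2 * `|y - x| + e / 2 * `|y - x|); [exact: lerD|field].
Qed.

Lemma deriv_on_shift a b h f g : deriv_on a b f g ->
  deriv_on (a - h) (b - h) (fun x => f (x + h)) (fun x => g (x + h)).
Proof.
move=> H x xab e e0.
have [|d d0 Hd] := H (x + h) _ e e0; first by move: xab => /andP[? ?]; apply/andP; split; lra.
exists d => // y yab yd.
have E : y + h - (x + h) = y - x by ring.
by rewrite -E; apply: Hd; [move: yab => /andP[? ?]; apply/andP; split; lra|rewrite E].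
Qed.

Lemma deriv_on_continuous a b f g : deriv_on a b f g ->
  {within `[a, b], continuous f}.
Proof.
move=> H; apply/subspace_continuousP => x; rewrite /= in_itv/= => xab.
apply/cvgrPdist_le => /= e e0.
have [d d0 Hd] := H x xab 1 ltr01.
have d1 : 0 < Num.min d (e / (1 + `|g x|)).
  by rewrite lt_min d0 divr_gt0// ltr_pwDl.
suff : \forall y \near x, `[a, b]%classic y -> `|f x - f y| <= e by [].
near=> y; rewrite /= in_itv/= => yab.
have yx : `|y - x| < Num.min d (e / (1 + `|g x|)).
  rewrite distrC; near: y; exact: nbhsx_ballx.
move: yx; rewrite lt_min => /andP[y1 y2].
have := Hd y yab y1; rewrite mul1r => H1.
rewrite distrC (_ : f y - f x = (f y - f x - g x * (y - x)) + g x * (y - x)); last by ring.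
apply: le_trans (ler_normD _ _) _; rewrite normrM.
apply: (@le_trans _ _ ((1 + `|g x|) * `|y - x|)).
  by rewrite mulrDl mul1r lerD2r.
by rewrite -ler_pdivlMl ?ltr_pwDl// mulrC ltW.
Unshelve. all: by end_near. Qed.

(** At interior points the relative derivative is the ordinary one, which opens
    the way to the mean value theorem. *)
Lemma deriv_on_is_derive a b f g x : deriv_on a b f g -> a < x < b ->
  is_derive x 1 f (g x).
Proof.
move=> H /andP[ax xb].
have L : h^-1 *: ((f \o shift x) (h *: 1) - f x) @[h --> 0^'] --> g x.
  apply/cvgrPdist_le => /= e e0.
  have [|d d0 Hd] := H x _ e e0; first by rewrite !ltW.
  near=> h.
  have h0 : h != 0 by near: h; exact: nbhs_dnbhs_neq.
  have hd : `|h| < Num.min d (Num.min (x - a) (b - x)).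
    near: h; apply: dnbhs0_lt; by rewrite !lt_min d0 !subr_gt0 ax xb.
  move: hd; rewrite !lt_min => /and3P[h1 h2 h3].
  have := Hd (h + x); rewrite addrK => /(_ _ h1) Hh.
  have {}Hh : `|f (h + x) - f x - g x * h| <= e * `|h|.
    by apply: Hh; move: h2 h3; rewrite !ltr_norml => /andP[? ?] /andP[? ?]; apply/andP; split; lra.
  rewrite /= /shift /GRing.scale /= mulr1.
  rewrite (_ : g x - _ = - (h^-1 * (f (h + x) - f x - g x * h))); last by field.
  by rewrite normrN normrM normfV ler_pdivrMl ?normr_gt0// [`|h| * _]mulrC.
apply: DeriveDef; first by apply/cvg_ex; exists (g x).
exact: cvg_lim.
Unshelve. all: by end_near. Qed.

Lemma deriv_on_MVT a b f g : a <= b -> deriv_on a b f g ->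
  exists2 c, a <= c <= b & f b - f a = g c * (b - a).
Proof.
move=> ab H.
have D x : x \in `]a, b[%R -> is_derive x 1 f (g x).
  by rewrite in_itv/=; exact: deriv_on_is_derive.
have [c] := MVT_segment ab D (deriv_on_continuous H).
by rewrite in_itv /= => cab E; exists c.
Qed.
End Calculus.

Section Bridge.
Context {R : realType}.
Implicit Types (f g : R -> R).

Lemma eq_deriv_on a b f f' g : (forall x, a <= x <= b -> f x = f' x) ->
  deriv_on a b f g -> deriv_on a b f' g.
Proof.
move=> E H x xab e e0; have [d d0 Hd] := H x xab e e0.
by exists d => // y yab yx; rewrite -!E//; exact: Hd.
Qed.

Lemma derivable01_deriv_on f : (forall x, 0 <= x <= 1 -> derivable01 f x) ->
  deriv_on 0 1 f (D01 f).
Proof.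
move=> H x x01 e e0; have /cvgrPdist_le/(_ _ e0) := H x x01.
rewrite /quot01 => -[/= d d0 Hd]; exists d => // y y01 yx.
have [->|yne] := eqVneq y x; first by rewrite !subrr mulr0 normr0 mulr0 subr0 normr0.
have yx0 : y - x != 0 by rewrite subr_eq0.
have := Hd y; rewrite /= distrC in_itv/= => /(_ yx yne y01).
rewrite -/(D01 f x) => H1.
rewrite (_ : f y - f x - D01 f x * (y - x) = - ((D01 f x - (f y - f x) / (y - x)) * (y - x))); last by field.
by rewrite normrN normrM ler_pM2r ?normr_gt0.
Qed.

(** No point of the unit interval is isolated, so that limits of difference
    quotients taken inside it are unique. *)
Lemma within01_proper (x : R) : 0 <= x <= 1 -> ProperFilter (within `[0, 1] x^').
Proof.
move=> x01; apply: Build_ProperFilter_ex => A [/= d d0 Hd].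
have m0 : 0 < Num.min (d / 2) (1 / 2) :> R by rewrite lt_min !divr_gt0.
have md : Num.min (d / 2) (1 / 2) < d by rewrite gt_min; apply/orP; left; lra.
have m2 : Num.min (d / 2) (1 / 2) <= 1 / 2 :> R by rewrite ge_min lexx orbT.
set m := Num.min _ _ in m0 md m2.
have [x2|x2] := lerP x (1 / 2).
  exists (x + m); apply: Hd => /=.
  - by rewrite opprD addrA subrr sub0r normrN gtr0_norm.
  - by rewrite -subr_eq0 addrAC subrr add0r gt_eqF.
  - by rewrite in_itv/=; apply/andP; split; lra.
exists (x - m); apply: Hd => /=.
- by rewrite opprB addrCA subrr addr0 gtr0_norm.
- by rewrite -subr_eq0 addrAC subrr add0r oppr_eq0 gt_eqF.
- by rewrite in_itv/=; apply/andP; split; lra.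
Qed.

Lemma deriv_on_derivable01 f g x : deriv_on 0 1 f g -> 0 <= x <= 1 ->
  derivable01 f x /\ D01 f x = g x.
Proof.
move=> H x01.
have PF := within01_proper x01.
have C : quot01 f x --> g x.
  apply/cvgrPdist_le => e e0; have [d d0 Hd] := H x x01 e e0.
  rewrite /quot01; exists d => //= y /=.
  rewrite distrC in_itv /= => yx yne y01.
  have yx0 : y - x != 0 by rewrite subr_eq0.
  have := Hd y y01 yx.
  rewrite (_ : f y - f x - g x * (y - x) = - ((g x - (f y - f x) / (y - x)) * (y - x))); last by field.
  by rewrite normrN normrM ler_pM2r ?normr_gt0.
split; first by apply/cvg_ex; exists (g x).
exact: cvg_lim.
Qed.

(** [F j] plays the role of the j-th derivative. Carrying the whole chain as
    data makes induction on the order possible for functions that are not given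
    as iterated derivatives. *)
Definition deriv_chain (a b : R) k (F : nat -> R -> R) :=
  forall j, (j < k)%N -> deriv_on a b (F j) (F j.+1).

Lemma derivable01n_chain k f : derivable01n k f ->
  deriv_chain 0 1 k (fun j => Dn j f).
Proof.
move=> H j jk; apply: (@derivable01_deriv_on (Dn j f)) => x x01.
exact: H.
Qed.

Lemma deriv_chain_Dn k f (F : nat -> R -> R) :
  (forall x, 0 <= x <= 1 -> F 0%N x = f x) -> deriv_chain 0 1 k F ->
  derivable01n k f /\
  forall j x, (j <= k)%N -> 0 <= x <= 1 -> Dn j f x = F j x.
Proof.
move=> F0 HF.
have E : forall j x, (j <= k)%N -> 0 <= x <= 1 -> Dn j f x = F j x.
  elim=> [|j IH] x jk x01; first by rewrite /= F0.
  have := HF _ jk; move/(eq_deriv_on (fun y y01 => esym (IH y (ltnW jk) y01))).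
  by move/deriv_on_derivable01 => /(_ _ x01)[].
split=> // j x jk x01.
have := HF _ jk; move/(eq_deriv_on (fun y y01 => esym (E j y (ltnW jk) y01))).
by move/deriv_on_derivable01 => /(_ _ x01)[].
Qed.

Lemma eq_Dn k f g : (forall x, 0 <= x <= 1 -> g x = f x) -> derivable01n k g ->
  derivable01n k f /\
  forall j x, (j <= k)%N -> 0 <= x <= 1 -> Dn j f x = Dn j g x.
Proof. by move=> E /derivable01n_chain; exact: deriv_chain_Dn. Qed.
End Bridge.

(** * Finite differences *)

Section FiniteDifferences.
Context {R : realType}.
Implicit Types (f g : R -> R) (h : R).

Fixpoint fdiff h j f x : R :=
  if j is j'.+1 then fdiff h j' (fun y => f (y + h) - f y) x else f x.

Lemma fdiff_sum h j : exists c : nat -> R, forall f x,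
  fdiff h j f x = \sum_(i < j.+1) c i * f (x + i%:R * h).
Proof.
elim: j => [|j [c IH]].
  by exists (fun=> 1) => f x; rewrite big_ord1 /= mul0r addr0 mul1r.
exists (fun i => (if i is i'.+1 then c i' else 0) - (if (i <= j)%N then c i else 0)).
move=> f x /=; rewrite IH.
under [RHS]eq_bigr do rewrite mulrBl; rewrite sumrB.
rewrite [X in X - _]big_ord_recl /= mul0r add0r.
rewrite [X in _ - X]big_ord_recr /= ltnn mul0r addr0.
under eq_bigr do rewrite mulrBr; rewrite sumrB; congr (_ - _); apply: eq_bigr => i _.
  by rewrite /= -addrA -natr1 mulrDl mul1r addrA.
by rewrite -ltnS ltn_ord.
Qed.

(** Induction on the order, applied to the chain of the differences [F j (y +
    h) - F j y], with one mean value theorem at each step. *)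
Lemma fdiff_MVT k : forall h a b (F : nat -> R -> R) x, 0 <= h ->
  deriv_chain a b k F -> a <= x -> x + k%:R * h <= b ->
  exists2 y, x <= y <= x + k%:R * h & fdiff h k (F 0%N) x = h ^+ k * F k y.
Proof.
elim: k => [|k IH] h a b F x h0 HF ax xb.
  by exists x; rewrite /= ?expr0 ?mul1r// mul0r addr0 lexx.
move: xb; rewrite -natr1 mulrDl mul1r => xb.
have HG : deriv_chain a (b - h) k (fun j y => F j (y + h) - F j y).
  move=> j jk; apply: deriv_onB.
    apply: (@deriv_on_sub _ (a - h) (b - h)) => //; first by lra.
    exact/deriv_on_shift/HF/leqW.
  by apply: (@deriv_on_sub _ a b) => //; [lra|exact/HF/leqW].
have [|y /andP[y1 y2] Ey] := IH h a (b - h) _ x h0 HG ax; first by lra.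
have HM : deriv_on y (y + h) (F k) (F k.+1).
  by apply: (@deriv_on_sub _ a b) (HF k (ltnSn k)); lra.
have [|z /andP[z1 z2] Ez] := deriv_on_MVT _ HM; first by lra.
exists z; first by apply/andP; split; lra.
by rewrite /= Ey Ez addrAC subrr add0r exprS; ring.
Qed.

(** The last difference is replaced by first order expansions at [x], so that
    the k-th derivative need only exist, not be continuous. *)
Lemma fdiff_near k (F : nat -> R -> R) x e : 0 < e -> 0 <= x <= 1 ->
  deriv_chain 0 1 k F ->
  exists2 d, 0 < d & forall h y, 0 < h -> k%:R * h < d -> 0 <= y <= x ->
    x <= y + k%:R * h <= 1 -> `|fdiff h k (F 0%N) y / h ^+ k - F k x| <= e.
Proof.
move=> e0 x01; case: k => [|k] HF.
  exists 1 => // h y _ _; rewrite mul0r addr0 => /andP[y0 yx] /andP[xy _].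
  have -> : y = x by apply/eqP; rewrite eq_le yx.
  by rewrite /= expr0 divr1 subrr normr0 ltW.
have e2 : 0 < e / (2 * k.+1%:R) by rewrite divr_gt0// mulr_gt0// ltr0Sn.
have [d d0 Hd] := HF k (ltnSn k) x x01 _ e2.
exists d => // h y h0 hd /andP[y0 yx] /andP[xy y1].
move: hd xy y1; rewrite -natr1 mulrDl mul1r => hd xy y1.
have HG : deriv_chain 0 (1 - h) k (fun j y => F j (y + h) - F j y).
  move=> j jk; apply: deriv_onB.
    apply: (@deriv_on_sub _ (0 - h) (1 - h)) => //; first by lra.
    exact/deriv_on_shift/HF/leqW.
  by apply: (@deriv_on_sub _ 0 1) => //; [lra|exact/HF/leqW].
have [|z /andP[z1 z2] Ez] := fdiff_MVT (ltW h0) HG y0; first by lra.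
have kh0 : 0 <= k%:R * h by rewrite mulr_ge0// ltW.
rewrite /= Ez exprS.
have hk : h ^+ k != 0 by rewrite expf_neq0// gt_eqF.
have hn : h != 0 by rewrite gt_eqF.
rewrite (_ : _ - _ = (F k (z + h) - F k x - F k.+1 x * (z + h - x)) / h
   - (F k z - F k x - F k.+1 x * (z - x)) / h); last by field; rewrite hn hk.
have b1 : `|z + h - x| <= k.+1%:R * h.
  by rewrite -natr1 mulrDl mul1r ler_norml; apply/andP; split; lra.
have b2 : `|z - x| <= k.+1%:R * h.
  by rewrite -natr1 mulrDl mul1r ler_norml; apply/andP; split; lra.
have kd : k.+1%:R * h < d by rewrite -natr1 mulrDl mul1r.
have := Hd (z + h); rewrite (le_lt_trans b1)// => /(_ _ isT) H1.
have := Hd z; rewrite (le_lt_trans b2)// => /(_ _ isT) H2.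
have {}H1 := H1 ltac:(apply/andP; split; lra).
have {}H2 := H2 ltac:(apply/andP; split; lra).
apply: le_trans (ler_normB _ _) _; rewrite !normrM normfV (gtr0_norm h0).
rewrite -mulrDl ler_pdivrMr//.
have K0 : (0 : R) < k.+1%:R by rewrite ltr0Sn.
apply: (@le_trans _ _ (e / (2 * k.+1%:R) * (k.+1%:R * h) + e / (2 * k.+1%:R) * (k.+1%:R * h))).
  apply: lerD; [apply: le_trans H1 _|apply: le_trans H2 _]; by rewrite ler_pM2l.
rewrite le_eqVlt; apply/orP; left; apply/eqP; field; by rewrite gt_eqF.
Qed.

Definition dstep k (N : nat) : R := (k + N).+1%:R^-1.
(** The base point [(1 - k h) x], with [h] the step, keeps all nodes of the
    difference inside the unit interval and [x] between the extreme nodes, up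
    to the end points. *)
Definition dquot k N f x : R :=
  fdiff (dstep k N) k f ((1 - k%:R * dstep k N) * x) / dstep k N ^+ k.

Lemma dstep_gt0 k N : 0 < dstep k N. Proof. by rewrite invr_gt0 ltr0Sn. Qed.

Lemma dstep_le1 k N : k%:R * dstep k N <= 1.
Proof.
by rewrite /dstep ler_pdivrMr ?ltr0Sn// mul1r ler_nat; apply: leqW; rewrite leq_addr.
Qed.

Lemma dstep_cvg k : k%:R * dstep k N @[N --> \oo] --> (0 : R).
Proof.
have H : dstep k N @[N --> \oo] --> (0 : R).
  rewrite (_ : dstep k = fun N => harmonic (N + k)%N); last first.
    by apply/funext => N; rewrite /dstep /harmonic /= addnC.
  by rewrite (cvg_shiftn k (harmonic : nat -> R)); exact: cvg_harmonic.
by rewrite -(mulr0 (k%:R)); apply: cvgM => //; exact: cvg_cst.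
Qed.

Lemma dquot_window x k N : 0 <= x <= 1 -> [/\ 0 <= (1 - k%:R * dstep k N) * x <= x &
   x <= (1 - k%:R * dstep k N) * x + k%:R * dstep k N <= 1].
Proof.
move=> /andP[x0 x1]; have := dstep_le1 k N; have := dstep_gt0 k N => d0 d1.
have kd0 : 0 <= k%:R * dstep k N by rewrite mulr_ge0// ltW.
set t := _ * dstep k N in d1 kd0 *.
have tx : 0 <= t * x by rewrite mulr_ge0.
have tx1 : 0 <= t * (1 - x) by rewrite mulr_ge0// subr_ge0.
have tx2 : 0 <= (1 - t) * x by rewrite mulr_ge0// subr_ge0.
have tx3 : 0 <= (1 - t) * (1 - x) by rewrite mulr_ge0// subr_ge0.
by split; apply/andP; split; lra.
Qed.

(** A difference quotient is a finite combination of values at points of the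
    unit interval. This is what lets it pass through series, limits and
    measurability. *)
Lemma dquot_sum k N : exists (c : nat -> R) (p : R -> nat -> R),
  (forall x i, 0 <= x <= 1 -> (i < k.+1)%N -> 0 <= p x i <= 1) /\
  forall f x, dquot k N f x = \sum_(i < k.+1) c i * f (p x i).
Proof.
have [c Hc] := fdiff_sum (dstep k N) k.
exists (fun i => c i / dstep k N ^+ k).
exists (fun x i => (1 - k%:R * dstep k N) * x + i%:R * dstep k N); split.
  move=> x i x01 ik; have [/andP[a1 a2] /andP[a3 a4]] := dquot_window k N x01.
  have : 0 <= i%:R * dstep k N by rewrite mulr_ge0// ltW// dstep_gt0.
  have : i%:R * dstep k N <= k%:R * dstep k N by rewrite ler_pM2r ?dstep_gt0// ler_nat -ltnS.
  by move=> ? ?; apply/andP; split; lra.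
move=> f x; rewrite /dquot Hc mulr_suml; apply: eq_bigr => i _.
by rewrite mulrAC.
Qed.

Lemma dquot_MVT k N (F : nat -> R -> R) x : deriv_chain 0 1 k F ->
  0 <= x <= 1 -> exists y, [/\ 0 <= y <= 1, `|y - x| <= k%:R * dstep k N &
    dquot k N (F 0%N) x = F k y].
Proof.
move=> HF x01; have [/andP[a1 a2] /andP[a3 a4]] := dquot_window k N x01.
have [y /andP[y1 y2] E] := fdiff_MVT (ltW (dstep_gt0 k N)) HF a1 a4.
exists y; split; first by apply/andP; split; lra.
  by rewrite ler_norml; apply/andP; split; lra.
by rewrite /dquot E mulrAC divff ?mul1r// expf_neq0// gt_eqF// dstep_gt0.
Qed.

Lemma dquot_cvg k (F : nat -> R -> R) x : deriv_chain 0 1 k F ->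
  0 <= x <= 1 -> dquot k N (F 0%N) x @[N --> \oo] --> F k x.
Proof.
move=> HF x01; apply/cvgrPdist_le => e e0.
have [d d0 Hd] := fdiff_near e0 x01 HF.
near=> N; have [a1 a2] := dquot_window k N x01.
rewrite distrC; apply: Hd => //; first exact: dstep_gt0.
near: N; have /cvgrPdist_lt/(_ _ d0) := dstep_cvg k.
apply: filterS => N; rewrite sub0r normrN ger0_norm//.
by rewrite mulr_ge0// ltW// dstep_gt0.
Unshelve. all: by end_near. Qed.

End FiniteDifferences.

(** * Mixed partial derivatives as limits of iterated differences *)

Section MixedDerivatives.
Context {R : realType}.
Implicit Types (f g : R -> R) (K : R -> R -> R).

Lemma within01_continuous2 (f : R * R -> R) x x' e :
  {within `[0, 1] `*` `[0, 1], continuous f} -> 0 <= x <= 1 -> 0 <= x' <= 1 ->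
  0 < e -> exists2 d, 0 < d & forall y y', 0 <= y <= 1 -> 0 <= y' <= 1 ->
    `|y - x| < d -> `|y' - x'| < d -> `|f (y, y') - f (x, x')| <= e.
Proof.
move=> /subspace_continuousP/(_ (x, x')) H x01 x'01 e0.
have {}H := H ltac:(by split; rewrite /= in_itv).
have /cvgrPdist_le/(_ _ e0) := H.
move=> [[A B] /= [[d1 d10 Hd1] [d2 d20 Hd2]] Hd].
exists (Num.min d1 d2); first by rewrite lt_min; apply/andP; split.
move=> y y' y01 y'01; rewrite !lt_min => /andP[a1 _] /andP[_ b2].
rewrite distrC; apply: (Hd (y, y')); last by split; rewrite /= in_itv.
by split; [apply: Hd1|apply: Hd2]; rewrite /= distrC.
Qed.

Lemma within01_bounded2 (f : R * R -> R) :
  {within `[0, 1] `*` `[0, 1], continuous f} ->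
  exists2 C, 0 < C & forall x x', 0 <= x <= 1 -> 0 <= x' <= 1 -> `|f (x, x')| <= C.
Proof.
move=> H; have cpt : compact (`[0, 1] `*` `[0, 1] : set (R * R)).
  by apply: compact_setX; exact: segment_compact.
have /compact_bounded[M [_ HM]] := continuous_compact H cpt.
exists (`|M| + 1); first by rewrite ltr_wpDl.
move=> x x' x01 x'01; apply: (HM (`|M| + 1)).
  by rewrite (le_lt_trans (ler_norm _))// ltrDl.
by exists (x, x') => //; split; rewrite /= in_itv.
Qed.

(** The inner quotient is a finite combination of slices of [K], hence a
    function [F 0] with k derivatives in its variable; the mean value theorem
    applied to it, and then in the other variable to the k-th partial
    derivative, yields a value of the mixed derivative. *)
Lemma dquot_mixed k N K x x' : C2k01 k K -> 0 <= x <= 1 -> 0 <= x' <= 1 ->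
  exists y y', [/\ 0 <= y <= 1, 0 <= y' <= 1,
    `|y - x| <= k%:R * dstep k N, `|y' - x'| <= k%:R * dstep k N &
    dquot k N (fun z => dquot k N (K z) x') x = partial12 k K y y'].
Proof.
move=> HK x01 x'01; have [c [p [Hp Hc]]] := @dquot_sum R k N.
have [HK1 HK2 _] := HK k (leqnn k).
pose F l z := \sum_(i < k.+1) c i * Dn l (K (p x i)) z.
have chF : deriv_chain 0 1 k F.
  move=> l lk; rewrite /F => z z01 e e0.
  have K0 : 0 < \sum_(i < k.+1) `|c i| + 1 by rewrite ltr_wpDl// sumr_ge0.
  have e1 : 0 < e / (\sum_(i < k.+1) `|c i| + 1) by rewrite divr_gt0.
  have /choice[d Hd] : forall i : 'I_k.+1, exists d, 0 < d /\ forall y, 0 <= y <= 1 ->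
    `|y - z| < d -> `|Dn l (K (p x i)) y - Dn l (K (p x i)) z
      - Dn l.+1 (K (p x i)) z * (y - z)| <= e / (\sum_(i < k.+1) `|c i| + 1) * `|y - z|.
    move=> i; have pi := Hp x i x01 (ltn_ord i).
    have [d d0 Hd] := derivable01n_chain (HK1 _ pi) lk z01 e1.
    by exists d.
  exists (\big[Num.min/1]_i d i).
    by apply/bigmin_gtP; split => // i _; have [] := Hd i.
  move=> y y01 /bigmin_gtP[_ yd].
  rewrite -sumrB mulr_suml -sumrB.
  apply: le_trans (ler_norm_sum _ _ _) _.
  apply: (@le_trans _ _ (\sum_(i < k.+1) `|c i| * (e / (\sum_(i < k.+1) `|c i| + 1) * `|y - z|))).
    apply: ler_sum => i _; rewrite -mulrBr -mulrA -mulrBr normrM ler_wpM2l//.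
    by apply: (Hd i).2 => //; exact: yd.
  rewrite -mulr_suml mulrA ler_wpM2r// mulrCA ger_pMr// ler_pdivrMr// mul1r.
  by rewrite lerDl.
have [y' [y'01 y'x E']] := dquot_MVT N chF x'01.
have [y [y01 yx E]] := dquot_MVT N (derivable01n_chain (HK2 _ y'01)) x01.
exists y, y'; split => //.
transitivity (dquot k N (F 0%N) x').
  rewrite !Hc /F; under eq_bigr do rewrite Hc mulr_sumr.
  rewrite exchange_big; apply: eq_bigr => i _; rewrite mulr_sumr.
  by apply: eq_bigr => j _; rewrite mulrCA.
transitivity (dquot k N (fun z => partial02 k K z y') x); last exact: E.
by rewrite E' Hc.
Qed.

(** Joint continuity of the mixed derivative enters here: the mean value
    theorem only locates its arguments near [(x, x')]. *)
Lemma dquot_mixed_cvg k K x x' : C2k01 k K -> 0 <= x <= 1 -> 0 <= x' <= 1 ->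
  dquot k N (fun z => dquot k N (K z) x') x @[N --> \oo] --> partial12 k K x x'.
Proof.
move=> HK x01 x'01; apply/cvgrPdist_le => e e0.
have [_ _ HK3] := HK k (leqnn k).
have [d d0 Hd] := within01_continuous2 HK3 x01 x'01 e0.
near=> N; have [y [y' [y01 y'01 yx yx' ->]]] := dquot_mixed N HK x01 x'01.
have Nd : k%:R * dstep k N < d.
  near: N; have /cvgrPdist_lt/(_ _ d0) := @dstep_cvg R k.
  apply: filterS => N; rewrite sub0r normrN ger0_norm//.
  by rewrite mulr_ge0// ltW// dstep_gt0.
by rewrite distrC; apply: Hd => //; [exact: le_lt_trans Nd|exact: le_lt_trans Nd].
Unshelve. all: by end_near. Qed.

Lemma dquot_mixed_bounded k K : C2k01 k K -> exists2 C, 0 < C &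
  forall N x x', 0 <= x <= 1 -> 0 <= x' <= 1 ->
    `|dquot k N (fun z => dquot k N (K z) x') x| <= C.
Proof.
move=> HK; have [_ _ HK3] := HK k (leqnn k).
have [C C0 HC] := within01_bounded2 HK3; exists C => // N x x' x01 x'01.
by have [y [y' [y01 y'01 _ _ ->]]] := dquot_mixed N HK x01 x'01; exact: HC.
Qed.
End MixedDerivatives.

(** * Partial sums of series *)

Section Sums.
Context {R : realType}.

Lemma cauchy_schwarz_sum (I : finType) (a b : I -> R) :
  (\sum_i a i * b i) ^+ 2 <= (\sum_i a i ^+ 2) * (\sum_i b i ^+ 2).
Proof.
have : 0 <= \sum_i \sum_j (a i * b j - a j * b i) ^+ 2.
  by apply: sumr_ge0 => i _; apply: sumr_ge0 => j _; exact: sqr_ge0.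
have -> : \sum_i \sum_j (a i * b j - a j * b i) ^+ 2 =
    2 * ((\sum_i a i ^+ 2) * (\sum_i b i ^+ 2)) - 2 * (\sum_i a i * b i) ^+ 2.
  transitivity (\sum_i \sum_j (a i ^+ 2 * b j ^+ 2 + b i ^+ 2 * a j ^+ 2
      - 2 * ((a i * b i) * (a j * b j)))).
    by apply: eq_bigr => i _; apply: eq_bigr => j _; ring.
  under eq_bigr do rewrite sumrB big_split/= -!mulr_sumr.
  rewrite sumrB big_split/= -!mulr_sumr -!mulr_suml; ring.
lra.
Qed.

Lemma le_psum (a : nat -> R) (l : R) m : (forall i, 0 <= a i) ->
  \sum_(i < N) a i @[N --> \oo] --> l -> \sum_(i < m) a i <= l.
Proof.
move=> a0 H; have E : (fun N => \sum_(i < N) a i) = series a.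
  by apply/funext => N; rewrite /series/= big_mkord.
move: H; rewrite E => H.
have <- : limn (series a) = l by exact: cvg_lim.
rewrite -(big_mkord predT a); apply: (@nondecreasing_cvgn_le _ (series a)).
  by move=> i j ij; exact: nondecreasing_series.
by apply/cvg_ex; exists l.
Qed.

Lemma psum_le_cvg (a : nat -> R) (C : R) : (forall i, 0 <= a i) ->
  (forall m, \sum_(i < m) a i <= C) ->
  exists2 l : R, l <= C & \sum_(i < N) a i @[N --> \oo] --> l.
Proof.
move=> a0 H; have E : (fun N => \sum_(i < N) a i) = series a.
  by apply/funext => N; rewrite /series/= big_mkord.
have C1 : cvgn (series a).
  apply: nondecreasing_is_cvgn; first by move=> i j ij; exact: nondecreasing_series.
  by exists C => _ [N _ <-]; rewrite /series/= big_mkord.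
exists (limn (series a)); last by rewrite E.
by apply: limr_le => //; apply: nearW => N; rewrite /series/= big_mkord.
Qed.

Lemma cauchy_schwarz_lim (a b : nat -> R) (A B l : R) :
  (forall m, \sum_(i < m) a i ^+ 2 <= A) -> (forall m, \sum_(i < m) b i ^+ 2 <= B) ->
  \sum_(i < N) a i * b i @[N --> \oo] --> l -> l ^+ 2 <= A * B.
Proof.
move=> HA HB H.
have H2 : (\sum_(i < N) a i * b i) ^+ 2 @[N --> \oo] --> l ^+ 2.
  by rewrite expr2; under eq_fun do rewrite expr2; exact: cvgM.
apply: (cvgr_to_le H2); apply: nearW => N; apply: le_trans (cauchy_schwarz_sum _ _) _.
by apply: ler_pM => //; apply: sumr_ge0 => i _; exact: sqr_ge0.
Qed.

Lemma psum_tail_le (a b : nat -> R) (l B : R) m : (forall i, `|a i| <= b i) ->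
  \sum_(i < N) a i @[N --> \oo] --> l -> \sum_(i < N) b i @[N --> \oo] --> B ->
  `|\sum_(i < m) a i - l| <= B - \sum_(i < m) b i.
Proof.
move=> ab Ha Hb.
have H1 : `|\sum_(i < m) a i - \sum_(i < N) a i| @[N --> \oo] --> `|\sum_(i < m) a i - l|.
  by apply: cvg_norm; apply: cvgB => //; exact: cvg_cst.
have H2 : \sum_(i < N) b i - \sum_(i < m) b i @[N --> \oo] --> B - \sum_(i < m) b i.
  by apply: cvgB => //; exact: cvg_cst.
apply: (ler_cvg_to H1 H2); near=> N.
have mN : (m <= N)%N by near: N; exists m.
rewrite -!(big_mkord predT) distrC (big_cat_nat _ mN)//=.
rewrite addrAC subrr add0r [X in _ <= X - _](big_cat_nat _ mN)//= addrAC subrr add0r.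
by apply: le_trans (ler_norm_sum _ _ _) _; apply: ler_sum.
Unshelve. all: by end_near. Qed.

Lemma cvg_psum m (g : nat -> nat -> R) (g' : nat -> R) :
  (forall i, (i < m)%N -> g N i @[N --> \oo] --> g' i) ->
  \sum_(i < m) g N i @[N --> \oo] --> \sum_(i < m) g' i.
Proof.
elim: m => [|m IH] H.
  by under eq_fun do rewrite big_ord0; rewrite big_ord0; exact: cvg_cst.
under eq_fun do rewrite big_ord_recr /=; rewrite big_ord_recr /=.
apply: cvgD; last exact: H.
by apply: IH => i im; apply: H; rewrite (ltn_trans im).
Qed.

(** Dominated convergence for series. It exchanges the limit of difference
    quotients with the Mercer sum. *)
Lemma tannery (g : nat -> nat -> R) (g' b G : nat -> R) (B L : R) :
  (forall i, g N i @[N --> \oo] --> g' i) -> (forall N i, `|g N i| <= b i) ->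
  \sum_(i < N) b i @[N --> \oo] --> B ->
  (forall N, \sum_(i < m) g N i @[m --> \oo] --> G N) -> G N @[N --> \oo] --> L ->
  \sum_(i < m) g' i @[m --> \oo] --> L.
Proof.
move=> Hg gb HB HG HL.
have key m : `|\sum_(i < m) g' i - L| <= B - \sum_(i < m) b i.
  have H1 : `|\sum_(i < m) g N i - G N| @[N --> \oo] --> `|\sum_(i < m) g' i - L|.
    apply: cvg_norm; apply: cvgB => //.
    by apply: cvg_psum => i _.
  by apply: (cvgr_to_le H1); apply: nearW => N; exact: psum_tail_le.
apply/cvgrPdist_le => e e0.
have := HB => /cvgrPdist_le/(_ _ e0); apply: filterS => m Hm.
rewrite distrC; apply: le_trans (key m) _; exact: le_trans (ler_norm _) Hm.
Qed.

Lemma psum_abs_cvg (a b : nat -> R) (B : R) : (forall i, `|a i| <= b i) ->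
  \sum_(i < N) b i @[N --> \oo] --> B ->
  exists l : R, \sum_(i < N) a i @[N --> \oo] --> l.
Proof.
move=> ab HB.
have b0 i : 0 <= b i by apply: le_trans (ab i).
have [|m|l1 _ Hl1] := @psum_le_cvg (fun i => `|a i|) B.
- by [].
- by apply: le_trans (le_psum m b0 HB); apply: ler_sum.
have [|m|l2 _ Hl2] := @psum_le_cvg (fun i => `|a i| - a i) (2 * B).
- by move=> i; rewrite subr_ge0 ler_norm.
- have H := le_psum m b0 HB.
  apply: (@le_trans _ _ (\sum_(i < m) 2 * b i)).
    apply: ler_sum => i _; rewrite mulr2n mulrDl !mul1r lerD//.
    by apply: le_trans (ab i); rewrite -normrN ler_norm.
  by rewrite -mulr_sumr ler_pM2l.
exists (l1 - l2).
rewrite (_ : (fun N => _) = fun N => \sum_(i < N) `|a i| - \sum_(i < N) (`|a i| - a i)).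
  exact: cvgB.
by apply/funext => N; rewrite -sumrB; apply: eq_bigr => i _; ring.
Qed.
End Sums.

Section SumsTail.
Context {R : realType}.

Lemma psum_trunc (x : nat -> R) N m : (N <= m)%N ->
  \sum_(i < m) (if (i < N)%N then 0 else x i) = \sum_(i < m) x i - \sum_(i < N) x i.
Proof.
move=> Nm; rewrite -(big_mkord predT (fun i => if (i < N)%N then 0 else x i)).
rewrite -!(big_mkord predT x) [in LHS](big_cat_nat _ Nm)//= [in RHS](big_cat_nat _ Nm)//=.
rewrite addrAC subrr add0r [X in X + _]big1_seq ?add0r; last first.
  by move=> i /=; rewrite mem_index_iota /= => ->.
apply: eq_big_seq => i; rewrite mem_index_iota => /andP[Ni _].
by rewrite ltnNge Ni.
Qed.

Lemma psum_trunc_cvg (x : nat -> R) (l : R) N : \sum_(i < m) x i @[m --> \oo] --> l ->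
  \sum_(i < m) (if (i < N)%N then 0 else x i) @[m --> \oo] --> l - \sum_(i < N) x i.
Proof.
move=> H.
have : \sum_(i < m) x i - \sum_(i < N) x i @[m --> \oo] --> l - \sum_(i < N) x i.
  by apply: cvgB => //; exact: cvg_cst.
apply: cvg_trans; apply: near_eq_cvg; near=> m; rewrite psum_trunc//.
by near: m; exists N.
Unshelve. all: by end_near. Qed.

(** The bound depends on [b] through [B] only, so that it gives uniform
    convergence of an expansion with respect to a parameter of [b]. *)
Lemma cauchy_schwarz_tail (a b : nat -> R) (A B l : R) N :
  \sum_(i < m) a i ^+ 2 @[m --> \oo] --> A -> (forall m, \sum_(i < m) b i ^+ 2 <= B) ->
  \sum_(i < m) a i * b i @[m --> \oo] --> l ->
  (l - \sum_(i < N) a i * b i) ^+ 2 <= (A - \sum_(i < N) a i ^+ 2) * B.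
Proof.
move=> HA HB Hl.
pose a' i := if (i < N)%N then 0 else a i.
apply: (@cauchy_schwarz_lim _ a' b) => //; last first.
  have := @psum_trunc_cvg (fun i => a i * b i) _ N Hl; apply: cvg_trans; apply: near_eq_cvg.
  by apply: nearW => m; apply: eq_bigr => i _; rewrite /a'; case: ifP => // _; rewrite mul0r.
move=> m; have HT := @psum_trunc_cvg (fun i => a i ^+ 2) _ N HA.
have := @le_psum _ (fun i => if (i < N)%N then 0 else a i ^+ 2) _ m _ HT.
move=> H; apply: le_trans (H _); last by move=> i; case: ifP => // _; exact: sqr_ge0.
by apply: ler_sum => i _; rewrite /a'; case: ifP => // _; rewrite expr0n.
Qed.
End SumsTail.

(** * Quadratic forms and the ridge inverse *)

Section QuadraticForms.
Context {R : realType}.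

Lemma discriminant_le (a b c : R) : 0 <= c ->
  (forall t, 0 <= a + 2 * b * t + c * t ^+ 2) -> b ^+ 2 <= a * c.
Proof.
rewrite le_eqVlt => /predU1P[<-|c0] H.
  rewrite mulr0; have [->|b0] := eqVneq b 0; first by rewrite expr0n.
  have := H (- (a + 1) / (2 * b)); rewrite mul0r addr0.
  have -> : a + 2 * b * (- (a + 1) / (2 * b)) = -1 by field.
  by rewrite ler0N1.
have := H (- b / c).
have -> : a + 2 * b * (- b / c) + c * (- b / c) ^+ 2 = a - b ^+ 2 / c.
  by field; rewrite gt_eqF.
by rewrite subr_ge0 ler_pdivrMr.
Qed.

Section Bilinear.
Variables (n : nat) (M : 'M[R]_n).
Implicit Types y z : 'I_n -> R.

Definition bilin y z : R := \sum_i \sum_j y i * M i j * z j.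

Lemma bilinE y z : ((\row_i y i) *m M *m (\col_i z i)) 0 0 = bilin y z.
Proof.
rewrite mxE; under eq_bigr do rewrite !mxE mulr_suml.
rewrite exchange_big; apply: eq_bigr => i _; apply: eq_bigr => j _.
by rewrite !mxE.
Qed.

Lemma bilinDr y z z' : bilin y (fun i => z i + z' i) = bilin y z + bilin y z'.
Proof.
rewrite /bilin -big_split; apply: eq_bigr => i _; rewrite -big_split.
by apply: eq_bigr => j _; rewrite mulrDr.
Qed.

Lemma bilinZr y z a : bilin y (fun i => a * z i) = a * bilin y z.
Proof.
rewrite /bilin mulr_sumr; apply: eq_bigr => i _; rewrite mulr_sumr.
by apply: eq_bigr => j _; rewrite mulrCA.
Qed.

Hypothesis Msym : forall i j, M i j = M j i.

Lemma bilinC y z : bilin y z = bilin z y.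
Proof.
rewrite /bilin exchange_big; apply: eq_bigr => i _; apply: eq_bigr => j _.
by rewrite Msym mulrAC [RHS]mulrAC [y _ * _]mulrC.
Qed.

Lemma bilinZl y z a : bilin (fun i => a * y i) z = a * bilin y z.
Proof. by rewrite bilinC bilinZr bilinC. Qed.

Lemma bilin_sqrD y z : bilin (fun i => y i + z i) (fun i => y i + z i) =
  bilin y y + 2 * bilin y z + bilin z z.
Proof.
rewrite bilinDr (bilinC _ y) (bilinC _ z) !bilinDr (bilinC z y); ring.
Qed.

Hypothesis Mpsd : forall y, 0 <= bilin y y.

Lemma bilin_cauchy_schwarz y z : bilin y z ^+ 2 <= bilin y y * bilin z z.
Proof.
apply: discriminant_le => // t.
have := Mpsd (fun i => y i + t * z i); rewrite bilin_sqrD !bilinZr bilinZl; lra.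
Qed.

Lemma bilin_sqrD_le y z : bilin (fun i => y i + z i) (fun i => y i + z i) <=
  2 * bilin y y + 2 * bilin z z.
Proof.
rewrite bilin_sqrD.
have := Mpsd (fun i => y i + -1 * z i); rewrite bilin_sqrD !bilinZr bilinZl; lra.
Qed.
End Bilinear.

Section Ridge.
Variables (n : nat) (K : R -> R -> R) (lam : R) (x : 'I_n -> R).
Hypothesis n0 : (0 < n)%N.
Hypothesis lam0 : 0 < lam.
Hypothesis Ksym : forall i j, K (x i) (x j) = K (x j) (x i).
Hypothesis Kpsd : forall v : 'I_n -> R,
  0 <= \sum_i \sum_j v i * v j * K (x i) (x j).

Let c := n%:R * lam.
Let c0 : 0 < c. Proof. by rewrite mulr_gt0// ltr0n. Qed.
Let A := gram K x + c%:M.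
Let M := ridge_inv K lam x.

Let gram_quad v : 0 <= bilin (gram K x) v v.
Proof.
apply: le_trans (Kpsd v) _; rewrite le_eqVlt; apply/orP; left; apply/eqP.
by apply: eq_bigr => i _; apply: eq_bigr => j _; rewrite mxE mulrAC.
Qed.

Let bilin_ridge v : bilin A v v = bilin (gram K x) v v + c * \sum_i v i ^+ 2.
Proof.
rewrite /bilin mulr_sumr -big_split; apply: eq_bigr => i _ /=.
under eq_bigr do rewrite mxE mulrDr mulrDl; rewrite big_split/=; congr (_ + _).
rewrite (bigD1 i)//= big1 ?addr0; first by rewrite mxE eqxx mulr1n; ring.
by move=> j ji; rewrite mxE eq_sym (negbTE ji) mulr0 mul0r.
Qed.

Lemma ridge_unit : A \in unitmx.
Proof.
rewrite -row_free_unit -kermx_eq0; apply/eqP/row_matrixP => i; rewrite row0.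
set v := row i _; have vA : v *m A = 0.
  by apply/eqP; rewrite -sub_kermx; exact: row_sub.
have : bilin A (fun j => v 0 j) (fun j => v 0 j) = 0.
  rewrite -bilinE (_ : \row_j v 0 j = v) ?vA ?mul0mx ?mxE//.
  by apply/rowP => j; rewrite mxE.
rewrite bilin_ridge => E; have := gram_quad (fun j => v 0 j).
have S0 : 0 <= \sum_j v 0 j ^+ 2 by apply: sumr_ge0 => j _; exact: sqr_ge0.
have cS := mulr_ge0 (ltW c0) S0 => H.
have /eqP : c * \sum_j v 0 j ^+ 2 = 0 by lra.
rewrite mulf_eq0 gt_eqF//= psumr_eq0; last by move=> j _; exact: sqr_ge0.
move=> /allP H0; apply/rowP => j; rewrite [RHS]mxE.
by have := H0 j (mem_index_enum _); rewrite /= sqrf_eq0 => /eqP.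
Qed.

Lemma ridge_sym i j : M i j = M j i.
Proof.
have AT : A^T = A.
  by apply/matrixP => a b; rewrite !mxE eq_sym Ksym.
by rewrite -[in RHS](trmxK M) mxE; congr (fun_of_matrix _ _ _); rewrite /M /ridge_inv -/c -/A trmx_inv AT.
Qed.

Definition ridge_sol (k : 'I_n -> R) i : R := \sum_j M i j * k j.

Lemma ridge_solE k i :
  \sum_j K (x i) (x j) * ridge_sol k j + c * ridge_sol k i = k i.
Proof.
have : (A *m M *m (\col_i k i)) i 0 = k i.
  by rewrite mulmxV ?ridge_unit// mul1mx mxE.
rewrite -mulmxA mxE => <-.
have E j : (M *m \col_i k i) j 0 = ridge_sol k j.
  by rewrite mxE; apply: eq_bigr => l _; rewrite mxE.
under [RHS]eq_bigr do rewrite E mxE mulrDl; rewrite big_split/=; congr (_ + _).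
  by apply: eq_bigr => j _; rewrite mxE.
rewrite (bigD1 i)//= big1 ?addr0; first by rewrite mxE eqxx mulr1n.
by move=> j ji; rewrite mxE eq_sym (negbTE ji) mul0r.
Qed.

Lemma bilin_sol y k : bilin M y k = \sum_i y i * ridge_sol k i.
Proof.
by apply: eq_bigr => i _; rewrite mulr_sumr; apply: eq_bigr => j _; rewrite mulrA.
Qed.

(** With [v = M k], [k^T M k = v^T (gram + c) v]: statements about the inverse
    become statements about the kernel matrix. *)
Lemma bilin_ridge_inv k : bilin M k k =
  \sum_i \sum_j ridge_sol k i * ridge_sol k j * K (x i) (x j)
  + c * \sum_i ridge_sol k i ^+ 2.
Proof.
rewrite bilin_sol mulr_sumr -big_split; apply: eq_bigr => i _ /=.
rewrite -{1}(ridge_solE k i) mulrDl mulr_suml; congr (_ + _); last by ring.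
by apply: eq_bigr => j _; rewrite mulrC mulrA mulrAC.
Qed.

Lemma ridge_psd k : 0 <= bilin M k k.
Proof.
rewrite bilin_ridge_inv addr_ge0// mulr_ge0 ?(ltW c0)//.
by apply: sumr_ge0 => i _; exact: sqr_ge0.
Qed.

(** Since [1 - c M = gram M], this says that the smoother [gram M] has a
    nonnegative quadratic form. *)
Lemma ridge_le k : c * bilin M k k <= \sum_i k i ^+ 2.
Proof.
have -> : \sum_i k i ^+ 2 = \sum_i (\sum_j K (x i) (x j) * ridge_sol k j) ^+ 2
    + c * \sum_i \sum_j ridge_sol k i * ridge_sol k j * K (x i) (x j)
    + c * bilin M k k.
  rewrite bilin_ridge_inv [X in _ + X]mulrDr !mulr_sumr -!big_split.
  apply: eq_bigr => i _ /=.
  rewrite -{1}(ridge_solE k i).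
  have -> : \sum_j ridge_sol k i * ridge_sol k j * K (x i) (x j) =
    ridge_sol k i * \sum_j K (x i) (x j) * ridge_sol k j.
    by rewrite mulr_sumr; apply: eq_bigr => j _; ring.
  ring.
rewrite lerDr; apply: addr_ge0; last exact: mulr_ge0 (ltW c0) (Kpsd _).
by apply: sumr_ge0 => i _; exact: sqr_ge0.
Qed.

(** As a quadratic form, [c M] lies between 0 and the identity. *)
Lemma ridge_entry_le i j : `|c * M i j| <= 1.
Proof.
have bd l m : bilin M (fun a => (a == l)%:R) (fun a => (a == m)%:R) = M l m.
  rewrite /bilin (bigD1 l)//= [X in _ + X]big1 ?addr0; last first.
    by move=> a al; rewrite big1// => b _; rewrite (negbTE al) !mul0r.
  rewrite (bigD1 m)//= [X in _ + X]big1 ?addr0; last first.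
    by move=> a al; rewrite (negbTE al) mulr0.
  by rewrite !eqxx mul1r mulr1.
have dg l : 0 <= c * M l l <= 1.
  rewrite -bd mulr_ge0 ?(ltW c0) ?ridge_psd//=; apply: le_trans (ridge_le _) _.
  rewrite (bigD1 l)//= big1 ?addr0; first by rewrite eqxx expr1n.
  by move=> a al; rewrite (negbTE al) expr0n.
have := bilin_cauchy_schwarz ridge_sym ridge_psd (fun a => (a == i)%:R) (fun a => (a == j)%:R).
rewrite !bd => H.
rewrite -(@expr_le1 _ 2)// real_normK ?num_real//.
rewrite exprMn; apply: (@le_trans _ _ ((c * M i i) * (c * M j j))).
  rewrite (_ : _ * _ = c ^+ 2 * (M i i * M j j)); last by ring.
  by rewrite ler_wpM2l// sqr_ge0.
have /andP[? ?] := dg i; have /andP[? ?] := dg j.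
by rewrite mulr_ile1.
Qed.

(** Both sides are the trace of the smoother. Only the characteristic
    polynomial of [gram] is known; determinants of [gram + s] follow, then the
    characteristic polynomial of [M] at infinitely many points, hence the trace
    of [M]. *)
Lemma ridge_trace (u : 'I_n -> R) : char_poly (gram K x) = \prod_(i < n) ('X - (u i)%:P) ->
  \sum_i (1 - c * M i i) = \sum_i u i / (c + u i).
Proof.
move=> Hu.
have hornerU (m : nat) (v : 'I_m -> R) t :
    (\prod_(i < m) ('X - (v i)%:P)).[t] = \prod_(i < m) (t - v i).
  by rewrite horner_prod; apply: eq_bigr => i _; rewrite !hornerE.
have charE (B : 'M[R]_n) t : (char_poly B).[t] = \det (t%:M - B).
  rewrite /char_poly -[_.[_]]/(horner_eval t _) -det_map_mx; congr (\det _).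
  apply/matrixP => i j; rewrite !mxE rmorphB rmorphMn /= /horner_eval hornerX hornerC.
  by [].
have hc (a : R) : a ^+ n = \prod_(i < n) a by rewrite prodr_const card_ord.
have detS s : \det (gram K x + s%:M) = \prod_i (u i + s).
  have := charE (gram K x) (- s); rewrite Hu hornerU.
  have -> : (- s)%:M - gram K x = - (gram K x + s%:M).
    by rewrite raddfN/= opprD addrC.
  rewrite -(scaleN1r (gram K x + _)) detZ => H.
  have {}H : \prod_i (u i + s) * (-1) ^+ n = (-1) ^+ n * \det (gram K x + s%:M).
    rewrite -H hc -big_split; apply: eq_bigr => i _ /=; ring.
  apply: (@mulfI _ ((-1) ^+ n)); first by rewrite signr_eq0.
  by rewrite -H mulrC.
have A0 : \det A != 0 by have := ridge_unit; rewrite unitmxE unitfE.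
have cu i : u i + c != 0.
  by move: A0; rewrite /A detS => /prodf_neq0; apply.
have key t : t != 0 -> (char_poly M).[t] = \prod_i (t - (u i + c)^-1).
  move=> t0; rewrite charE; apply: (@mulfI _ (\det A)) => //.
  rewrite -det_mulmx mulmxBr mulmxV ?ridge_unit// mul_mx_scalar.
  have -> : t *: A - 1%:M = t *: (gram K x + (c - t^-1)%:M).
    rewrite /A !scalerDr -addrA; congr (_ + _).
    by rewrite !scale_scalar_mx -raddfB/= mulrBr divff.
  rewrite detZ detS /A detS hc -!big_split.
  by apply: eq_bigr => i _ /=; field; rewrite cu t0.
have EP : char_poly M = \prod_(i < n) ('X - ((u i + c)^-1)%:P).
  apply/eqP; rewrite -subr_eq0; apply/negP => /negP p0.
  set p := _ - _ in p0.
  have := @max_poly_roots _ p [seq (i.+1)%:R | i <- iota 0 (size p)] p0.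
  rewrite size_map size_iota ltnn => H; suff : false by [].
  apply: H.
    apply/allP => _ /mapP[i _ ->]; rewrite /root /p hornerD hornerN key ?pnatr_eq0//.
    by rewrite hornerU subrr.
  rewrite map_inj_uniq ?iota_uniq// => i j /eqP; rewrite eqr_nat eqSS => /eqP.
  by [].
have := char_poly_trace M n0; rewrite EP.
pose D : 'M[R]_n := diag_mx (\row_i (u i + c)^-1).
have := char_poly_trace D n0; rewrite char_poly_trig ?diag_mx_is_trig//.
have -> : \prod_(i < n) ('X - (D i i)%:P) = \prod_(i < n) ('X - ((u i + c)^-1)%:P).
  by apply: eq_bigr => i _; rewrite !mxE eqxx.
move=> -> /oppr_inj; rewrite mxtrace_diag => H.
rewrite sumrB -mulr_sumr -[\sum_i M i i]/(\tr M) -H mulr_sumr -sumrB.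
by apply: eq_bigr => i _; rewrite mxE; field; rewrite addrC cu.
Qed.

End Ridge.
End QuadraticForms.

(** * Real-valued integrals against a probability *)

Section RealIntegral.
Context d (T : measurableType d) (R : realType) (P : probability T R).
Variables (D : set T) (mD : measurable D).
Implicit Types f g : T -> R.

Notation integr f := (P.-integrable D (EFin \o f)).

Lemma EFin_Rintegral f : integr f ->
  (\int[P]_(x in D) (f x)%:E)%E = (\int[P]_(x in D) f x)%:E.
Proof. by move=> H; rewrite /Rintegral fineK//; exact: integrable_fin_num. Qed.

Lemma integr_measurable f : integr f -> measurable_fun D f.
Proof. by move=> H; apply/measurable_EFinP; exact: measurable_int H. Qed.

Lemma integrD f g : integr f -> integr g -> integr (fun x => f x + g x).
Proof. by move=> If Ig; have := integrableD mD If Ig. Qed.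

Lemma integrB f g : integr f -> integr g -> integr (fun x => f x - g x).
Proof. by move=> If Ig; have := integrableB mD If Ig. Qed.

Lemma integrZ c f : integr f -> integr (fun x => c * f x).
Proof. by move=> If; have := integrableZl mD c If. Qed.

Lemma Rintegral_cst_le c : 0 <= c -> \int[P]_(x in D) c <= c.
Proof.
move=> c0; rewrite Rintegral_cst// ler_piMr// -lee_fin fineK ?fin_num_measure//.
exact: probability_le1.
Qed.

Lemma integr_le f g : measurable_fun D f -> (forall x, D x -> `|f x| <= g x) ->
  integr g -> integr f.
Proof.
move=> mf fg; apply: le_integrable => //; first exact/measurable_EFinP.
by move=> x Dx; rewrite /= lee_fin; exact: le_trans (fg x Dx) (ler_norm _).
Qed.

Lemma integr_bounded f C : measurable_fun D f -> (forall x, D x -> `|f x| <= C) ->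
  integr f.
Proof.
move=> mf fC; apply: (integr_le mf fC).
exact: finite_measure_integrable_cst.
Qed.

Lemma integrM_bounded f g C : measurable_fun D f -> (forall x, D x -> `|f x| <= C) ->
  integr g -> integr (fun x => f x * g x).
Proof.
move=> mf fC Ig; apply: (@integr_le _ (fun x => C * `|g x|)).
- by apply: measurable_funM => //; exact: integr_measurable.
- by move=> x Dx; rewrite normrM ler_wpM2r// fC.
- by apply: integrZ; exact: integrable_norm.
Qed.

Lemma integrM_sqr f g : measurable_fun D f -> measurable_fun D g ->
  integr (fun x => f x ^+ 2) -> integr (fun x => g x ^+ 2) ->
  integr (fun x => f x * g x).
Proof.
move=> mf mg If Ig; apply: (@integr_le _ (fun x => f x ^+ 2 + g x ^+ 2)).
- exact: measurable_funM.
- move=> x Dx; rewrite normrM -(real_normK (num_real (f x))) -(real_normK (num_real (g x))).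
  have := sqr_ge0 (`|f x| - `|g x|); have := sqr_ge0 (`|f x| + `|g x|); lra.
- exact: integrD.
Qed.

Lemma integr_sum n (f : nat -> T -> R) : (forall i, (i < n)%N -> integr (f i)) ->
  integr (fun x => \sum_(i < n) f i x).
Proof.
elim: n => [|n IH] H.
  rewrite (_ : (fun x => _) = cst 0); last by apply/funext => x; rewrite big_ord0.
  exact: finite_measure_integrable_cst.
rewrite (_ : (fun x => _) = fun x => \sum_(i < n) f i x + f n x); last first.
  by apply/funext => x; rewrite big_ord_recr.
by apply: integrD; [apply: IH => i im; apply: H; exact: leqW|exact: H].
Qed.

Lemma Rintegral_sum n (f : nat -> T -> R) : (forall i, (i < n)%N -> integr (f i)) ->
  \int[P]_(x in D) (\sum_(i < n) f i x) = \sum_(i < n) \int[P]_(x in D) f i x.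
Proof.
elim: n => [|n IH] H.
  rewrite (@eq_Rintegral _ _ _ _ _ (cst 0)); last by move=> x _; rewrite big_ord0.
  by rewrite big_ord0 Rintegral_cst// mul0r.
rewrite (@eq_Rintegral _ _ _ _ _ (fun x => \sum_(i < n) f i x + f n x)); last first.
  by move=> x _; rewrite big_ord_recr.
rewrite RintegralD//; last by apply: H.
  by rewrite big_ord_recr/= IH// => i im; apply: H; exact: leqW.
by apply: integr_sum => i im; apply: H; exact: leqW.
Qed.

Lemma markov_abs f e : integr f -> 0 < e ->
  (P (D `&` [set x | (e <= `|f x|)%R]) <= ((\int[P]_(x in D) `|f x|) / e)%:E)%E.
Proof.
move=> If e0.
have mf := integr_measurable If.
have -> : [set x | e <= `|f x|] = [set x | (e%:E <= `|(EFin \o f) x|)%E] by [].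
have IN : integr (fun x => `|f x|) by exact: integrable_norm.
rewrite EFinM -EFin_Rintegral// lee_pdivlMr//.
have := @le_integral_abse _ _ _ P D mD (EFin \o f) e (measurable_int _ If) e0.
by move=> H; rewrite muleC.
Qed.

Lemma Rintegral_dominated (f_ : nat -> T -> R) f g :
  (forall n, measurable_fun D (f_ n)) -> measurable_fun D f ->
  (forall x, D x -> f_ n x @[n --> \oo] --> f x) -> integr g ->
  (forall n x, D x -> `|f_ n x| <= g x) ->
  \int[P]_(x in D) f_ n x @[n --> \oo] --> \int[P]_(x in D) f x.
Proof.
move=> mf_ mf fcv Ig fg.
have := @dominated_convergence _ _ _ P D mD (fun n x => (f_ n x)%:E) (EFin \o f) (EFin \o g).
case.
- by move=> n; exact/measurable_EFinP.
- exact/measurable_EFinP.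
- by apply: aeW => x Dx; apply: cvg_EFin; [exact: nearW|exact: fcv].
- exact: Ig.
- by apply: aeW => x n Dx; rewrite /= lee_fin fg.
move=> If _ H.
have If_ n : integr (f_ n) by apply: integr_le Ig => //; exact: fg.
by move: H; rewrite /= EFin_Rintegral// => /fine_cvg.
Qed.
End RealIntegral.

(** * Independence *)

Section Independence.
Context d (T : measurableType d) (R : realType) (P : probability T R).
Implicit Types U W : T -> R.

Notation integr f := (P.-integrable setT (EFin \o f)).

Definition independent2 U W := forall B C : set R, measurable B -> measurable C ->
  P (U @^-1` B `&` W @^-1` C) = (P (U @^-1` B) * P (W @^-1` C))%E.

(** The law of [(U, W)] is the product of the marginal laws, and Fubini's
    theorem applies. *)
Lemma integr_indepM U W : independent2 U W -> integr U -> integr W ->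
  integr (fun w => U w * W w) /\
  \int[P]_w (U w * W w) = (\int[P]_w U w) * (\int[P]_w W w).
Proof.
move=> UW IU IW.
have mU : measurable_fun setT U by exact: integr_measurable IU.
have mW : measurable_fun setT W by exact: integr_measurable IW.
pose U' : {mfun T >-> R} := HB.pack U (isMeasurableFun.Build _ _ _ _ _ mU).
pose W' : {mfun T >-> R} := HB.pack W (isMeasurableFun.Build _ _ _ _ _ mW).
pose m1 := distribution P U'; pose m2 := distribution P W'.
have mUW : measurable_fun setT (fun w => (U w, W w)) by exact: measurable_fun_pair.
pose V : {mfun T >-> (R * R)%type} :=
  HB.pack (fun w => (U w, W w)) (isMeasurableFun.Build _ _ _ _ _ mUW).
pose m := distribution P V.
have E X : measurable X -> (m1 \x m2)%E X = m X.
  move=> mX; exact: (@product_measure_unique _ _ _ _ _ m1 m2 m).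
pose f (z : R * R) := (z.1 * z.2)%:E.
have mf : measurable_fun setT f.
  by apply/measurable_EFinP; apply: measurable_funM.
have mE : measurable_fun setT (@EFin R).
  by apply/(measurable_EFinP setT (@id R)); exact: measurable_id.
have IU' : m1.-integrable setT EFin by exact: (integrable_pushforward mU mE).
have IW' : m2.-integrable setT EFin by exact: (integrable_pushforward mW mE).
have EU : (\int[m1]_x x%:E = (\int[P]_w U w)%:E)%E.
  by rewrite -EFin_Rintegral//; exact: (integral_pushforward mU mE).
have EW : (\int[m2]_x x%:E = (\int[P]_w W w)%:E)%E.
  by rewrite -EFin_Rintegral//; exact: (integral_pushforward mW mE).
have If : (m1 \x m2)%E.-integrable setT f.
  apply/integrable12ltyP => //.
  have fin2 : (\int[m2]_y `|y%:E| < +oo)%E by have /integrableP[_] := IW'.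
  have fin1 : (\int[m1]_y `|y%:E| < +oo)%E by have /integrableP[_] := IU'.
  have ma : measurable_fun setT (fun y : R => `|y%:E|%E) by exact: measurableT_comp.
  rewrite (eq_integral (fun x : R => `|x%:E| * \int[m2]_y `|y%:E|)%E); last first.
    move=> x _; rewrite -ge0_integralZl//.
    by apply: eq_integral => y _; rewrite /f /= normrM EFinM.
  rewrite ge0_integralZr//; last by apply: integral_ge0.
  apply: lte_mul_pinfty => //; first by apply: integral_ge0.
  by rewrite ge0_fin_numE//; apply: integral_ge0.
have Im : m.-integrable setT f.
  have [_ H] := integrableP _ _ _ If; apply/integrableP; split=> //.
  by rewrite (@eq_measure_integral _ _ _ setT (m1 \x m2)%E)// => A mA _; exact: (esym (E A mA)).
have IfP : P.-integrable setT (f \o V).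
  have [_ H] := integrableP _ _ _ Im; apply/integrableP; split.
    exact: measurableT_comp.
  move: H; rewrite ge0_integral_pushforward//.
  exact: measurableT_comp.
split => //.
apply/EFin_inj; rewrite -EFin_Rintegral// EFinM -EU -EW.
transitivity (\int[m]_z f z)%E.
  by rewrite /m /distribution integral_pushforward.
rewrite (@eq_measure_integral _ _ _ setT (m1 \x m2)%E); last by move=> A mA _; exact: (esym (E A mA)).
rewrite -integral12_prod_meas1//.
rewrite (eq_integral (fun x : R => x%:E * \int[m2]_y y%:E)%E); last first.
  by move=> x _; rewrite /f -integralZl.
by rewrite EW integralZr.
Qed.

(** Both sides are finite measures in [A] that agree on a generating pi-system.
    *)
Lemma indep_sigma_algebra U (G : set (set T)) : measurable_fun setT U ->
  G `<=` measurable -> setI_closed G -> G setT ->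
  (forall A B, G A -> measurable B -> P (A `&` U @^-1` B) = (P A * P (U @^-1` B))%E) ->
  forall A B, <<s G >> A -> measurable B ->
  P (A `&` U @^-1` B) = (P A * P (U @^-1` B))%E.
Proof.
move=> mU Gm GI GT H A B sA mB.
have mUB : measurable (U @^-1` B) by rewrite -[_ @^-1` _]setTI; exact: mU.
have p0 : 0 <= fine (P (U @^-1` B)) by rewrite fine_ge0.
have pE : (fine (P (U @^-1` B)))%:E = P (U @^-1` B) by rewrite fineK// fin_num_measure.
have cov : \bigcup_(k in [set: nat]) [set: T] = setT by rewrite bigcup_const//; exists 0%N.
have U1 := @g_sigma_algebra_measure_unique _ _ _ G Gm (fun=> setT) (fun=> GT) cov
  (mrestr P mUB) (mscale (NngNum p0) P) GI.
have -> : P (A `&` U @^-1` B) = mrestr P mUB A by [].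
have mE C : mscale (NngNum p0) P C = (P C * P (U @^-1` B))%E.
  by rewrite muleC; congr (_ * _)%E; exact: pE.
rewrite U1//; first exact: mE.
- by move=> C GC; transitivity (P C * P (U @^-1` B))%E; [exact: H|exact: (esym (mE C))].
- by move=> _; apply: le_lt_trans (probability_le1 P _) (ltry 1); apply: measurableI.
Qed.

Lemma second_moment_sum n (U : nat -> T -> R) v :
  (forall i, (i < n)%N -> integr (fun w => U i w ^+ 2)) ->
  (forall i, (i < n)%N -> integr (U i)) ->
  (forall i, (i < n)%N -> \int[P]_w U i w = 0) ->
  (forall i, (i < n)%N -> \int[P]_w (U i w ^+ 2) <= v) ->
  (forall i j, (i < n)%N -> (j < n)%N -> i != j -> independent2 (U i) (U j)) ->
  integr (fun w => (\sum_(i < n) U i w) ^+ 2) /\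
  \int[P]_w ((\sum_(i < n) U i w) ^+ 2) <= n%:R * v.
Proof.
move=> I2 I1 E0 Ev ind.
have Iij i j : (i < n)%N -> (j < n)%N -> integr (fun w => U i w * U j w).
  move=> im jm; apply: integrM_sqr => //; [exact: integr_measurable (I1 i im)|
    exact: integr_measurable (I1 j jm)|exact: I2|exact: I2].
have E : (fun w => (\sum_(i < n) U i w) ^+ 2) =
    fun w => \sum_(i < n) \sum_(j < n) U i w * U j w.
  apply/funext => w; rewrite expr2 mulr_suml; apply: eq_bigr => i _.
  by rewrite mulr_sumr.
have Ii i : (i < n)%N -> integr (fun w => \sum_(j < n) U i w * U j w).
  by move=> im; exact: (integr_sum measurableT (fun j jm => Iij i j im jm)).
rewrite E; split; first exact: (integr_sum measurableT Ii).
rewrite (Rintegral_sum measurableT Ii).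
have -> : n%:R * v = \sum_(i < n) v by rewrite sumr_const card_ord mulr_natl.
apply: ler_sum => i _.
rewrite (Rintegral_sum measurableT (fun j jm => Iij i j (ltn_ord i) jm)).
rewrite (bigD1 i)//= big1 ?addr0; first by under eq_Rintegral do rewrite -expr2; exact: Ev.
move=> j ji; rewrite (integr_indepM _ _ _).2 ?E0 ?mul0r//; [|exact: I1|exact: I1].
by apply: ind => //; rewrite eq_sym.
Qed.
End Independence.

(** * The normal distribution *)

Section Gaussian.
Context {R : realType}.
Local Notation leb := (@lebesgue_measure R).
Implicit Types m s t x : R.

Lemma ge0_integral_normal_prob m s (f : R -> \bar R) : s != 0 ->
  measurable_fun setT f -> (forall x, (0 <= f x)%E) ->
  (\int[normal_prob m s]_x f x = \int[leb]_x (f x * (normal_pdf m s x)%:E))%E.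
Proof.
move=> s0 mf f0.
have dom : normal_prob m s `<< leb := normal_prob_dominates m s.
rewrite -(Radon_Nikodym_SigmaFinite.change_of_variables dom f0 measurableT mf).
apply: ae_eq_integral => //.
- apply: emeasurable_funM => //.
  exact: measurable_int (Radon_Nikodym_SigmaFinite.f_integrable dom).
- apply: emeasurable_funM => //; apply/measurable_EFinP; exact: measurable_normal_pdf.
- apply: ae_eqe_mul2l.
  apply: integral_ae_eq => //.
  + exact: Radon_Nikodym_SigmaFinite.f_integrable.
  + by apply/measurable_EFinP; exact: measurable_normal_pdf.
  + by move=> A _ mA; rewrite -Radon_Nikodym_SigmaFinite.f_integral.
Qed.

(** A linear exponential weight shifts the mean. *)
Lemma expR_mul_normal_pdf s t x : s != 0 ->
  expR (t * x) * normal_pdf 0 s x = expR (t ^+ 2 * s ^+ 2 / 2) * normal_pdf (t * s ^+ 2) s x.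
Proof.
move=> s0; rewrite !normal_pdfE// mulrCA [RHS]mulrCA; congr (_ * _).
rewrite /normal_fun -!expRD; congr expR; field; exact: s0.
Qed.

(** A quadratic exponential weight changes the variance [s^2] into [s'^2], with
    [1 / s'^2 = 1 / s^2 - 2 t]. *)
Lemma expR_sqr_mul_normal_pdf m s s' t x : 0 < s -> 0 < s' ->
  2 * t * (s ^+ 2 * s' ^+ 2) = s' ^+ 2 - s ^+ 2 ->
  expR (t * (x - m) ^+ 2) * normal_pdf m s x = s' / s * normal_pdf m s' x.
Proof.
move=> s0 s'0 H; rewrite !normal_pdfE ?gt_eqF//.
have -> : normal_peak s = s' / s * normal_peak s'.
  have E r : 0 < r -> normal_peak r = r^-1 * (Num.sqrt (pi *+ 2))^-1.
    move=> r0; rewrite /normal_peak -mulrnAr sqrtrM ?sqr_ge0// sqrtr_sqr gtr0_norm//.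
    by rewrite invfM.
  by rewrite !E//; set p := (Num.sqrt _)^-1; field; rewrite !gt_eqF.
rewrite mulrCA -!mulrA; congr (_ * (_ * (_ * _))).
rewrite /normal_fun -expRD; congr expR.
have -> : t = (s' ^+ 2 - s ^+ 2) / (2 * (s ^+ 2 * s' ^+ 2)).
  by rewrite -H; field; rewrite !gt_eqF.
by field; rewrite !gt_eqF.
Qed.

Lemma integral_expR_normal_prob s t : 0 < s ->
  (\int[normal_prob 0 s]_x (expR (t * x))%:E = (expR (t ^+ 2 * s ^+ 2 / 2))%:E)%E.
Proof.
move=> s0; rewrite ge0_integral_normal_prob ?gt_eqF//; last first.
  by apply/measurable_EFinP; apply: measurableT_comp => //; exact: mulrl_measurable.
under eq_integral do rewrite -EFinM expR_mul_normal_pdf ?gt_eqF// EFinM.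
rewrite ge0_integralZl ?integral_normal_pdf ?mule1//.
  by apply/measurable_EFinP; exact: measurable_normal_pdf.
by move=> x _; rewrite lee_fin normal_pdf_ge0.
Qed.

Lemma integral_expR_sqr_normal_prob m s s' t : 0 < s -> 0 < s' ->
  2 * t * (s ^+ 2 * s' ^+ 2) = s' ^+ 2 - s ^+ 2 ->
  (\int[normal_prob m s]_x (expR (t * (x - m) ^+ 2))%:E = (s' / s)%:E)%E.
Proof.
move=> s0 s'0 H; rewrite ge0_integral_normal_prob ?gt_eqF//; last first.
  apply/measurable_EFinP; apply: measurableT_comp => //.
  apply: measurable_funM => //; apply: measurable_funX.
  exact: measurable_funB.
under eq_integral do rewrite -EFinM (expR_sqr_mul_normal_pdf _ _ s0 s'0 H) EFinM.
rewrite ge0_integralZl ?integral_normal_pdf ?mule1//.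
- by apply/measurable_EFinP; exact: measurable_normal_pdf.
- by move=> x _; rewrite lee_fin normal_pdf_ge0.
- by rewrite lee_fin divr_ge0// ltW.
Qed.

(** Exponential Markov inequality for [exp ((x - m)^2 / (4 v))]. This weight
    doubles the variance, so that the constant is [sqrt 2], at most 2. *)
Lemma gaussian_tail m v V a : 0 <= v -> v <= V -> 0 < V -> 0 < a ->
  (gaussian m v [set x | (a <= `|x - m|)%R] <= (2 * expR (- (a ^+ 2 / (4 * V))))%:E)%E.
Proof.
move=> v0 vV V0 a0; rewrite /gaussian; case: eqVneq => [_|vne].
  rewrite diracE memNset ?lee_fin ?mulr_ge0 ?expR_ge0//=.
  by rewrite subrr normr0 leNgt a0.
have {}v0 : 0 < v by rewrite lt_neqAle eq_sym vne.
set s := Num.sqrt v.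
have s0 : 0 < s by rewrite sqrtr_gt0.
have sv : s ^+ 2 = v by rewrite sqr_sqrtr// ltW.
pose s' := s * Num.sqrt 2.
have s'0 : 0 < s' by rewrite mulr_gt0// sqrtr_gt0.
have s'v : s' ^+ 2 = 2 * v by rewrite /s' exprMn sv sqr_sqrtr// mulrC.
have mA : measurable [set x : R | (a <= `|x - m|)%R].
  rewrite -[X in measurable X]setTI.
  apply: measurable_fun_ler => //.
  by apply: measurableT_comp => //; exact: measurable_funB.
pose c := (4 * v)^-1.
have c0 : 0 < c by rewrite invr_gt0 mulr_gt0.
have mE : measurable_fun setT (fun x : R => expR (c * (x - m) ^+ 2)).
  apply: measurableT_comp => //.
  apply: measurable_funM => //; apply: measurable_funX.
  exact: measurable_funB.
have EI : (\int[normal_prob m s]_x (expR (c * (x - m) ^+ 2))%:E = (s' / s)%:E)%E.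
  apply: integral_expR_sqr_normal_prob => //; rewrite sv s'v /c.
  by field; rewrite gt_eqF.
have -> : normal_prob m s [set x | (a <= `|x - m|)%R] =
    (\int[normal_prob m s]_x (\1_[set x | (a <= `|x - m|)%R] x)%:E)%E.
  by rewrite integral_indic// setIT.
apply: (@le_trans _ _ (\int[normal_prob m s]_x ((expR (- (c * a ^+ 2)))%:E *
    (expR (c * (x - m) ^+ 2))%:E))%E).
  apply: ge0_le_integral => //.
  - exact/measurable_EFinP.
  - by apply/measurable_EFinP; exact: measurable_funM.
  - move=> x _; rewrite -EFinM lee_fin indicE; case: (boolP (x \in _)) => [|_].
      rewrite inE /= => ax; rewrite -expRD -[1%:R]expR0 ler_expR addrC subr_ge0.
      rewrite ler_pM2l// -(real_normK (num_real (x - m))) ler_sqr ?nnegrE//.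
      exact: ltW.
    by rewrite mulr_ge0// expR_ge0.
rewrite ge0_integralZl//; last exact/measurable_EFinP.
rewrite EI -EFinM lee_fin mulrC; apply: ler_pM.
- by rewrite divr_ge0// ltW.
- exact: expR_ge0.
- rewrite /s' mulrAC divff ?gt_eqF// mul1r.
  rewrite -(@ler_pXn2r _ 2%N) ?nnegrE ?sqrtr_ge0// sqr_sqrtr//.
  by rewrite expr2; lra.
- rewrite ler_expR lerN2 /c mulrC ler_pM2r ?exprn_gt0//.
  by rewrite lef_pV2 ?posrE ?mulr_gt0// ler_pM2l.
Qed.
Lemma le1p_sqr_expR (y : R) : 0 <= y -> y ^+ 2 <= 4 * expR y.
Proof.
move=> y0; have := expR_ge1Dx (y / 2) => H.
have : (y / 2) ^+ 2 <= expR (y / 2) ^+ 2.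
  by rewrite ler_sqr ?nnegrE ?expR_ge0 ?divr_ge0//; lra.
rewrite -expRM_natl (_ : 2%:R * (y / 2) = y); last by field.
lra.
Qed.

(** First order comparison in [t] at 0, from both sides. Taking [t]
    proportional to [v - S] makes the first order term a positive multiple of
    [(v - S)^2], and the factor [tau] makes the other terms smaller. *)
Lemma eq_of_expansion (v S : R) : 0 <= v -> 0 < S ->
  (forall t, 2 * t * S < 1 -> 0 <= 1 + t * v -> (1 + t * v) ^+ 2 * (1 - 2 * t * S) <= 1) ->
  v = S.
Proof.
move=> v0 s2 H.
apply/eqP; rewrite -subr_eq0; apply: contraT => d0.
have [dd ddE] : exists dd, v - S = dd by exists (v - S).
rewrite ddE in d0.
pose Q := `|dd| * (2 * S + v) + `|v ^+ 2 - 4 * v * S| + 2 * `|dd| * v ^+ 2 * S + 1.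
have nd0 : 0 < `|dd| by rewrite normr_gt0.
have Q1 : 0 <= `|dd| * (2 * S + v) by rewrite mulr_ge0// addr_ge0// mulr_ge0// ltW.
have Q2 : 0 <= 2 * `|dd| * v ^+ 2 * S by rewrite !mulr_ge0// ?sqr_ge0 ?ltW.
have Q3 := normr_ge0 (v ^+ 2 - 4 * v * S).
have Q0 : 1 <= Q by rewrite /Q; lra.
pose tau := Q^-1.
have Qp : 0 < Q by lra.
have tau0 : 0 < tau by rewrite invr_gt0.
have tau1 : tau <= 1 by rewrite invf_le1.
have tQ : tau * Q = 1 by rewrite /tau mulVf// gt_eqF.
have tb : tau * (`|dd| * (2 * S + v)) < 1.
  by rewrite -[X in _ < X]tQ ltr_pM2l// /Q; lra.
have dn : - `|dd| <= dd <= `|dd| by rewrite -ler_norml.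
have /andP[dn1 dn2] := dn.
have c1 : 2 * (tau * dd) * S < 1.
  have : tau * (`|dd| * (2 * S)) <= tau * (`|dd| * (2 * S + v)).
    by rewrite ler_pM2l// ler_pM2l// lerDl.
  have : tau * (dd * (2 * S)) <= tau * (`|dd| * (2 * S)).
    by rewrite ler_pM2l// ler_pM2r// mulr_gt0.
  lra.
have c2 : 0 <= 1 + tau * dd * v.
  have : tau * (`|dd| * v) <= tau * (`|dd| * (2 * S + v)).
    by rewrite ler_pM2l// ler_pM2l//; lra.
  have : - (tau * (`|dd| * v)) <= tau * (dd * v).
    by rewrite -mulrN -mulNr ler_pM2l// ler_wpM2r.
  lra.
have {H} := H _ c1 c2.
have d2 : 0 < dd ^+ 2 by rewrite exprn_even_gt0.
have -> : (1 + tau * dd * v) ^+ 2 * (1 - 2 * (tau * dd) * S) = 1 + tau * dd ^+ 2 *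
   (2 + tau * (v ^+ 2 - 4 * v * S) - 2 * tau ^+ 2 * dd * v ^+ 2 * S).
  rewrite -ddE.
  ring.
rewrite -subr_ge0 opprD addrA subrr sub0r oppr_ge0.
rewrite pmulr_rle0; last by rewrite mulr_gt0.
have : tau * (- `|v ^+ 2 - 4 * v * S|) <= tau * (v ^+ 2 - 4 * v * S).
  by rewrite ler_pM2l// lerNl -normrN ler_norm.
have : 2 * tau ^+ 2 * dd * v ^+ 2 * S <= tau * (2 * `|dd| * v ^+ 2 * S).
  apply: (@le_trans _ _ (tau ^+ 2 * (2 * `|dd| * v ^+ 2 * S))).
    rewrite (_ : 2 * tau ^+ 2 * dd * v ^+ 2 * S = tau ^+ 2 * (2 * v ^+ 2 * S * dd)); last by ring.
    rewrite (_ : 2 * `|dd| * v ^+ 2 * S = 2 * v ^+ 2 * S * `|dd|); last by ring.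
    by rewrite ler_wpM2l ?sqr_ge0// ler_wpM2l// !mulr_ge0// ?sqr_ge0// ltW.
  by rewrite ler_wpM2r// expr2 ger_pMl.
have : tau * (`|v ^+ 2 - 4 * v * S| + 2 * `|dd| * v ^+ 2 * S) <= tau * Q.
  by rewrite ler_pM2l// /Q; lra.
rewrite tQ mulrDr; lra.
Qed.

Section Moments.
Variable s : R.
Hypothesis s0 : 0 < s.
Let N := normal_prob 0 s.
Notation integr f := (N.-integrable setT (EFin \o f)).

Let Iexp_sqr t : 2 * t * s ^+ 2 < 1 ->
  integr (fun x => expR (t * x ^+ 2)) /\
  \int[N]_x expR (t * x ^+ 2) = (Num.sqrt (1 - 2 * t * s ^+ 2))^-1.
Proof.
move=> ts; set a := Num.sqrt _.
have a0 : 0 < a by rewrite sqrtr_gt0 subr_gt0.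
have a2 : a ^+ 2 = 1 - 2 * t * s ^+ 2 by rewrite sqr_sqrtr// subr_ge0 ltW.
have E : (\int[N]_x (expR (t * x ^+ 2))%:E = (a^-1)%:E)%E.
  have := @integral_expR_sqr_normal_prob 0 s (s / a) t s0 (divr_gt0 s0 a0).
  under eq_integral do rewrite subr0.
  move=> ->; first by congr EFin; field; rewrite !gt_eqF.
  rewrite expr_div_n a2; field.
  by rewrite -a2 sqrf_eq0 gt_eqF.
split; last by rewrite /Rintegral E.
apply/integrableP; split.
  apply/measurable_EFinP; apply: measurableT_comp => //.
  by apply: measurable_funM => //; exact: measurable_funX.
under eq_integral do rewrite /= ger0_norm ?expR_ge0//.
by rewrite E ltry.
Qed.

Lemma normal_integr4 : integr (fun x => x ^+ 4).
Proof.
have t4 : 2 * (4 * s ^+ 2)^-1 * s ^+ 2 < 1.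
  rewrite (_ : _ * _ = 2^-1); last by field; rewrite gt_eqF.
  by rewrite invf_lt1// ltr1n.
have [I _] := Iexp_sqr t4.
apply: (@integr_le _ _ _ N setT measurableT _ (fun x => (4 * (4 * s ^+ 2) ^+ 2) * expR ((4 * s ^+ 2)^-1 * x ^+ 2))).
- exact: measurable_funX.
- move=> x _; have s2 : 0 < 4 * s ^+ 2 by rewrite mulr_gt0// exprn_gt0.
  have y0 : 0 <= (4 * s ^+ 2)^-1 * x ^+ 2 by rewrite mulr_ge0 ?invr_ge0 ?sqr_ge0// ltW.
  have := le1p_sqr_expR y0; rewrite -(@ler_pM2l _ ((4 * s ^+ 2) ^+ 2)) ?exprn_gt0//.
  rewrite -exprMn mulrA divff ?gt_eqF// mul1r -exprM ger0_norm ?exprn_even_ge0//.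
  by move=> H; apply: le_trans H _; rewrite mulrCA mulrA.
- exact: integrZ.
Qed.

Lemma normal_integr2 : integr (fun x => x ^+ 2).
Proof.
apply: (@integr_le _ _ _ N setT measurableT _ (fun x => 1 + x ^+ 4)).
- exact: measurable_funX.
- move=> x _; rewrite ger0_norm ?sqr_ge0//.
  have := sqr_ge0 (x ^+ 2 - 1 / 2); have -> : x ^+ 4 = (x ^+ 2) ^+ 2 by rewrite -exprM.
  lra.
- apply: (@integrD _ _ _ N setT measurableT (fun=> 1)); last exact: normal_integr4.
  exact: finite_measure_integrable_cst.
Qed.

Lemma normal_integr1 : integr (fun x => x).
Proof.
apply: (@integr_le _ _ _ N setT measurableT _ (fun x => 1 + x ^+ 2)).
- exact: measurable_id.
- move=> x _; rewrite -(real_normK (num_real x)); have := sqr_ge0 (`|x| - 1 / 2); lra.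
- apply: (@integrD _ _ _ N setT measurableT (fun=> 1)); last exact: normal_integr2.
  exact: finite_measure_integrable_cst.
Qed.

Let N1 : \int[N]_x (1 : R) = 1.
Proof.
rewrite Rintegral_cst// mul1r.
exact: (congr1 fine (probability_setT (normal_prob 0 s))).
Qed.

(** If [m] were not 0, the inequality [1 + t m <= E exp (t x) = exp (t^2 s^2 /
    2)] would fail for small [t] of the sign of [m]. *)
Lemma normal_mean : \int[N]_x x = 0.
Proof.
set m := Rintegral _ _ _; apply/eqP; apply: contraT => m0.
pose tau := (2 * s ^+ 2 + `|m| * s + 1)^-1.
have D0 : 0 < 2 * s ^+ 2 + `|m| * s + 1.
  by rewrite ltr_wpDl// addr_ge0// mulr_ge0// ?sqr_ge0// ltW.
have tau0 : 0 < tau by rewrite invr_gt0.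
have s2 := exprn_gt0 2 s0.
have ms0 : 0 <= `|m| * s by rewrite mulr_ge0// ltW.
have t1 : tau * s ^+ 2 <= 2^-1.
  rewrite /tau mulrC ler_pdivrMr// ; lra.
have t2 : tau * `|m| * s <= 1.
  rewrite /tau -mulrA mulrC ler_pdivrMr//; lra.
pose t := tau * m.
have It : integr (fun x => expR (t * x)).
  apply/integrableP; split.
    by apply/measurable_EFinP; apply: measurableT_comp => //; exact: mulrl_measurable.
  under eq_integral do rewrite /= ger0_norm ?expR_ge0//.
  by rewrite integral_expR_normal_prob// ltry.
have H : 1 + t * m <= expR (t ^+ 2 * s ^+ 2 / 2).
  have <- : \int[N]_x expR (t * x) = expR (t ^+ 2 * s ^+ 2 / 2).
    by rewrite /Rintegral integral_expR_normal_prob.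
  have I1 : integr (fun x => t * x) by exact: integrZ normal_integr1.
  have Ic : integr (fun=> 1) by exact: finite_measure_integrable_cst.
  have <- : \int[N]_x (1 + t * x) = 1 + t * m.
    rewrite RintegralD// RintegralZl//; last exact: normal_integr1.
    by rewrite N1.
  apply: le_Rintegral => //; first by apply: integrD.
  by move=> x _; exact: expR_ge1Dx.
set u := t ^+ 2 * s ^+ 2 / 2 in H.
have u2 : t ^+ 2 * s ^+ 2 = (tau * `|m| * s) ^+ 2.
  by rewrite /t !exprMn real_normK ?num_real//.
have u0 : 0 <= u by rewrite /u divr_ge0// mulr_ge0 ?sqr_ge0.
have u1 : u <= 1 / 2.
  by rewrite /u u2 ler_pM2r ?invr_gt0// expr_le1// !mulr_ge0// ltW.
have := expR_ge1Dx (- u); rewrite expRN => H2.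
have e0 := expR_gt0 u.
have H3 : expR u * (1 - u) <= 1 by rewrite -ler_pdivlMl// mulr1.
have mm : 0 < m ^+ 2 by rewrite exprn_even_gt0.
have : t * m = tau * m ^+ 2 by rewrite /t; ring.
have : u = tau * m ^+ 2 * (tau * s ^+ 2) / 2 by rewrite /u /t; field.
set q := tau * m ^+ 2 => uE tm.
have q0 : 0 < q by rewrite mulr_gt0.
have uq : u <= q / 4.
  by rewrite uE -mulrA ler_pM2l// ler_pdivrMr//; lra.
have : (1 + q) * (1 - u) <= 1.
  apply: le_trans H3; rewrite ler_wpM2r ?subr_ge0 -?tm//; lra.
nra.
Qed.

(** From [1 + t x^2 <= exp (t x^2)], whose mean is explicit, for small [t] of
    both signs. *)
Lemma normal_variance : \int[N]_x (x ^+ 2) = s ^+ 2.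
Proof.
set v := Rintegral _ _ _.
have v0 : 0 <= v by apply: Rintegral_ge0 => x _; exact: sqr_ge0.
have s2 := exprn_gt0 2 s0.
have H t : 2 * t * s ^+ 2 < 1 -> 0 <= 1 + t * v -> (1 + t * v) ^+ 2 * (1 - 2 * t * s ^+ 2) <= 1.
  move=> ts tv; have [It Et] := Iexp_sqr ts.
  have a0 : 0 < 1 - 2 * t * s ^+ 2 by rewrite subr_gt0.
  have I1 : integr (fun x => t * x ^+ 2) by exact: integrZ normal_integr2.
  have Ic : integr (fun=> 1) by exact: finite_measure_integrable_cst.
  have : 1 + t * v <= (Num.sqrt (1 - 2 * t * s ^+ 2))^-1.
    rewrite -Et; have <- : \int[N]_x (1 + t * x ^+ 2) = 1 + t * v.
      rewrite RintegralD// RintegralZl//; last exact: normal_integr2.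
      by rewrite N1.
    apply: le_Rintegral => //; first by apply: integrD.
    by move=> x _; exact: expR_ge1Dx.
  rewrite -ler_sqr ?nnegrE ?invr_ge0 ?sqrtr_ge0// exprVn sqr_sqrtr ?(ltW a0)//.
  by rewrite -[X in _ <= X -> _]div1r ler_pdivlMr.
by apply: eq_of_expansion.
Qed.
End Moments.
End Gaussian.

(** * Coefficients in an orthonormal basis *)

Section Mercer.
Context {R : realType} (PX : probability (measurableTypeR R) R).
Variables (mu : nat -> R) (phi : nat -> R -> R) (K : R -> R -> R).
Hypothesis HM : mercer_decomposition PX mu phi K.
Implicit Types (f g : R -> R) (x : R).

Local Notation I := (`[0%R, 1%R]%classic : set R).
Local Notation integr f := (PX.-integrable `[0%R, 1%R] (EFin \o f)).

Let mI : measurable (I : set (measurableTypeR R)). Proof. exact: measurable_itv. Qed.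
Let B := mercer_basis HM.

Lemma mem_itv01 x : I x -> 0 <= x <= 1. Proof. by rewrite /= in_itv. Qed.

Lemma L2_norm_integr f : measurable_fun I f -> (L2_norm PX f < +oo)%E ->
  integr (fun x => f x ^+ 2).
Proof.
move=> mf H; apply/integrableP; split.
  by apply/measurable_EFinP; exact: measurable_funX.
under eq_integral do rewrite /= ger0_norm ?sqr_ge0//.
move: H; rewrite /L2_norm; case: (integral _ _ _) => [r _|H|_].
- by rewrite ltry.
- by move: H; rewrite poweRyr ?invr_eq0 ?pnatr_eq0// ltxx.
- by [].
Qed.

Lemma phi_measurable i : measurable_fun I (phi i). Proof. exact: onb_measurable B i. Qed.

Lemma phi_integr2 i : integr (fun x => phi i x ^+ 2).
Proof. by apply: L2_norm_integr; [exact: phi_measurable|exact: onb_L2 B i]. Qed.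

Lemma integr_phi f i : measurable_fun I f -> integr (fun x => f x ^+ 2) ->
  integr (fun x => f x * phi i x).
Proof.
by move=> mf If; apply: integrM_sqr => //; [exact: phi_measurable|exact: phi_integr2].
Qed.

Lemma integr_bounded_sqr f C : measurable_fun I f ->
  (forall x, 0 <= x <= 1 -> `|f x| <= C) -> integr (fun x => f x ^+ 2).
Proof.
move=> mf fC; apply: (@integr_bounded _ _ _ PX I mI _ (C ^+ 2)).
  exact: measurable_funX.
move=> x /mem_itv01 x01; rewrite normrX; have := fC x x01 => H.
by rewrite ler_sqr ?nnegrE// (le_trans _ H).
Qed.

Lemma phi_integr i : integr (phi i).
Proof.
have := @integr_phi (fun=> 1) i (measurable_cst _).
rewrite (_ : (fun x => 1 * phi i x) = phi i); last by apply/funext => x; rewrite mul1r.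
by apply; apply: (@integr_bounded_sqr _ 1) => // x _; rewrite normr1.
Qed.

Lemma eq_coef f g i : (forall x, 0 <= x <= 1 -> f x = g x) -> coef PX phi f i = coef PX phi g i.
Proof.
by move=> fg; apply: eq_Rintegral => x; rewrite inE => /mem_itv01 x01; rewrite fg.
Qed.

Lemma coef_psum (c : nat -> R) N i :
  coef PX phi (fun x => \sum_(j < N) c j * phi j x) i = if (i < N)%N then c i else 0.
Proof.
have II j : integr (fun x => phi j x * phi i x).
  by apply: integr_phi; [exact: phi_measurable|exact: phi_integr2].
transitivity (\int[PX]_(x in `[0, 1]) (\sum_(j < N) c j * (phi j x * phi i x))).
  by apply: eq_Rintegral => x _; rewrite mulr_suml; apply: eq_bigr => j _; rewrite mulrA.
rewrite (Rintegral_sum mI (f := fun j x => c j * (phi j x * phi i x))); last first.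
  by move=> j _; exact: integrZ.
under eq_bigr do rewrite RintegralZl// -/(coef PX phi (phi _) i) (onb_orthonormal B).
case: ifPn => iN.
  rewrite (bigD1 (Ordinal iN))//= eqxx mulr1 big1 ?addr0// => j ji.
  by rewrite (_ : (j : nat) == i = false) ?mulr0//; apply: contraNF ji => /eqP ji; apply/eqP/val_inj.
rewrite big1// => j _; rewrite (_ : (j : nat) == i = false) ?mulr0//.
by apply: contraNF iN => /eqP <-.
Qed.

Lemma coefB f g i : measurable_fun I f -> measurable_fun I g ->
  integr (fun x => f x ^+ 2) -> integr (fun x => g x ^+ 2) ->
  coef PX phi (fun x => f x - g x) i = coef PX phi f i - coef PX phi g i.
Proof.
move=> mf mg If Ig; rewrite /coef -RintegralB//; [|exact: integr_phi|exact: integr_phi].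
by apply: eq_Rintegral => x _; rewrite mulrBl.
Qed.

Lemma bessel f N : measurable_fun I f -> integr (fun x => f x ^+ 2) ->
  \sum_(i < N) coef PX phi f i ^+ 2 <= \int[PX]_(x in `[0, 1]) (f x ^+ 2).
Proof.
move=> mf If; pose c := coef PX phi f.
pose g x := \sum_(j < N) c j * phi j x.
have Ifj j : integr (fun x => c j * (f x * phi j x)) by apply: integrZ => //; exact: integr_phi.
have Igp j : integr (fun x => g x * phi j x).
  rewrite (_ : (fun x => _) = fun x => \sum_(l < N) (c l * (phi l x * phi j x))).
    apply: (integr_sum mI (f := fun l x => c l * (phi l x * phi j x))) => l _; apply: integrZ => //.
    by apply: integr_phi; [exact: phi_measurable|exact: phi_integr2].
  by apply/funext => x; rewrite mulr_suml; apply: eq_bigr => l _; rewrite mulrA.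
have Igj j : integr (fun x => c j * (g x * phi j x)) by exact: integrZ.
have E x : (f x - g x) ^+ 2 = f x ^+ 2 - (\sum_(j < N) (c j * (f x * phi j x) + c j * (f x * phi j x)) -
    \sum_(j < N) c j * (g x * phi j x)).
  rewrite big_split/= (_ : \sum_(j < N) c j * (f x * phi j x) = f x * g x); last first.
    by rewrite mulr_sumr; apply: eq_bigr => j _; rewrite mulrCA.
  rewrite (_ : \sum_(j < N) c j * (g x * phi j x) = g x * g x); last first.
    by rewrite {2}/g mulr_sumr; apply: eq_bigr => j _; rewrite mulrCA.
  ring.
have : 0 <= \int[PX]_(x in `[0, 1]) ((f x - g x) ^+ 2).
  by apply: Rintegral_ge0 => x _; exact: sqr_ge0.
under eq_Rintegral do rewrite E.
have I1 : integr (fun x => \sum_(j < N) (c j * (f x * phi j x) + c j * (f x * phi j x))).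
  by apply: (integr_sum mI (f := fun j x => c j * (f x * phi j x) + c j * (f x * phi j x))) => j _; exact: integrD.
have I2 : integr (fun x => \sum_(j < N) c j * (g x * phi j x)).
  exact: (integr_sum mI (f := fun j x => c j * (g x * phi j x))).
rewrite RintegralB//; last exact: integrB.
rewrite RintegralB//.
rewrite (Rintegral_sum mI (f := fun j x => c j * (f x * phi j x) + c j * (f x * phi j x))); last by move=> j _; exact: integrD.
rewrite (Rintegral_sum mI (f := fun j x => c j * (g x * phi j x)))//.
under eq_bigr do rewrite RintegralD// RintegralZl ?integr_phi// -/(coef PX phi f _) -/(c _).
have -> : \sum_(j < N) \int[PX]_(x in `[0, 1]) (c j * (g x * phi j x)) = \sum_(j < N) c j * c j.
  apply: eq_bigr => j _; rewrite RintegralZl// -/(coef PX phi g j) /g coef_psum.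
  by rewrite ltn_ord.
rewrite -sumrB; under eq_bigr do rewrite addrK -expr2.
by rewrite subr_ge0.
Qed.

Lemma coef_cvg_unif (F : nat -> R -> R) f i :
  (forall N, measurable_fun I (F N)) -> (forall N, integr (fun x => F N x ^+ 2)) ->
  measurable_fun I f -> integr (fun x => f x ^+ 2) ->
  (forall e, 0 < e -> \forall N \near \oo, forall x, 0 <= x <= 1 -> `|F N x - f x| <= e) ->
  coef PX phi (F N) i @[N --> \oo] --> coef PX phi f i.
Proof.
move=> mF IF mf If H; apply/cvgrPdist_le => e e0.
set A := \int[PX]_(x in `[0, 1]) `|phi i x|.
have A0 : 0 <= A by apply: Rintegral_ge0 => x _.
have e1 : 0 < e / (A + 1) by rewrite divr_gt0// ltr_wpDl.
have := H _ e1; apply: filterS => N HN.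
rewrite distrC -coefB//.
have IFf : integr (fun x => (F N x - f x) * phi i x).
  apply: (@integrM_bounded _ _ _ PX I mI _ _ (e / (A + 1))).
  - exact: (measurable_funB (mF N) mf).
  - by move=> x /mem_itv01; exact: HN.
  - exact: phi_integr.
apply: le_trans (le_normr_Rintegral mI IFf) _.
apply: (@le_trans _ _ (\int[PX]_(x in `[0, 1]) (e / (A + 1) * `|phi i x|))).
  apply: le_Rintegral => //.
  - exact: integrable_norm IFf.
  - by apply: integrZ => //; exact: integrable_norm (phi_integr i).
  - by move=> x /mem_itv01 x01; rewrite normrM ler_wpM2r// HN.
rewrite RintegralZl//; last exact: integrable_norm (phi_integr i).
by rewrite -/A mulrAC ler_pdivrMr ?ltr_wpDl// ler_pM2l// lerDl.
Qed.
End Mercer.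

(** * The kernel and its derivatives in the Mercer basis *)

Section MercerKernel.
Context {R : realType} (PX : probability (measurableTypeR R) R).
Variables (mu : nat -> R) (phi : nat -> R -> R) (K : R -> R -> R).
Hypothesis HM : mercer_decomposition PX mu phi K.
Hypothesis HK : psd_kernel K.
Implicit Types (f g : R -> R) (x : R).

Local Notation I := (`[0%R, 1%R]%classic : set R).
Local Notation integr f := (PX.-integrable `[0%R, 1%R] (EFin \o f)).

Let mI : measurable (I : set (measurableTypeR R)). Proof. exact: measurable_itv. Qed.
Let mu0 i : 0 < mu i := mercer_gt0 HM i.
Let mphi := phi_measurable HM.

Lemma mercer_diag x : 0 <= x <= 1 ->
  \sum_(i < N) (Num.sqrt (mu i) * phi i x) ^+ 2 @[N --> \oo] --> K x x.
Proof.
move=> x01; have := mercer_sum HM x01 x01; apply: cvg_trans; apply: near_eq_cvg.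
apply: nearW => N; apply: eq_bigr => i _.
by rewrite exprMn sqr_sqrtr ?(ltW (mu0 i))//; ring.
Qed.

Lemma mercer_diag_le x m : 0 <= x <= 1 ->
  \sum_(i < m) (Num.sqrt (mu i) * phi i x) ^+ 2 <= K x x.
Proof.
move=> x01; apply: (@le_psum _ (fun i => (Num.sqrt (mu i) * phi i x) ^+ 2)); last exact: mercer_diag.
by move=> i; exact: sqr_ge0.
Qed.

Lemma mercer_cvg x x' : 0 <= x <= 1 -> 0 <= x' <= 1 ->
  \sum_(i < N) (Num.sqrt (mu i) * phi i x) * (Num.sqrt (mu i) * phi i x') @[N --> \oo] --> K x x'.
Proof.
move=> x01 x'01; have := mercer_sum HM x01 x'01; apply: cvg_trans; apply: near_eq_cvg.
apply: nearW => N; apply: eq_bigr => i _.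
by rewrite mulrACA -expr2 sqr_sqrtr ?(ltW (mu0 i))// mulrA.
Qed.

Lemma kernel_diag_bounded : exists2 C, 0 < C & forall x, 0 <= x <= 1 -> K x x <= C.
Proof.
have [C C0 H] := within01_bounded2 (kernel_continuous HK).
by exists C => // x x01; have := H x x x01 x01; rewrite ler_norml => /andP[].
Qed.

Lemma kernel_measurable x : 0 <= x <= 1 -> measurable_fun I (K x).
Proof.
move=> x01; apply: (@measurable_fun_cvg _ _ _ I
  (fun N x' => \sum_(i < N) mu i * phi i x * phi i x')).
- by move=> N; apply: measurable_sum => i; apply: measurable_funM => //; exact: mphi.
- by move=> x' /mem_itv01 x'01; exact: (mercer_sum HM).
Qed.

Lemma kernel_bounded : exists2 C, 0 < C & forall x x', 0 <= x <= 1 -> 0 <= x' <= 1 -> `|K x x'| <= C.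
Proof. exact: within01_bounded2 (kernel_continuous HK). Qed.

Lemma psum_measurable (c : nat -> R) N :
  measurable_fun I (fun x => \sum_(j < N) c j * phi j x).
Proof.
by apply: measurable_sum => i; apply: measurable_funM => //; exact: mphi.
Qed.

Lemma psum_integr2 (c : nat -> R) N : integr (fun x => (\sum_(j < N) c j * phi j x) ^+ 2).
Proof.
have -> : (fun x => (\sum_(j < N) c j * phi j x) ^+ 2) =
   fun x => \sum_(j < N) \sum_(l < N) (c j * c l) * (phi j x * phi l x).
  apply/funext => x; rewrite expr2 mulr_suml; apply: eq_bigr => j _.
  by rewrite mulr_sumr; apply: eq_bigr => l _; rewrite mulrACA.
apply: (integr_sum mI (f := fun j x => \sum_(l < N) (c j * c l) * (phi j x * phi l x))) => j _.
apply: (integr_sum mI (f := fun l x => (c j * c l) * (phi j x * phi l x))) => l _.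
by apply: integrZ => //; apply: (integr_phi HM _ (mphi j)); exact: (phi_integr2 HM j).
Qed.

(** The Mercer series of [K x] converges uniformly, because the Cauchy-Schwarz
    bound on its remainder does not depend on the second point; coefficients
    may then be taken term by term. *)
Lemma coef_kernel x i : 0 <= x <= 1 -> coef PX phi (K x) i = mu i * phi i x.
Proof.
move=> x01; have [C C0 HC] := kernel_diag_bounded.
have [C' C'0 HC'] := kernel_bounded.
pose F N x' := \sum_(j < N) (mu j * phi j x) * phi j x'.
have H1 : coef PX phi (F N) i @[N --> \oo] --> coef PX phi (K x) i.
  apply: (coef_cvg_unif HM).
  - by move=> N; exact: (psum_measurable (fun j => mu j * phi j x)).
  - by move=> N; exact: (psum_integr2 (fun j => mu j * phi j x)).
  - exact: kernel_measurable.
  - by apply: (@integr_bounded_sqr _ PX (K x) C'); [exact: kernel_measurable|move=> x' x'01; exact: HC'].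
  move=> e e0.
  have e1 : 0 < e ^+ 2 / C by rewrite divr_gt0// exprn_gt0.
  have /cvgrPdist_le/(_ _ e1) := mercer_diag x01.
  apply: filterS => N HN x' x'01.
  have := @cauchy_schwarz_tail _ (fun i => Num.sqrt (mu i) * phi i x) (fun i => Num.sqrt (mu i) * phi i x') _ C _ N (mercer_diag x01)
     (fun m => le_trans (mercer_diag_le m x'01) (HC _ x'01)) (mercer_cvg x01 x'01).
  have -> : \sum_(i < N) (Num.sqrt (mu i) * phi i x) * (Num.sqrt (mu i) * phi i x') = F N x'.
    by apply: eq_bigr => j _; rewrite mulrACA -expr2 sqr_sqrtr ?(ltW (mu0 j))// mulrA.
  rewrite distrC => H2; rewrite -ler_sqr ?nnegrE ?(ltW e0)// real_normK ?num_real//.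
  apply: le_trans H2 _; rewrite -ler_pdivlMr//; exact: le_trans (ler_norm _) HN.
have H2 : coef PX phi (F N) i @[N --> \oo] --> mu i * phi i x.
  apply: cvg_near_cst; near=> N; rewrite (coef_psum HM (fun j => mu j * phi j x)).
  by rewrite ifT//; near: N; exists i.+1.
exact: (cvg_unique _ H1 H2).
Unshelve. all: by end_near. Qed.

Section Derivatives.
Variable k : nat.
Hypothesis CK : C2k01 k K.

Let chK j x : (j <= k)%N -> 0 <= x <= 1 -> deriv_chain 0 1 j (fun l => Dn l (K x)).
Proof. by move=> jk x01; apply: derivable01n_chain; have [H _ _] := CK jk; exact: H. Qed.

Lemma dquot_mercer j N (F : R -> R) (f : nat -> R -> R) x :
  0 <= x <= 1 ->
  (forall y, 0 <= y <= 1 -> \sum_(i < m) f i y @[m --> \oo] --> F y) ->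
  \sum_(i < m) dquot j N (f i) x @[m --> \oo] --> dquot j N F x.
Proof.
move=> x01 H; have [c [p [Hp Hc]]] := @dquot_sum R j N.
rewrite Hc; under eq_fun do (under eq_bigr do rewrite Hc; rewrite exchange_big/=).
apply: (cvg_psum (g := fun m l => \sum_(i < m) c l * f i (p x l))
   (g' := fun l => c l * F (p x l))) => l lj.
by under eq_fun do rewrite -mulr_sumr; apply: cvgM; [exact: cvg_cst|apply: H; exact: Hp].
Qed.

Lemma dquotZ j N c f x : dquot j N (fun y => c * f y) x = c * dquot j N f x.
Proof.
have [c' [p [_ Hc]]] := @dquot_sum R j N.
by rewrite !Hc mulr_sumr; apply: eq_bigr => i _; rewrite mulrCA.
Qed.

Lemma dquot_kernel_cvg j N x x' : 0 <= x <= 1 -> 0 <= x' <= 1 ->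
  \sum_(i < m) (Num.sqrt (mu i) * dquot j N (phi i) x) * (Num.sqrt (mu i) * phi i x')
   @[m --> \oo] --> dquot j N (K x') x.
Proof.
move=> x01 x'01.
have := @dquot_mercer j N (K x') (fun i y => (Num.sqrt (mu i) * phi i x') * (Num.sqrt (mu i) * phi i y)) x x01
  (fun y y01 => mercer_cvg x'01 y01).
apply: cvg_trans; apply: near_eq_cvg; apply: nearW => m; apply: eq_bigr => i _.
by rewrite !dquotZ mulrC.
Qed.

Lemma dquot_kernel_diag_cvg j N x x' : 0 <= x <= 1 -> 0 <= x' <= 1 ->
  \sum_(i < m) (Num.sqrt (mu i) * dquot j N (phi i) x) * (Num.sqrt (mu i) * dquot j N (phi i) x')
   @[m --> \oo] --> dquot j N (fun z => dquot j N (K z) x') x.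
Proof.
move=> x01 x'01.
have := @dquot_mercer j N (fun z => dquot j N (K z) x')
  (fun i y => (Num.sqrt (mu i) * dquot j N (phi i) x') * (Num.sqrt (mu i) * phi i y)) x x01
  (fun y y01 => @dquot_kernel_cvg j N _ _ x'01 y01).
apply: cvg_trans; apply: near_eq_cvg; apply: nearW => m; apply: eq_bigr => i _.
by rewrite !dquotZ mulrC.
Qed.

(** By Cauchy-Schwarz in the Mercer series, the squared difference quotient in
    one variable is at most the quotient in both variables times the diagonal
    of [K]; the former is a value of the mixed derivative, which is continuous.
    *)
Lemma Dn_kernel_bounded j : (j <= k)%N -> exists2 C, 0 < C &
  forall x x', 0 <= x <= 1 -> 0 <= x' <= 1 -> `|Dn j (K x') x| <= C.
Proof.
move=> jk; have CKj : C2k01 j K by move=> l lj; apply: CK; exact: leq_trans jk.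
have [C1 C10 HC1] := dquot_mixed_bounded CKj.
have [C2 C20 HC2] := kernel_diag_bounded.
exists (C1 * C2 + 1); first by rewrite ltr_wpDl// mulr_ge0// ltW.
move=> x x' x01 x'01.
have H N : (dquot j N (K x') x) ^+ 2 <= C1 * C2.
  apply: (@cauchy_schwarz_lim _ (fun i => Num.sqrt (mu i) * dquot j N (phi i) x)
    (fun i => Num.sqrt (mu i) * phi i x') _ _ _ _ _ (@dquot_kernel_cvg j N _ _ x01 x'01)).
    move=> m; have Hd := @dquot_kernel_diag_cvg j N _ _ x01 x01.
    have := HC1 N x x x01 x01; rewrite ler_norml => /andP[_]; apply: le_trans.
    apply: (@le_psum _ (fun i => (Num.sqrt (mu i) * dquot j N (phi i) x) ^+ 2)) => [i|].
      exact: sqr_ge0.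
    by under eq_fun do under eq_bigr do rewrite expr2.
  by move=> m; apply: le_trans (mercer_diag_le m x'01) (HC2 _ x'01).
have H2 : (Dn j (K x') x) ^+ 2 <= C1 * C2.
  have Hc := dquot_cvg (chK jk x'01) x01.
  have Hc2 : dquot j N (K x') x ^+ 2 @[N --> \oo] --> (Dn j (K x') x) ^+ 2.
    by rewrite expr2; under eq_fun do rewrite expr2; exact: cvgM.
  by apply: (cvgr_to_le Hc2); apply: nearW.
move: H2; set y := Dn _ _ _; rewrite -(real_normK (num_real y)) => H2.
have := sqr_ge0 (`|y| - 1 / 2); lra.
Qed.

Lemma Dn_kernel_measurable j x : (j <= k)%N -> 0 <= x <= 1 ->
  measurable_fun I (fun x' => Dn j (K x') x).
Proof.
move=> jk x01; apply: (@measurable_fun_cvg _ _ _ I (fun N x' => dquot j N (K x') x)).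
  move=> N; have [c [p [Hp Hc]]] := @dquot_sum R j N.
  have -> : (fun x' => dquot j N (K x') x) = fun x' => \sum_(i < j.+1) c i * K x' (p x i).
    by apply/funext => x'; rewrite Hc.
  apply: measurable_sum => i; apply: measurable_funM => //.
  apply: (eq_measurable_fun (K (p x i))); last by apply: kernel_measurable; exact: Hp.
  by move=> x' /[!inE] /mem_itv01 x'01; apply: (kernel_sym HK) => //; exact: Hp.
by move=> x' /mem_itv01 x'01; exact: (dquot_cvg (chK jk x'01) x01).
Qed.

Lemma Dn_kernel_integr2 j x : (j <= k)%N -> 0 <= x <= 1 ->
  integr (fun x' => Dn j (K x') x ^+ 2).
Proof.
move=> jk x01; have [C C0 HC] := Dn_kernel_bounded jk.
apply: (@integr_bounded_sqr _ PX _ C); first exact: Dn_kernel_measurable.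
by move=> x' x'01; exact: HC.
Qed.

(** Since [mu_i phi_i (x)] is the i-th coefficient of [K x], the derivatives
    are obtained by differentiation under the integral, with the bounds on the
    kernel derivatives for domination. Arguing by contradiction provides the
    sequence along which dominated convergence is used. *)
Lemma phi_deriv i : derivable01n k (phi i) /\
  forall j x, (j <= k)%N -> 0 <= x <= 1 ->
    Dn j (phi i) x = (mu i)^-1 * coef PX phi (fun x' => Dn j (K x') x) i.
Proof.
pose F j x := (mu i)^-1 * coef PX phi (fun x' => Dn j (K x') x) i.
suff H : deriv_chain 0 1 k F.
  apply: (deriv_chain_Dn _ H) => x x01; rewrite /F.
  rewrite (_ : coef _ _ _ _ = mu i * phi i x) ?mulKf ?gt_eqF//.
  rewrite -coef_kernel//; apply: eq_coef => x' x'01 /=.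
  exact: (kernel_sym HK).
move=> j jk x x01 e e0.
apply: contrapT => Hno.
have Hn (n : nat) : exists y, [/\ 0 <= y <= 1, `|y - x| < n.+1%:R^-1 &
    e * `|y - x| < `|F j y - F j x - F j.+1 x * (y - x)|].
  apply: contrapT => H; apply: Hno; exists n.+1%:R^-1; first by rewrite invr_gt0.
  move=> y y01 yx; rewrite leNgt; apply/negP => L; apply: H; by exists y.
have [y Hy] := choice Hn.
have y01 n : 0 <= y n <= 1 by have [] := Hy n.
have ynx n : y n - x != 0.
  apply/eqP => E; have [_ _] := Hy n; rewrite (_ : y n = x) ?subrr ?mulr0 ?subr0 ?normr0 ?mulr0 ?ltxx//.
  by apply/eqP; rewrite -subr_eq0 E.
pose q n x' := (Dn j (K x') (y n) - Dn j (K x') x) / (y n - x).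
have [C C0 HC] := Dn_kernel_bounded jk.
have jk' := ltnW jk.
have [C' C'0 HC'] := Dn_kernel_bounded jk'.
have qC n x' : 0 <= x' <= 1 -> `|q n x'| <= C.
  move=> x'01; have := chK (leqnn k) x'01; move=> /(_ j jk) D.
  rewrite /q normrM normfV ler_pdivrMr ?normr_gt0//.
  have [yx|xy] := lerP (y n) x.
    have [z /andP[z1 z2] E] := deriv_on_MVT yx (deriv_on_sub (proj1 (andP (y01 n))) (proj2 (andP x01)) D).
    have yx0 : 0 <= x - y n by rewrite subr_ge0.
    rewrite distrC E normrM (ger0_norm yx0) ler_wpM2r//; apply: HC => //.
    by have /andP[? ?] := y01 n; move/andP: x01 => [? ?]; apply/andP; split; lra.
  have [z /andP[z1 z2] E] := deriv_on_MVT (ltW xy) (deriv_on_sub (proj1 (andP x01)) (proj2 (andP (y01 n))) D).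
  have xy0 : 0 <= y n - x by rewrite subr_ge0 ltW.
  rewrite E normrM (ger0_norm xy0) ler_wpM2r//; apply: HC => //.
  by have /andP[? ?] := y01 n; move/andP: x01 => [? ?]; apply/andP; split; lra.
have mq n : measurable_fun I (q n).
  apply: measurable_funM => //; apply: measurable_funB; exact: Dn_kernel_measurable.
have cq x' : 0 <= x' <= 1 -> q n x' @[n --> \oo] --> Dn j.+1 (K x') x.
  move=> x'01; apply/cvgrPdist_le => e' e'0.
  have D := chK (leqnn k) x'01 jk.
  have [d d0 Hd] := D x x01 e' e'0.
  near=> n.
  have yd : `|y n - x| < d.
    have [_ H _] := Hy n; apply: lt_trans H _.
    near: n; have /cvgrPdist_lt/(_ _ d0) := @cvg_harmonic R.
    by apply: filterS => n; rewrite sub0r normrN ger0_norm ?invr_ge0//.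
  have := Hd (y n) (y01 n) yd.
  rewrite (_ : Dn j (K x') (y n) - Dn j (K x') x - Dn j.+1 (K x') x * (y n - x) =
    - ((Dn j.+1 (K x') x - q n x') * (y n - x))); last by rewrite /q; field; exact: ynx.
  by rewrite normrN normrM ler_pM2r ?normr_gt0.
have cI : \int[PX]_(x' in `[0, 1]) (q n x' * phi i x') @[n --> \oo] -->
    coef PX phi (fun x' => Dn j.+1 (K x') x) i.
  apply: (@Rintegral_dominated _ _ _ PX I mI (fun n x' => q n x' * phi i x') _ (fun x' => C * `|phi i x'|)).
  - by move=> n; exact: (measurable_funM (mq n) (mphi i)).
  - exact: (measurable_funM (Dn_kernel_measurable jk x01) (mphi i)).
  - by move=> x' /mem_itv01 x'01; apply: cvgM; [exact: cq|exact: cvg_cst].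
  - by apply: integrZ => //; exact: integrable_norm (phi_integr HM i).
  - by move=> n x' /mem_itv01 x'01; rewrite normrM ler_wpM2r// qC.
have qE n : \int[PX]_(x' in `[0, 1]) (q n x' * phi i x') = mu i * ((F j (y n) - F j x) / (y n - x)).
  transitivity ((y n - x)^-1 * coef PX phi (fun x' => Dn j (K x') (y n) - Dn j (K x') x) i).
    rewrite -RintegralZl//.
      by apply: eq_Rintegral => x' _; rewrite /q; ring.
    apply: (integr_phi HM).
      by apply: measurable_funB; exact: Dn_kernel_measurable.
    apply: (@integr_bounded_sqr _ PX _ (C' + C')).
      by apply: measurable_funB; exact: Dn_kernel_measurable.
    move=> x' x'01; apply: le_trans (ler_normB _ _) _.
    by apply: lerD; exact: HC'.
  rewrite (coefB HM); [|exact: Dn_kernel_measurable|exact: Dn_kernel_measurable|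
    exact: Dn_kernel_integr2|exact: Dn_kernel_integr2].
  by rewrite /F; field; rewrite ynx gt_eqF.
have : mu i * ((F j (y n) - F j x) / (y n - x)) @[n --> \oo] --> mu i * F j.+1 x.
  have -> : mu i * F j.+1 x = coef PX phi (fun x' => Dn j.+1 (K x') x) i.
    by rewrite /F mulrA divff ?mul1r// gt_eqF.
  by rewrite -(funext qE).
move=> /cvgrPdist_le.
have e1 : 0 < mu i * e / 2 by rewrite divr_gt0// mulr_gt0.
move=> /(_ _ e1)[N _ /(_ N (leqnn N))] /=.
have [_ _] := Hy N.
rewrite (_ : F j (y N) - F j x - F j.+1 x * (y N - x) =
    - ((F j.+1 x - (F j (y N) - F j x) / (y N - x)) * (y N - x))); last by field; exact: ynx.
rewrite normrN normrM ltr_pM2r ?normr_gt0// => H1.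
rewrite -mulrBr normrM gtr0_norm// -mulrA ler_pM2l//; lra.
Unshelve. all: by end_near. Qed.
End Derivatives.
End MercerKernel.

Section MercerDerivatives.
Context {R : realType} (PX : probability (measurableTypeR R) R).
Variables (mu : nat -> R) (phi : nat -> R -> R) (K : R -> R -> R) (k : nat).
Hypothesis HM : mercer_decomposition PX mu phi K.
Hypothesis HK : psd_kernel K.
Hypothesis CK : C2k01 k K.
Variables (C S : R).
Hypothesis phiA : forall i x, 0 <= x <= 1 -> `|Dn k (phi i) x| <= C * i.+1%:R ^+ k.
Hypothesis HS : forall m, \sum_(i < m) mu i * i.+1%:R ^+ (2 * k) <= S.

Let mu0 i : 0 < mu i := mercer_gt0 HM i.
Let sq i : Num.sqrt (mu i) ^+ 2 = mu i. Proof. by rewrite sqr_sqrtr// ltW. Qed.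
Local Notation psi i := (Dn k (phi i)).

Let ch i : deriv_chain 0 1 k (fun j => Dn j (phi i)).
Proof. by apply: derivable01n_chain; have [] := phi_deriv HM HK CK i. Qed.

Let dq_le N i t : 0 <= t <= 1 -> `|dquot k N (phi i) t| <= C * i.+1%:R ^+ k.
Proof.
move=> t01; have [y [y01 _ ->]] := dquot_MVT N (ch i) t01; exact: phiA.
Qed.

Let wsum_cvg : exists S', \sum_(i < m) C ^+ 2 * (mu i * i.+1%:R ^+ (2 * k)) @[m --> \oo] --> (S' : R).
Proof.
have [|m|l _ Hl] := @psum_le_cvg R (fun i => C ^+ 2 * (mu i * i.+1%:R ^+ (2 * k))) (C ^+ 2 * S).
- by move=> i; rewrite mulr_ge0 ?sqr_ge0// mulr_ge0 ?(ltW (mu0 i))// exprn_ge0.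
- by rewrite -mulr_sumr ler_wpM2l// sqr_ge0.
by exists l.
Qed.

Let sqr_le i (z : R) : `|z| <= C * i.+1%:R ^+ k ->
  (Num.sqrt (mu i) * z) ^+ 2 <= C ^+ 2 * (mu i * i.+1%:R ^+ (2 * k)).
Proof.
move=> H; rewrite exprMn sq [X in _ <= X]mulrCA ler_pM2l// -(real_normK (num_real z)).
rewrite mulnC exprM -exprMn ler_sqr ?nnegrE//; exact: le_trans (normr_ge0 _) H.
Qed.

Let mul_le (a b : R) : `|a * b| <= a ^+ 2 + b ^+ 2.
Proof.
rewrite normrM -(real_normK (num_real a)) -(real_normK (num_real b)).
have := sqr_ge0 (`|a| - `|b|); have := sqr_ge0 (`|a| + `|b|); lra.
Qed.

(** Difference quotients of [phi_i] are values of its k-th derivative, so that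
    the growth bound on the latter dominates the Mercer series uniformly in the
    step. *)
Lemma partial01_mercer t x : 0 <= t <= 1 -> 0 <= x <= 1 ->
  \sum_(i < m) (Num.sqrt (mu i) * psi i t) * (Num.sqrt (mu i) * phi i x) @[m --> \oo]
    --> partial01 k K t x.
Proof.
move=> t01 x01; have [S' HS'] := wsum_cvg.
have [CK1 _ _] := CK (leqnn k).
have -> : partial01 k K t x = Dn k (K x) t.
  have [_ H] := eq_Dn (f := fun y => K y x) (fun y y01 => kernel_sym HK x01 y01) (CK1 x x01).
  exact: H.
apply: (@tannery R (fun N i => (Num.sqrt (mu i) * dquot k N (phi i) t) * (Num.sqrt (mu i) * phi i x))
  (fun i => (Num.sqrt (mu i) * psi i t) * (Num.sqrt (mu i) * phi i x)) (fun i => C ^+ 2 * (mu i * i.+1%:R ^+ (2 * k)) + (Num.sqrt (mu i) * phi i x) ^+ 2)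
  (fun N => dquot k N (K x) t) (S' + K x x)).
- move=> i; apply: cvgM; last exact: cvg_cst.
  by apply: cvgM; [exact: cvg_cst|exact: (dquot_cvg (ch i) t01)].
- move=> N i; apply: le_trans (mul_le _ _) _; rewrite lerD2r.
  by apply: sqr_le; exact: dq_le.
- rewrite (_ : (fun N => _) = fun N => \sum_(i < N) C ^+ 2 * (mu i * i.+1%:R ^+ (2 * k)) + \sum_(i < N) (Num.sqrt (mu i) * phi i x) ^+ 2).
    apply: cvgD; [exact: HS'|exact: (mercer_diag HM x01)].
  by apply/funext => N; rewrite big_split.
- by move=> N; exact: (dquot_kernel_cvg HM).
- exact: (dquot_cvg (derivable01n_chain (CK1 x x01)) t01).
Qed.

Lemma partial02_partial01 t x : 0 <= t <= 1 -> 0 <= x <= 1 -> partial02 k K x t = partial01 k K t x.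
Proof.
move=> t01 x01; have [CK1 _ _] := CK (leqnn k).
have [_ H] := eq_Dn (f := fun y => K y x) (fun y y01 => kernel_sym HK x01 y01) (CK1 x x01).
exact/esym/H.
Qed.

Lemma partial12_mercer t t' : 0 <= t <= 1 -> 0 <= t' <= 1 ->
  \sum_(i < m) (Num.sqrt (mu i) * psi i t) * (Num.sqrt (mu i) * psi i t') @[m --> \oo]
    --> partial12 k K t t'.
Proof.
move=> t01 t'01; have [S' HS'] := wsum_cvg.
apply: (@tannery R (fun N i => (Num.sqrt (mu i) * dquot k N (phi i) t) * (Num.sqrt (mu i) * dquot k N (phi i) t'))
  (fun i => (Num.sqrt (mu i) * psi i t) * (Num.sqrt (mu i) * psi i t')) (fun i => C ^+ 2 * (mu i * i.+1%:R ^+ (2 * k)) + C ^+ 2 * (mu i * i.+1%:R ^+ (2 * k)))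
  (fun N => dquot k N (fun z => dquot k N (K z) t') t) (S' + S')).
- move=> i; apply: cvgM.
    by apply: cvgM; [exact: cvg_cst|exact: (dquot_cvg (ch i) t01)].
  by apply: cvgM; [exact: cvg_cst|exact: (dquot_cvg (ch i) t'01)].
- move=> N i; apply: le_trans (mul_le _ _) _; apply: lerD.
    by apply: sqr_le; exact: dq_le.
  by apply: sqr_le; exact: dq_le.
- rewrite (_ : (fun N => _) = fun N => \sum_(i < N) C ^+ 2 * (mu i * i.+1%:R ^+ (2 * k)) + \sum_(i < N) C ^+ 2 * (mu i * i.+1%:R ^+ (2 * k))).
    by apply: cvgD; exact: HS'.
  by apply/funext => N; rewrite big_split.
- by move=> N; exact: (dquot_kernel_diag_cvg HM).
- exact: dquot_mixed_cvg.
Qed.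

End MercerDerivatives.

(** * Posterior variances as ridge residuals *)

Section PosteriorVariance.
Context {R : realType} (PX : probability (measurableTypeR R) R).
Variables (mu : nat -> R) (phi : nat -> R -> R) (K : R -> R -> R).
Hypothesis HM : mercer_decomposition PX mu phi K.
Hypothesis HK : psd_kernel K.
Let mu0 i : 0 < mu i := mercer_gt0 HM i.

(** Normalized so that the squares sum to the effective dimension at [x]. *)
Definition shrunk (lam : R) i x : R := Num.sqrt (mu i / (lam + mu i)) * phi i x.

(** The Gram matrix of the functions [shrunk] under the empirical measure of
    the sample, minus its mean under the design law. *)
Definition gram_error n (lam : R) (x : 'I_n -> R) (i j : nat) : R :=
  n%:R^-1 * \sum_l shrunk lam i (x l) * shrunk lam j (x l) - (i == j)%:R * (mu i / (lam + mu i)).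

Variables (n : nat) (lam : R) (x : 'I_n -> R).
Hypothesis n0 : (0 < n)%N.
Hypothesis lam0 : 0 < lam.
Hypothesis x01 : forall l, 0 <= x l <= 1.

Let n0R : (0 : R) < n%:R. Proof. by rewrite ltr0n. Qed.
Let lm i : 0 < lam + mu i. Proof. by rewrite addr_gt0. Qed.
Let s i l := Num.sqrt (mu i) * phi i (x l).
Let M := ridge_inv K lam x.

Lemma kernel_sample_sym i j : K (x i) (x j) = K (x j) (x i).
Proof. exact: (kernel_sym HK). Qed.

Lemma kernel_sample_psd (v : 'I_n -> R) : 0 <= \sum_i \sum_j v i * v j * K (x i) (x j).
Proof. exact: (kernel_psd HK). Qed.

(** In the coordinates [c_i = sqrt (lam + mu_i) b_i] the quadratic form on the
    right is twice the identity plus twice the matrix [gram_error]; a Frobenius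
    norm at most [1/2] leaves at least the identity. *)
Lemma bilin_gram_error_ge N (b : nat -> R) :
  (\sum_(i < N) \sum_(j < N) gram_error lam x i j ^+ 2 <= 4^-1) ->
  \sum_(i < N) (lam + mu i) * b i ^+ 2 <=
  2 * (n%:R^-1 * \sum_l (\sum_(i < N) b i * s i l) ^+ 2 + \sum_(i < N) lam * b i ^+ 2).
Proof.
move=> HB; pose c i := Num.sqrt (lam + mu i) * b i.
have c2 i : c i ^+ 2 = (lam + mu i) * b i ^+ 2 by rewrite exprMn sqr_sqrtr// ltW.
have ce i l : b i * s i l = c i * shrunk lam i (x l).
  rewrite /c /shrunk /s sqrtrM ?(ltW (mu0 i))// sqrtrV ?(ltW (lm i))//.
  by field; rewrite gt_eqF// sqrtr_gt0.
pose Bc := \sum_(i < N) \sum_(j < N) c i * c j * gram_error lam x i j.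
have E : n%:R^-1 * \sum_l (\sum_(i < N) b i * s i l) ^+ 2 =
    Bc + \sum_(i < N) mu i * b i ^+ 2.
  transitivity (\sum_(i < N) \sum_(j < N) c i * c j * (n%:R^-1 * \sum_l shrunk lam i (x l) * shrunk lam j (x l))).
    transitivity (\sum_l \sum_(i < N) \sum_(j < N) n%:R^-1 * ((b i * s i l) * (b j * s j l))).
      rewrite mulr_sumr; apply: eq_bigr => l _; rewrite expr2 mulr_suml mulr_sumr.
      by apply: eq_bigr => i _; rewrite !mulr_sumr.
    rewrite exchange_big; apply: eq_bigr => i _; rewrite exchange_big; apply: eq_bigr => j _ /=.
    by rewrite !mulr_sumr; apply: eq_bigr => l _; rewrite !ce; ring.
  rewrite /Bc -big_split; apply: eq_bigr => i _ /=.
  transitivity (\sum_(j < N) (c i * c j * gram_error lam x i j + c i * c j * (((i : nat) == j)%:R * (mu i / (lam + mu i))))).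
    by apply: eq_bigr => j _; rewrite /gram_error; ring.
  rewrite big_split/=; congr (_ + _).
  rewrite (bigD1 i)//= eqxx mul1r big1 ?addr0; last first.
    move=> j ji; rewrite (_ : (i : nat) == j = false) ?mul0r ?mulr0//.
    by apply: contraNF ji => /eqP ij; apply/eqP/val_inj.
  rewrite -expr2 c2; field; by rewrite gt_eqF.
have Bc2 : Bc ^+ 2 <= (\sum_(i < N) c i ^+ 2) ^+ 2 * 4^-1.
  rewrite /Bc pair_big /=.
  apply: le_trans (cauchy_schwarz_sum (I := ('I_N * 'I_N)%type) (fun p => c p.1 * c p.2) (fun p => gram_error lam x p.1 p.2)) _.
  apply: ler_pM.
  - by apply: sumr_ge0 => p _; exact: sqr_ge0.
  - by apply: sumr_ge0 => p _; exact: sqr_ge0.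
  - rewrite -(pair_big xpredT xpredT (fun i j : 'I_N => (c i * c j) ^+ 2))/=.
    rewrite [X in _ <= X]expr2 mulr_suml; apply: ler_sum => i _; rewrite mulr_sumr.
    by apply: ler_sum => j _; rewrite exprMn.
  - by rewrite -(pair_big xpredT xpredT (fun i j : 'I_N => gram_error lam x i j ^+ 2))/=.
set D := \sum_(i < N) c i ^+ 2 in Bc2.
have D0 : 0 <= D by apply: sumr_ge0 => i _; exact: sqr_ge0.
have Bge : - (D / 2) <= Bc.
  have : `|Bc| <= D / 2.
    rewrite -ler_sqr ?nnegrE ?divr_ge0// real_normK ?num_real//.
    by apply: le_trans Bc2 _; rewrite expr_div_n; lra.
  by rewrite ler_norml => /andP[].
rewrite E (eq_bigr (fun i : 'I_N => c i ^+ 2)); last by move=> i _; rewrite c2.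
rewrite -/D.
have -> : Bc + \sum_(i < N) mu i * b i ^+ 2 + \sum_(i < N) lam * b i ^+ 2 = Bc + D.
  by rewrite -addrA -big_split/=; congr (_ + _); apply: eq_bigr => i _; rewrite c2; ring.
lra.
Qed.

(* [w i] is [phi_i^(k)(t)], or the difference of its values at two points: the
   variance of the process and that of its increments are treated at once. *)
Variables (w : nat -> R) (kap W : R) (kv : 'I_n -> R).
Let ell i := Num.sqrt (mu i) * w i.
Hypothesis Hkap : \sum_(i < m) ell i * ell i @[m --> \oo] --> kap.
Hypothesis Hkv : forall l, \sum_(i < m) ell i * s i l @[m --> \oo] --> kv l.
Hypothesis HW : forall m, \sum_(i < m) mu i / (lam + mu i) * w i ^+ 2 <= W.

Let v := ridge_sol K lam x kv.
Let b i := (ell i - \sum_l v l * s i l) / lam.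
Let Q := lam^-1 * (kap - bilin M kv kv).

Let v_eq l : \sum_l' K (x l) (x l') * v l' + n%:R * lam * v l = kv l.
Proof. exact: (ridge_solE n0 lam0 kernel_sample_psd). Qed.

Let Hs l l' : \sum_(i < m) s i l * s i l' @[m --> \oo] --> K (x l) (x l').
Proof. exact: (mercer_cvg HM). Qed.

Let bs_cvg l : \sum_(i < m) b i * s i l @[m --> \oo] --> n%:R * v l.
Proof.
have -> : n%:R * v l = lam^-1 * (kv l - \sum_l' v l' * K (x l') (x l)).
  rewrite -v_eq; have -> : \sum_l' v l' * K (x l') (x l) = \sum_l' K (x l) (x l') * v l'.
    by apply: eq_bigr => l' _; rewrite kernel_sample_sym mulrC.
  by rewrite addrAC subrr add0r; field; rewrite gt_eqF.
have -> : (fun m => \sum_(i < m) b i * s i l) = fun m => lam^-1 *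
    (\sum_(i < m) ell i * s i l - \sum_l' v l' * \sum_(i < m) s i l' * s i l).
  apply/funext => m; rewrite (_ : \sum_l' v l' * \sum_(i < m) s i l' * s i l = \sum_(i < m) \sum_l' v l' * (s i l' * s i l)).
    rewrite -sumrB mulr_sumr; apply: eq_bigr => i _; under [X in _ = _ * (_ - X)]eq_bigr do rewrite mulrA.
    by rewrite -mulr_suml /b; ring.
  by under eq_bigr do rewrite mulr_sumr; rewrite exchange_big.
apply: cvgM; first exact: cvg_cst.
apply: cvgB; first exact: Hkv.
apply: cvg_big => [|l' _]; first by move=> z; exact: add_continuous.
by apply: cvgM; [exact: cvg_cst|exact: Hs].
Qed.

Let lb_cvg : \sum_(i < m) ell i * b i @[m --> \oo] --> Q.
Proof.
have -> : (fun m => \sum_(i < m) ell i * b i) = fun m => lam^-1 *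
    (\sum_(i < m) ell i * ell i - \sum_l v l * \sum_(i < m) ell i * s i l).
  apply/funext => m; rewrite (_ : \sum_l v l * \sum_(i < m) ell i * s i l = \sum_(i < m) \sum_l v l * (ell i * s i l)).
    rewrite -sumrB mulr_sumr; apply: eq_bigr => i _; under [X in _ = _ * (_ - X)]eq_bigr do rewrite mulrCA.
    by rewrite -mulr_sumr /b; ring.
  by under eq_bigr do rewrite mulr_sumr; rewrite exchange_big.
rewrite /Q bilin_sol; apply: cvgM; first exact: cvg_cst.
apply: cvgB; first exact: Hkap.
apply: cvg_big => [|l _]; first by move=> z; exact: add_continuous.
rewrite -/v mulrC; by apply: cvgM; [exact: cvg_cst|exact: Hkv].
Qed.

Let bb_cvg : \sum_(i < m) lam * b i ^+ 2 @[m --> \oo] --> Q - \sum_l v l * (n%:R * v l).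
Proof.
have -> : (fun m => \sum_(i < m) lam * b i ^+ 2) = fun m =>
    \sum_(i < m) ell i * b i - \sum_l v l * \sum_(i < m) b i * s i l.
  apply/funext => m; rewrite (_ : \sum_l v l * \sum_(i < m) b i * s i l = \sum_(i < m) \sum_l b i * (v l * s i l)).
    rewrite -sumrB; apply: eq_bigr => i _; rewrite -mulr_sumr.
    by rewrite {1}/b expr2 -/(b i); rewrite {1}/b; field; rewrite gt_eqF.
  by under eq_bigr do rewrite mulr_sumr; rewrite exchange_big; apply: eq_bigr => i _; apply: eq_bigr => l _; rewrite mulrCA.
apply: cvgB; first exact: lb_cvg.
apply: cvg_big => [|l _]; first by move=> z; exact: add_continuous.
by apply: cvgM; [exact: cvg_cst|exact: bs_cvg].
Qed.

Let Qge : \sum_l v l * (n%:R * v l) <= Q.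
Proof.
rewrite -subr_ge0; apply: (cvgr_to_ge bb_cvg); apply: nearW => m.
by apply: sumr_ge0 => i _; rewrite mulr_ge0 ?(ltW lam0) ?sqr_ge0.
Qed.

(** The normal equations for [v] give [Q] as a sum of squares, [n |v|^2 + lam
    |b|^2]. *)
Lemma posterior_variance_ge0 : 0 <= lam^-1 * (kap - bilin M kv kv).
Proof.
apply: le_trans Qge; apply: sumr_ge0 => l _.
by rewrite mulrCA -expr2 mulr_ge0 ?sqr_ge0// ltW.
Qed.

(** The normal equations give [Q = <ell, b> = |S b|^2 / n + lam |b|^2], where
    [S b] lists the values on the sample of the function with coordinates [b].
    By the Gram comparison, the sum of [(lam + mu_i) b_i^2] is at most [2 Q].
    Cauchy-Schwarz in [<ell, b>] then gives [Q^2 <= W (2 Q)]. *)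
Lemma posterior_variance_le :
  (forall N, \sum_(i < N) \sum_(j < N) gram_error lam x i j ^+ 2 <= 4^-1) ->
  lam^-1 * (kap - bilin M kv kv) <= 2 * W.
Proof.
move=> HB; rewrite -/Q; have Q0 : 0 <= Q := posterior_variance_ge0.
have W0 : 0 <= W by have := HW 0%N; rewrite big_ord0.
have DQ N : \sum_(i < N) (lam + mu i) * b i ^+ 2 <= 2 * Q.
  have H : 2 * (n%:R^-1 * \sum_l (\sum_(i < m) b i * s i l) ^+ 2 + \sum_(i < m) lam * b i ^+ 2) @[m --> \oo] -->
     2 * (n%:R^-1 * \sum_l (n%:R * v l) ^+ 2 + (Q - \sum_l v l * (n%:R * v l))).
    apply: cvgM; first exact: cvg_cst.
    apply: cvgD; last exact: bb_cvg.
    apply: cvgM; first exact: cvg_cst.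
    apply: cvg_big => [|l _]; first by move=> z; exact: add_continuous.
    rewrite expr2; under eq_fun do rewrite expr2.
    by apply: cvgM; exact: bs_cvg.
  have -> : 2 * Q = 2 * (n%:R^-1 * \sum_l (n%:R * v l) ^+ 2 + (Q - \sum_l v l * (n%:R * v l))).
    rewrite mulr_sumr addrCA -sumrB big1 ?addr0// => l _.
    by field; rewrite gt_eqF.
  apply: (cvgr_to_ge H); near=> m.
  apply: le_trans _ (bilin_gram_error_ge _ (HB m)).
  have Nm : (N <= m)%N by near: m; exists N.
  rewrite -!(big_mkord predT (fun i => (lam + mu i) * b i ^+ 2)) [X in _ <= X](big_cat_nat _ Nm)//=.
  by rewrite lerDl sumr_ge0// => i _; rewrite mulr_ge0 ?sqr_ge0// ltW.
have Q2 : Q ^+ 2 <= W * (2 * Q).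
  apply: (@cauchy_schwarz_lim _ (fun i => Num.sqrt (mu i / (lam + mu i)) * w i) (fun i => Num.sqrt (lam + mu i) * b i)).
  - move=> m; apply: le_trans (HW m); rewrite le_eqVlt; apply/orP; left; apply/eqP.
    by apply: eq_bigr => i _; rewrite exprMn sqr_sqrtr// divr_ge0// ltW.
  - move=> m; apply: le_trans (DQ m); rewrite le_eqVlt; apply/orP; left; apply/eqP.
    by apply: eq_bigr => i _; rewrite exprMn sqr_sqrtr// ltW.
  - have := lb_cvg; apply: cvg_trans; apply: near_eq_cvg; apply: nearW => m; apply: eq_bigr => i _.
    rewrite /ell sqrtrM ?(ltW (mu0 i))// sqrtrV ?(ltW (lm i))//.
    by field; rewrite gt_eqF// sqrtr_gt0.
move: Q2; rewrite mulrA (mulrC W) expr2.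
have [->|Qn] := eqVneq Q 0; first by move=> _; rewrite mulr_ge0.
by rewrite ler_pM2r// lt_neqAle eq_sym Qn.
Unshelve. all: by end_near. Qed.
End PosteriorVariance.

(** * Outer probabilities and dyadic chaining *)

Section OuterProbability.
Context d (T : measurableType d) (R : realType) (P : probability T R).
Local Notation "'Pstar' A" := ((P^*)%mu A) (at level 10, A at next level).

Lemma outer_measurable (A : set T) : measurable A -> Pstar A = P A.
Proof. exact: measurable_mu_extE. Qed.

Lemma outer_le (A B : set T) : A `<=` B -> (Pstar A <= Pstar B)%E.
Proof. by move=> AB; exact: le_outer_measure. Qed.

Lemma outerU (A B : set T) (a b : R) : (Pstar A <= a%:E)%E -> (Pstar B <= b%:E)%E ->
  (Pstar (A `|` B) <= (a + b)%:E)%E.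
Proof.
move=> Aa Bb; apply: le_trans (outer_measureU2 _ _ _) _.
by rewrite EFinD; exact: leeD.
Qed.

Lemma outer_finite_union (A : nat -> set T) n (c : R) : 0 <= c ->
  (forall i, (i < n)%N -> (Pstar (A i) <= c%:E)%E) ->
  (Pstar [set s | exists2 i, (i < n)%N & A i s] <= (n%:R * c)%:E)%E.
Proof.
move=> c0; elim: n => [|n IH] H.
  rewrite mul0r (_ : [set s | _] = set0) ?outer_measure0//.
  by apply/seteqP; split => // s [].
apply: (@le_trans _ _ (Pstar ([set s | exists2 i, (i < n)%N & A i s] `|` A n))).
  apply: outer_le => s [i]; rewrite ltnS leq_eqVlt => /predU1P[->|il] As; first by right.
  by left; exists i.
rewrite -natr1 mulrDl mul1r; apply: outerU; last exact: H.
by apply: IH => i il; apply: H; exact: leqW.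
Qed.

Lemma outer_countable_union (A : nat -> set T) (q : nat -> R) (c : R) :
  (forall i, (Pstar (A i) <= (q i)%:E)%E) ->
  (forall n, \sum_(i < n) q i <= c) ->
  (Pstar (\bigcup_i A i) <= c%:E)%E.
Proof.
move=> H Hc; apply: le_trans (outer_measure_sigma_subadditive _ _) _.
apply: lime_le; first by apply: is_cvg_nneseries => n _ _; exact: outer_measure_ge0.
apply: nearW => n; apply: (@le_trans _ _ (\sum_(0 <= i < n) (q i)%:E)%E).
  by apply: lee_sum => i _; exact: H.
by rewrite sumEFin lee_fin big_mkord.
Qed.
End OuterProbability.

Section Dyadic.
Context {R : realType}.

Definition dyadic j i : R := i%:R / 2 ^+ j.

Lemma dyadic01 j i : (i <= 2 ^ j)%N -> 0 <= dyadic j i <= 1.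
Proof.
move=> ij; rewrite /dyadic divr_ge0 ?exprn_ge0//= ler_pdivrMr ?exprn_gt0// mul1r.
by rewrite -natrX ler_nat.
Qed.

Lemma dyadicS j i : dyadic j.+1 (2 * i) = dyadic j i.
Proof. by rewrite /dyadic natrM exprS; field; rewrite expf_neq0. Qed.

Lemma dyadic_step j i : dyadic j i.+1 - dyadic j i = (2 ^+ j)^-1.
Proof. by rewrite /dyadic -natr1 mulrDl addrAC subrr add0r mul1r. Qed.

Lemma dyadic_dense (h : R -> R) c j0 : {within `[0, 1], continuous h} ->
  (forall j i, (j0 <= j)%N -> (i <= 2 ^ j)%N -> `|h (dyadic j i)| <= c) ->
  forall t, 0 <= t <= 1 -> `|h t| <= c.
Proof.
move=> /subspace_continuousP ch H t t01.
have /ch : `[0, 1]%classic t by rewrite /= in_itv.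
move=> /cvgrPdist_le Hc; apply/ler_addgt0Pl => e e0.
have [/= d d0 Hd] := Hc e e0.
have /cvgrPdist_lt/(_ _ d0)[N _ HN] := @cvg_expr R (2^-1) ltac:(by rewrite ger0_norm ?invr_ge0// invf_lt1 ?ltr1n).
pose j := maxn j0 N; pose i := Num.truncn (2 ^+ j * t).
have p0 : (0 : R) < 2 ^+ j by rewrite exprn_gt0.
have [t0 t1] := andP t01.
have /truncn_itv/andP[i1 i2] : 0 <= 2 ^+ j * t by rewrite mulr_ge0// ltW.
have ij : (i <= 2 ^ j)%N.
  rewrite -(ler_nat R) (le_trans i1)// natrX ler_piMr// ltW //.
have D1 : dyadic j i <= t by rewrite /dyadic ler_pdivrMr// mulrC.
have D2 : t < dyadic j i + (2 ^+ j)^-1.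
  by rewrite -(dyadic_step j i) addrC subrK /dyadic ltr_pdivlMr// mulrC.
have := Hd (dyadic j i) _ _; rewrite /= in_itv/= dyadic01// => Hx.
have {}Hx : `|h t - h (dyadic j i)| <= e.
  apply: Hx => //; rewrite ger0_norm ?subr_ge0//.
  have := HN j (leq_maxr _ _); rewrite /= sub0r normrN ger0_norm ?exprn_ge0 ?invr_ge0//.
  by rewrite exprVn; lra.
rewrite -(subrK (h (dyadic j i)) (h t)); apply: le_trans (ler_normD _ _) _.
by apply: lerD => //; apply: H => //; exact: leq_maxl.
Qed.
End Dyadic.

Section Chaining.
Context d (S : measurableType d) (R : realType) (Q : probability S R).
Variables (G : R -> S -> R) (V L : R).
Hypothesis V0 : 0 < V.
Hypothesis L0 : 0 < L.
Hypothesis tailG : forall t a, 0 <= t <= 1 -> 0 < a ->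
  ((Q^*)%mu [set s | (a <= `|G t s|)%R] <= (2 * expR (- (a ^+ 2 / (4 * V))))%:E)%E.
Hypothesis tailD : forall t t' a, 0 <= t <= 1 -> 0 <= t' <= 1 -> t' < t -> 0 < a ->
  ((Q^*)%mu [set s | (a <= `|G t s - G t' s|)%R] <=
   (2 * expR (- (a ^+ 2 / (4 * (L * (t - t') ^+ 2)))))%:E)%E.

(** Gaussian tails are applied to the [2^j0 + 1] points of the coarse grid. A
    finer level [m] adds increments between neighbours, with thresholds [be
    (3/4)^m] of total [4 be]: there are [2^(j0 + m + 1)] of them, with standard
    deviations of order [2^-(j0 + m)], so that the crude bound [exp (- y) <= 1
    / y] already leaves a geometric series, of ratio [8/9]. *)
Lemma chaining j0 al be : 0 < al -> 0 < be ->
  ((Q^*)%mu [set s | exists j i, [/\ (j0 <= j)%N, (i <= 2 ^ j)%N &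
     (al + 4 * be < `|G (dyadic j i) s|)%R]] <=
   ((2 ^+ j0 + 1) * (2 * expR (- (al ^+ 2 / (4 * V)))) + 36 * L / (be ^+ 2 * 2 ^+ j0))%:E)%E.
Proof.
move=> al0 be0.
pose A i := [set s | (al <= `|G (dyadic j0 i) s|)%R].
pose F m i := [set s | (be * (3 / 4) ^+ m <=
  `|G (dyadic (j0 + m).+1 i.+1) s - G (dyadic (j0 + m).+1 i) s|)%R].
pose BA := [set s | exists2 i, (i < (2 ^ j0).+1)%N & A i s].
pose BF m := [set s | exists2 i, (i < 2 ^ (j0 + m).+1)%N & F m i s].
apply: (@le_trans _ _ ((Q^*)%mu (BA `|` \bigcup_m BF m))).
  apply: outer_le => s [j [i [jj ij]]]; apply: contraPP => /not_orP[nA nF].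
  apply/negP; rewrite -leNgt.
  have HA i' : (i' <= 2 ^ j0)%N -> `|G (dyadic j0 i') s| < al.
    move=> i'j; rewrite ltNge; apply/negP => H; apply: nA; by exists i'.
  have HF m i' : (i' < 2 ^ (j0 + m).+1)%N ->
     `|G (dyadic (j0 + m).+1 i'.+1) s - G (dyadic (j0 + m).+1 i') s| < be * (3 / 4) ^+ m.
    move=> i'j; rewrite ltNge; apply/negP => H; apply: nF; exists m => //; by exists i'.
  have key m : forall i', (i' <= 2 ^ (j0 + m))%N -> `|G (dyadic (j0 + m) i') s| <= al + be * (4 - 4 * (3 / 4) ^+ m).
    elim: m => [|m IH] i' i'j.
      rewrite addn0 expr0 mulr1 subrr mulr0 addr0 ltW//; apply: HA; by rewrite addn0 in i'j.
    rewrite addnS in i'j *.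
    have E : be * (4 - 4 * (3 / 4) ^+ m.+1) = be * (4 - 4 * (3 / 4) ^+ m) + be * (3 / 4) ^+ m.
      by rewrite exprS; field.
    have e0 : 0 <= be * (3 / 4) ^+ m by rewrite mulr_ge0 ?(ltW be0)// exprn_ge0// divr_ge0.
    rewrite -(odd_double_half i') in i'j *.
    have h2 : (i'./2 <= 2 ^ (j0 + m))%N.
      rewrite -leq_double; apply: leq_trans (leq_addl (odd i') _) _.
      by apply: leq_trans i'j _; rewrite expnS mul2n.
    case: (odd i') i'j => /= i'j; last first.
      rewrite add0n -mul2n dyadicS E addrA; apply: le_trans (IH _ h2) _.
      by rewrite lerDl.
    rewrite add1n in i'j *.
    have := HF m (i'./2).*2 i'j; rewrite -[X in _ - G (dyadic _ X) _]mul2n dyadicS => H1.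
    rewrite -(subrK (G (dyadic (j0 + m) i'./2) s) (G _ s)); apply: le_trans (ler_normD _ _) _.
    by rewrite E addrA [X in X <= _]addrC; apply: lerD; [exact: IH|exact: ltW].
  have := key (j - j0)%N i; rewrite subnKC// => /(_ ij) H; apply: le_trans H _.
  rewrite lerD2l mulrC ler_pM2r// gerBl mulr_ge0// exprn_ge0// divr_ge0//.
apply: outerU.
  rewrite -natrX -(natrD _ _ 1) addn1; apply: outer_finite_union; first by rewrite mulr_ge0// expR_ge0.
  by move=> i ij; apply: tailG => //; exact: dyadic01.
apply: (@outer_countable_union _ _ _ _ _ (fun m => 4 * L / (be ^+ 2 * 2 ^+ j0) * (8 / 9) ^+ m)).
  move=> m; set J := (j0 + m).+1.
  have p2 : (0 : R) < 2 ^+ J by rewrite exprn_gt0.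
  have c0 : 0 < be * (3 / 4) ^+ m by rewrite mulr_gt0// exprn_gt0// divr_gt0.
  pose y := (be * (3 / 4) ^+ m) ^+ 2 / (4 * (L * ((2 ^+ J)^-1) ^+ 2)).
  have y0 : 0 < y by rewrite divr_gt0 ?exprn_gt0// !mulr_gt0// exprn_gt0// invr_gt0.
  apply: (@le_trans _ _ ((2 ^ J)%:R * (2 * expR (- y)))%:E).
    apply: outer_finite_union; first by rewrite mulr_ge0// expR_ge0.
    move=> i ij; rewrite /y -(dyadic_step J i); apply: tailD => //.
    - exact: dyadic01.
    - by apply: dyadic01; exact: ltnW.
    - by rewrite -subr_gt0 dyadic_step invr_gt0.
  have ey : expR (- y) <= y^-1.
    rewrite expRN lef_pV2 ?posrE ?expR_gt0//; apply: le_trans (expR_ge1Dx y); lra.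
  rewrite lee_fin natrX; apply: (@le_trans _ _ (2 ^+ J * (2 * y^-1))).
    by rewrite ler_pM2l// ler_pM2l.
  rewrite le_eqVlt; apply/orP; left; apply/eqP.
  rewrite /y /J exprS exprD !expr_div_n.
  have -> : (8 : R) ^+ m = 2 ^+ m * 4 ^+ m by rewrite -exprMn; congr (_ ^+ _); ring.
  have -> : (9 : R) ^+ m = 3 ^+ m * 3 ^+ m by rewrite -exprMn; congr (_ ^+ _); ring.
  have -> : (4 : R) ^+ m = 2 ^+ m * 2 ^+ m by rewrite -exprMn; congr (_ ^+ _); ring.
  by field; rewrite !expf_neq0 ?gt_eqF.
move=> n; rewrite -mulr_sumr.
have -> : 36 * L / (be ^+ 2 * 2 ^+ j0) = 4 * L / (be ^+ 2 * 2 ^+ j0) * 9.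
  by field; rewrite expf_neq0// gt_eqF.
rewrite ler_wpM2l//; first by rewrite divr_ge0// ?mulr_ge0// ?sqr_ge0 ?exprn_ge0 ?ltW.
have -> : \sum_(i < n) (8 / 9 : R) ^+ i = 9 - 9 * (8 / 9) ^+ n.
  elim: n => [|n IH]; first by rewrite big_ord0 expr0 mulr1 subrr.
  by rewrite big_ord_recr/= IH exprS; field.
by rewrite gerBl mulr_ge0// exprn_ge0// divr_ge0.
Qed.
End Chaining.

(** * The regression model *)

Section Transport.
Context d (T : measurableType d) (R : realType) (P : probability T R).

Lemma integral_law (D : set R) (nu : probability (measurableTypeR R) R) (X : T -> R) (g : R -> R) :
  measurable D ->
  measurable_fun setT X -> (forall w, D (X w)) ->
  (forall B : set R, measurable B -> P (X @^-1` B) = nu B) ->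
  nu.-integrable D (EFin \o g) ->
  P.-integrable setT (EFin \o (g \o X)) /\
  \int[P]_w g (X w) = \int[nu]_(x in D) g x.
Proof.
move=> mD mX XD law Ig.
pose X' : T -> measurableTypeR R := X.
have mX' : measurable_fun setT X' by [].
pose m := pushforward P X'.
have mE (A : set (measurableTypeR R)) : measurable A -> m A = nu A by move=> mA; exact: law.
pose h : measurableTypeR R -> \bar R := (EFin \o g) \_ D.
have Ih : nu.-integrable setT h by rewrite /h -integrable_mkcond.
have mh : measurable_fun setT h := measurable_int _ Ih.
have hX w : h (X' w) = (g (X w))%:E by rewrite /h patchE mem_set//; exact: XD.
have Im : m.-integrable setT h.
  have [_ H] := integrableP _ _ _ Ih; apply/integrableP; split=> //.
  by rewrite (@eq_measure_integral _ _ _ setT nu)// => A mA _; exact: mE.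
have EX : EFin \o (g \o X) = h \o X' by apply/funext => w; rewrite /= hX.
have IP : P.-integrable setT (EFin \o (g \o X)).
  have [_ H] := integrableP _ _ _ Im; apply/integrableP; rewrite EX; split.
    exact: measurableT_comp.
  move: H; rewrite ge0_integral_pushforward//.
  exact: measurableT_comp.
split => //; rewrite /Rintegral; congr fine.
transitivity (\int[P]_w (h \o X') w)%E; first by apply: eq_integral => w _; rewrite /= hX.
rewrite -[RHS]/(\int[nu]_(x in D) (EFin \o g) x)%E [RHS]integral_mkcond -/h.
transitivity (\int[m]_x h x)%E; last first.
  by apply: eq_measure_integral => A mA _; exact: mE.
rewrite /m integral_pushforward//.
by rewrite -EX.
Qed.
End Transport.

Lemma measurable_inv {R : realType} : measurable_fun setT (fun y : R => y^-1).
Proof.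
rewrite (_ : (fun y => _) = fun y => y * (y ^+ 2) `^ (-1)).
  apply: measurable_funM => //.
  by apply: (measurableT_comp (measurable_powR _)); exact: measurable_funX.
apply/funext => y; rewrite powR_inv1 ?sqr_ge0//.
by have [->|y0] := eqVneq y 0; [rewrite invr0 mul0r|field].
Qed.

Section MeasurableRidge.
Context {R : realType} (PX : probability (measurableTypeR R) R).
Variables (mu : nat -> R) (phi : nat -> R -> R) (K : R -> R -> R).
Hypothesis HM : mercer_decomposition PX mu phi K.
Hypothesis HK : psd_kernel K.
Local Notation I := (`[0%R, 1%R]%classic : set R).
Let mI : measurable (I : set R). Proof. exact: measurable_itv. Qed.

Lemma measurable_comp01 d (T : measurableType d) (X : T -> R) (g : R -> R) :
  measurable_fun setT X -> (forall w, 0 <= X w <= 1) -> measurable_fun I g ->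
  measurable_fun setT (g \o X).
Proof.
move=> mX X01 mg; apply: (measurable_comp mI _ mg mX).
by move=> _ [w _ <-]; rewrite /= in_itv/=.
Qed.

(** [K] is regular on the square only; the Mercer partial sums, products of
    functions of one variable, carry measurability over. *)
Lemma measurable_kernel_comp d (T : measurableType d) (X X' : T -> R) :
  measurable_fun setT X -> measurable_fun setT X' ->
  (forall w, 0 <= X w <= 1) -> (forall w, 0 <= X' w <= 1) ->
  measurable_fun setT (fun w => K (X w) (X' w)).
Proof.
move=> mX mX' X01 X'01.
apply: (@measurable_fun_cvg _ _ _ setT (fun N w => \sum_(i < N) mu i * phi i (X w) * phi i (X' w))).
  move=> N; apply: measurable_sum => i; apply: measurable_funM.
    by apply: measurable_funM => //; exact: (measurable_comp01 mX X01 (phi_measurable HM i)).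
  exact: (measurable_comp01 mX' X'01 (phi_measurable HM i)).
by move=> w _; exact: (mercer_sum HM).
Qed.

Lemma measurable_det d (T : measurableType d) n (A : T -> 'M[R]_n) :
  (forall i j, measurable_fun setT (fun w => A w i j)) ->
  measurable_fun setT (fun w => \det (A w)).
Proof.
move=> mA; rewrite /determinant; apply: measurable_sum => s.
apply: measurable_funM => //; apply: measurable_prod => i _; exact: mA.
Qed.

(** By Cramer's rule, the entries of the inverse are quotients of determinants.
    *)
Lemma measurable_ridge d (T : measurableType d) n lam (x : T -> 'I_n -> R) i j :
  (0 < n)%N -> 0 < lam ->
  (forall l, measurable_fun setT (fun w => x w l)) -> (forall w l, 0 <= x w l <= 1) ->
  measurable_fun setT (fun w => ridge_inv K lam (x w) i j).
Proof.
move=> n0 lam0 mx x01; pose A w := gram K (x w) + (n%:R * lam)%:M.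
have mA a b : measurable_fun setT (fun w => A w a b).
  rewrite (_ : (fun w => _) = fun w => K (x w a) (x w b) + ((n%:R * lam)%:M : 'M[R]_n) a b).
    by apply: measurable_funD => //; apply: measurable_kernel_comp.
  by apply/funext => w; rewrite !mxE.
rewrite (_ : (fun w => _) = fun w => (\det (A w))^-1 * cofactor (A w) j i); last first.
  apply/funext => w; rewrite /ridge_inv -/(A w) /invmx ifT ?mxE//.
  apply: (ridge_unit n0 lam0) => v; exact: (kernel_psd HK).
apply: measurable_funM.
  have mi := measurable_det mA.
  exact: (measurableT_comp measurable_inv mi).
rewrite /cofactor; apply: measurable_funM => //; apply: measurable_det => a b.
rewrite (_ : (fun w => _) = fun w => A w (lift j a) (lift i b)) ; first exact: mA.
by apply/funext => w; rewrite !mxE.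
Qed.
End MeasurableRidge.

Section Model.
Context {R : realType} d (T : measurableType d) (P : probability T R)
  (PX : probability (measurableTypeR R) R) (f0 : R -> R) (sigma0 : R)
  (X Y eps : nat -> {RV P >-> R}).
Hypothesis cf0 : {within `[0, 1], continuous f0}.
Hypothesis HR : regression_model PX f0 sigma0 X Y eps.
Local Notation I := (`[0%R, 1%R]%classic : set R).
Let mI : measurable (I : set R). Proof. exact: measurable_itv. Qed.
Local Notation integr f := (P.-integrable setT (EFin \o f)).

Let mX i : measurable_fun setT (X i : T -> R). Proof. exact: measurable_funP. Qed.
Let me i : measurable_fun setT (eps i : T -> R). Proof. exact: measurable_funP. Qed.
Let X01 i w : 0 <= X i w <= 1. Proof. exact: (model_X01 HR). Qed.

Lemma f0_measurable : measurable_fun I f0.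
Proof. exact: subspace_continuous_measurable_fun. Qed.

(** Independence is assumed of the pairs [(X_i, Y_i)]. As [eps_i = Y_i - f0
    (X_i)], an event on [(X_i, eps_i)] is an event on [(X_i, Y_i)]. *)
Lemma model_joint (s : seq nat) (B C : nat -> set R) : uniq s ->
  (forall i, measurable (B i)) -> (forall i, measurable (C i)) ->
  P (\bigcap_(i in [set` s]) (X i @^-1` B i `&` eps i @^-1` C i)) =
  (\prod_(i <- s) (P (X i @^-1` B i) * P (eps i @^-1` C i)))%E.
Proof.
move=> us mB mC; pose f := f0 \_ I.
have mf : measurable_fun setT f by apply/(measurable_restrictT f0 mI); exact: f0_measurable.
pose D i : set (R * R) := (B i `*` setT) `&` (fun z => z.2 - f z.1) @^-1` (C i).
have mD i : measurable (D i).
  apply: measurableI; first exact: measurableX.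
  rewrite -[X in measurable X]setTI.
  have mg : measurable_fun setT (fun z : R * R => z.2 - f z.1).
    by apply: measurable_funB => //; exact: (measurableT_comp mf).
  exact: mg.
have E i : X i @^-1` B i `&` eps i @^-1` C i = (fun w => (X i w, Y i w)) @^-1` D i.
  have EY w : Y i w - f (X i w) = eps i w.
    rewrite /f patchE mem_set; last by rewrite /= in_itv/=.
    by rewrite (model_Y HR) addrAC subrr add0r.
  rewrite /D; apply/seteqP; split=> w; rewrite /= EY; first by move=> [? ?].
  by move=> [[? _] ?].
rewrite (eq_bigcapr (fun i _ => E i)) (model_indep HR us mD).
by apply: eq_bigr => i _; rewrite -E (model_X_eps HR).
Qed.

Lemma model_pair i j (B B' C C' : set R) : i != j ->
  measurable B -> measurable B' -> measurable C -> measurable C' ->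
  P ((X i @^-1` B `&` eps i @^-1` C) `&` (X j @^-1` B' `&` eps j @^-1` C')) =
  (P (X i @^-1` B) * P (eps i @^-1` C) * (P (X j @^-1` B') * P (eps j @^-1` C')))%E.
Proof.
move=> ij mB mB' mC mC'.
have := @model_joint [:: i; j] (fun l => if l == i then B else B') (fun l => if l == i then C else C').
rewrite /= inE ij/= => /(_ isT).
move=> /(_ ltac:(by move=> l; case: ifP)) /(_ ltac:(by move=> l; case: ifP)).
rewrite !big_cons big_nil mule1 eqxx (eq_sym j) (negbTE ij) => <-.
congr (P _); apply/seteqP; split=> w.
  move=> [H1 H2] l /=; rewrite !inE => /orP[/eqP->|/eqP->]; first by rewrite eqxx.
  by rewrite eq_sym (negbTE ij).
move=> H; split; first by have := H i; rewrite /= inE eqxx => /(_ isT).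
by have := H j; rewrite /= !inE eqxx orbT eq_sym (negbTE ij) => /(_ isT).
Qed.

Let PT : P setT = 1%E := probability_setT P.

Lemma X_independent i j : i != j -> independent2 P (X i) (X j).
Proof.
move=> ij B C mB mC; have := model_pair ij mB mC measurableT measurableT.
by rewrite !preimage_setT !setIT PT !mule1.
Qed.

Lemma eps_independent i j : i != j -> independent2 P (eps i) (eps j).
Proof.
move=> ij B C mB mC; have := model_pair ij measurableT measurableT mB mC.
by rewrite !preimage_setT !setTI PT !mul1e.
Qed.

Lemma independent2_comp (U W : T -> R) (g h : R -> R) :
  measurable_fun setT g -> measurable_fun setT h ->
  independent2 P U W -> independent2 P (g \o U) (h \o W).
Proof.
move=> mg mh UW B C mB mC.
have := UW (g @^-1` B) (h @^-1` C); apply.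
  by rewrite -[_ @^-1` _]setTI; exact: mg.
by rewrite -[_ @^-1` _]setTI; exact: mh.
Qed.

Lemma X_independent_comp i j (g h : R -> R) : i != j ->
  measurable_fun I g -> measurable_fun I h ->
  independent2 P (g \o X i) (h \o X j).
Proof.
move=> ij mg mh.
have E (k : R -> R) l : k \o X l = (k \_ I) \o X l.
  by apply/funext => w; rewrite /= patchE mem_set//= in_itv/=.
rewrite (E g) (E h); apply: independent2_comp; last exact: X_independent.
  exact/(measurable_restrictT g mI).
exact/(measurable_restrictT h mI).
Qed.

Lemma X_integral i (g : R -> R) : PX.-integrable `[0, 1] (EFin \o g) ->
  integr (g \o X i) /\ \int[P]_w g (X i w) = \int[PX]_(x in `[0, 1]) g x.
Proof.
move=> Ig; apply: (integral_law (nu := PX) mI (mX i)) => //.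
- by move=> w; rewrite /= in_itv/=.
- by move=> B mB; exact: (model_X_law HR).
Qed.

Lemma eps_integral i (g : R -> R) : (normal_prob 0 sigma0).-integrable setT (EFin \o g) ->
  integr (g \o eps i) /\ \int[P]_w g (eps i w) = \int[normal_prob 0 sigma0]_x g x.
Proof.
move=> Ig; apply: (integral_law (nu := normal_prob 0 sigma0) measurableT (me i)) => //.
by move=> B mB; exact: (model_eps_law HR).
Qed.

Section OneLeftOut.
Variables (n i : nat).
Hypothesis iln : (i < n)%N.

(** A pi-system that generates the sigma-algebra of all [X_l] and [eps_l] with
    [l < n], apart from [eps_i]: the condition [C i = setT] leaves [eps_i]
    free. *)
Definition others : set (set T) := [set A | exists B C : nat -> set R,
  [/\ forall l, measurable (B l), forall l, measurable (C l), C i = setT &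
  A = \bigcap_(l in [set` iota 0 n]) (X l @^-1` B l `&` eps l @^-1` C l)]].

Lemma others_measurable : others `<=` measurable.
Proof.
move=> _ [B [C [mB mC _ ->]]].
apply: fin_bigcap_measurable; first exact: finite_seq.
by move=> l _; apply: measurableI; rewrite -[X in measurable X]setTI; [exact: mX|exact: me].
Qed.

Lemma others_setI : setI_closed others.
Proof.
move=> _ _ [B [C [mB mC Ci ->]]] [B' [C' [mB' mC' Ci' ->]]].
exists (fun l => B l `&` B' l), (fun l => C l `&` C' l); split.
- by move=> l; exact: measurableI.
- by move=> l; exact: measurableI.
- by rewrite Ci Ci' setIT.
rewrite -bigcapI; apply: eq_bigcapr => l _.
by rewrite !preimage_setI setIACA.
Qed.

Lemma others_setT : others setT.
Proof.
exists (fun=> setT), (fun=> setT); split => //.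
by apply/seteqP; split.
Qed.

Lemma others_indep A B : <<s others >> A -> measurable B ->
  P (A `&` eps i @^-1` B) = (P A * P (eps i @^-1` B))%E.
Proof.
move=> HA mB; apply: (indep_sigma_algebra (me i) others_measurable others_setI others_setT) HA mB.
move=> _ {}B [B' [C' [mB' mC' Ci ->]]] mB.
have in_ : i \in iota 0 n by rewrite mem_iota.
have un := iota_uniq 0 n.
(* adding the event on [eps_i] to a member of the pi-system keeps its product
   form *)
pose C'' l := if l == i then B else C' l.
have mC'' l : measurable (C'' l) by rewrite /C''; case: ifP.
have -> : (\bigcap_(l in [set` iota 0 n]) (X l @^-1` B' l `&` eps l @^-1` C' l)) `&` eps i @^-1` B =
   \bigcap_(l in [set` iota 0 n]) (X l @^-1` B' l `&` eps l @^-1` C'' l).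
  apply/seteqP; split=> w.
    by move=> [H Hi] l ln; have [H1 H2] := H l ln; split=> //; rewrite /C'' /=; case: eqP => [->|].
  move=> H; split; last by have [_] := H i in_; rewrite /C'' /= eqxx.
  move=> l ln; have [H1 H2] := H l ln; split=> //.
  by move: H2; rewrite /C'' /=; case: eqP => [->|//]; rewrite Ci.
rewrite !model_joint// !(bigD1_seq i)//=.
rewrite {1}/C'' eqxx Ci preimage_setT PT mule1 -!muleA; congr (_ * _)%E.
rewrite muleC; congr (_ * _)%E; apply: eq_bigr => l li.
by rewrite /C'' (negbTE li).
Qed.

Lemma others_X l : (l < n)%N -> measurable_fun setT (X l : g_sigma_algebraType others -> R).
Proof.
move=> ln _ B mB; rewrite setTI; apply: sub_sigma_algebra.
exists (fun l' => if l' == l then B else setT), (fun=> setT); split => //.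
  by move=> l'; case: ifP.
apply/seteqP; split=> w /=.
  by move=> Hw l' _; split=> //=; case: eqP => // ->.
by move=> /(_ l); rewrite /= mem_iota/= add0n eqxx => /(_ ln)[].
Qed.

Lemma others_eps l : (l < n)%N -> l != i -> measurable_fun setT (eps l : g_sigma_algebraType others -> R).
Proof.
move=> ln li _ B mB; rewrite setTI; apply: sub_sigma_algebra.
exists (fun=> setT), (fun l' => if l' == l then B else setT); split => //.
  by move=> l'; case: ifP.
  by rewrite eq_sym (negbTE li).
apply/seteqP; split=> w /=.
  by move=> Hw l' _; split=> //=; case: eqP => // ->.
by move=> /(_ l); rewrite /= mem_iota/= add0n eqxx => /(_ ln)[].
Qed.

Lemma eps_others_independent (g : R -> R) (W : T -> R) : measurable_fun setT g ->
  measurable_fun setT (W : g_sigma_algebraType others -> R) ->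
  independent2 P (g \o eps i) W.
Proof.
move=> mg mW B C mB mC; rewrite setIC muleC.
apply: (others_indep (B := g @^-1` B)); last by rewrite -[_ @^-1` _]setTI; exact: mg.
by rewrite -[_ @^-1` _]setTI; exact: mW.
Qed.

End OneLeftOut.
End Model.

(** * The signal part of the variance estimator *)

Section Signal.
Context {R : realType} (PX : probability (measurableTypeR R) R).
Variables (mu : nat -> R) (phi : nat -> R -> R) (K : R -> R -> R) (f0 : R -> R).
Hypothesis HM : mercer_decomposition PX mu phi K.
Hypothesis HK : psd_kernel K.
Hypothesis cf0 : {within `[0, 1], continuous f0}.
Local Notation I := (`[0%R, 1%R]%classic : set R).
Local Notation integr f := (PX.-integrable `[0%R, 1%R] (EFin \o f)).
Let mI : measurable (I : set (measurableTypeR R)). Proof. exact: measurable_itv. Qed.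
Let mu0 i : 0 < mu i := mercer_gt0 HM i.

Lemma continuous01_bounded (h : R -> R) : {within `[0, 1], continuous h} ->
  exists2 C, 0 < C & forall x, 0 <= x <= 1 -> `|h x| <= C.
Proof.
move=> H; have /compact_bounded[M [_ HMb]] := continuous_compact H (segment_compact (a := 0) (b := 1)).
exists (`|M| + 1); first by rewrite ltr_wpDl.
move=> x x01; apply: (HMb (`|M| + 1)); first by rewrite (le_lt_trans (ler_norm _))// ltrDl.
by exists x => //; rewrite /= in_itv.
Qed.

Lemma continuous01_measurable (h : R -> R) : {within `[0, 1], continuous h} -> measurable_fun I h.
Proof. exact: subspace_continuous_measurable_fun. Qed.

Lemma continuous01_integr2 (h : R -> R) : {within `[0, 1], continuous h} -> integr (fun x => h x ^+ 2).
Proof.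
move=> ch; have [C C0 HC] := continuous01_bounded ch.
by apply: (@integr_bounded_sqr _ PX _ C) => //; exact: continuous01_measurable.
Qed.

Let mf0 := continuous01_measurable cf0.
Let If0 := continuous01_integr2 cf0.

(** [g] lists the values on the sample of a function with squared norm at most
    [A] in the reproducing kernel space. Pairing it with the kernel combination
    of coefficients [v] gives [q], whereas the squared norm of that combination
    is at most [q]; Cauchy-Schwarz gives [q^2 <= A q]. *)
Lemma ridge_rkhs n lam (x : 'I_n -> R) (a : nat -> R) (A : R) (g : 'I_n -> R) :
  (0 < n)%N -> 0 < lam -> (forall l, 0 <= x l <= 1) ->
  (forall m, \sum_(i < m) a i ^+ 2 <= A) ->
  (forall l, \sum_(i < m) a i * (Num.sqrt (mu i) * phi i (x l)) @[m --> \oo] --> g l) ->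
  bilin (ridge_inv K lam x) g g <= A.
Proof.
move=> n0 lam0 x01 HA Hg; set q := bilin _ _ _.
pose v := ridge_sol K lam x g.
have q0 : 0 <= q by exact: (ridge_psd n0 lam0 (fun v => kernel_sample_psd HK x01 v)).
have qE : q = \sum_i \sum_j v i * v j * K (x i) (x j) + n%:R * lam * \sum_i v i ^+ 2.
  exact: (bilin_ridge_inv n0 lam0 (fun v => kernel_sample_psd HK x01 v)).
pose t i := \sum_l v l * (Num.sqrt (mu i) * phi i (x l)).
have Hq : \sum_(i < m) a i * t i @[m --> \oo] --> q.
  have -> : (fun m => \sum_(i < m) a i * t i) = fun m => \sum_l (\sum_(i < m) a i * (Num.sqrt (mu i) * phi i (x l))) * v l.
    apply/funext => m; under [RHS]eq_bigr do rewrite mulr_suml.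
    rewrite exchange_big; apply: eq_bigr => i _; rewrite /t mulr_sumr; apply: eq_bigr => l _; ring.
  rewrite /q bilin_sol.
  apply: cvg_big => [|l _]; first by move=> z; exact: add_continuous.
  by apply: cvgM; [exact: Hg|exact: cvg_cst].
have Ht : \sum_(i < m) t i ^+ 2 @[m --> \oo] --> \sum_i \sum_j v i * v j * K (x i) (x j).
  have -> : (fun m => \sum_(i < m) t i ^+ 2) = fun m => \sum_l \sum_l' v l * v l' *
      \sum_(i < m) (Num.sqrt (mu i) * phi i (x l)) * (Num.sqrt (mu i) * phi i (x l')).
    apply/funext => m; under [RHS]eq_bigr do (under eq_bigr do rewrite mulr_sumr; rewrite exchange_big).
    rewrite exchange_big; apply: eq_bigr => i _; rewrite expr2 mulr_suml; apply: eq_bigr => l _.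
    by rewrite mulr_sumr; apply: eq_bigr => l' _; ring.
  apply: cvg_big => [|l _]; first by move=> z; exact: add_continuous.
  apply: cvg_big => [|l' _]; first by move=> z; exact: add_continuous.
  by apply: cvgM; [exact: cvg_cst|exact: (mercer_cvg HM)].
have tq m : \sum_(i < m) t i ^+ 2 <= q.
  apply: le_trans (@le_psum _ (fun i => t i ^+ 2) _ m _ Ht) _; first by move=> i; exact: sqr_ge0.
  by rewrite qE lerDl mulr_ge0 ?mulr_ge0 ?(ltW lam0)// sumr_ge0// => i _; exact: sqr_ge0.
have := @cauchy_schwarz_lim _ a t A q q HA tq Hq.
have [->|qn] := eqVneq q 0; first by move=> _; have := HA 0%N; rewrite big_ord0.
by rewrite expr2 ler_pM2r// lt_neqAle eq_sym qn.
Qed.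

Variable lam : R.
Hypothesis lam0 : 0 < lam.
Let lm i : 0 < lam + mu i. Proof. by rewrite addr_gt0. Qed.
Let c := coef PX phi f0.
(* the coordinates of [f_lambda] in the orthonormal basis [sqrt (mu_i) phi_i]
   of the reproducing kernel space *)
Let a i := Num.sqrt (mu i) / (lam + mu i) * c i.
Let F N x := \sum_(i < N) (mu i / (lam + mu i) * c i) * phi i x.

Let FE N x : F N x = \sum_(i < N) a i * (Num.sqrt (mu i) * phi i x).
Proof.
apply: eq_bigr => i _; rewrite -{1}[mu i]sqr_sqrtr ?(ltW (mu0 i))// /a; field.
by rewrite gt_eqF.
Qed.

Let A1 := \int[PX]_(x in `[0, 1]) (f0 x ^+ 2).

Let a_le : forall m, \sum_(i < m) a i ^+ 2 <= lam^-1 * A1.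
Proof.
move=> m; apply: (@le_trans _ _ (\sum_(i < m) lam^-1 * c i ^+ 2)).
  apply: ler_sum => i _; rewrite /a exprMn ler_wpM2r ?sqr_ge0//.
  rewrite expr_div_n sqr_sqrtr ?(ltW (mu0 i))// ler_pdivrMr ?exprn_gt0//.
  have -> : lam^-1 * (lam + mu i) ^+ 2 = lam + 2 * mu i + mu i ^+ 2 / lam by field; rewrite gt_eqF.
  have : 0 <= mu i ^+ 2 / lam by rewrite divr_ge0 ?sqr_ge0// ltW.
  have := mu0 i; move: lam0; lra.
rewrite -mulr_sumr ler_pM2l ?invr_gt0//.
exact: (bessel HM).
Qed.

Let acvg : exists A : R, \sum_(i < m) a i ^+ 2 @[m --> \oo] --> A.
Proof.
have [|m|l _ Hl] := @psum_le_cvg _ (fun i => a i ^+ 2) (lam^-1 * A1).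
- by move=> i; exact: sqr_ge0.
- exact: a_le.
- by exists l.
Qed.

Lemma f_lambda_cvg x : 0 <= x <= 1 ->
  \sum_(i < m) a i * (Num.sqrt (mu i) * phi i x) @[m --> \oo] --> f_lambda PX mu phi f0 lam x.
Proof.
move=> x01; have [A HA] := acvg.
have [| |l Hl] := @psum_abs_cvg _ (fun i => a i * (Num.sqrt (mu i) * phi i x))
   (fun i => a i ^+ 2 + (Num.sqrt (mu i) * phi i x) ^+ 2) (A + K x x).
- move=> i; set z := _ * phi i x.
  rewrite normrM -(real_normK (num_real (a i))) -(real_normK (num_real z)).
  have := sqr_ge0 (`|a i| - `|z|); have := sqr_ge0 (`|a i| + `|z|); lra.
- rewrite (_ : (fun N => _) = fun N => \sum_(i < N) a i ^+ 2 + \sum_(i < N) (Num.sqrt (mu i) * phi i x) ^+ 2).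
    by apply: cvgD => //; exact: (mercer_diag HM).
  by apply/funext => N; rewrite big_split.
rewrite /f_lambda; have -> : limn (fun N => \sum_(i < N) mu i / (lam + mu i) * coef PX phi f0 i * phi i x) = l.
  apply: cvg_lim => //; move: Hl; rewrite (_ : (fun N => _) = fun N => F N x)//.
  by apply/funext => N; rewrite FE.
by [].
Qed.

Let f_lambda_measurable : measurable_fun I (f_lambda PX mu phi f0 lam).
Proof.
apply: (@measurable_fun_cvg _ _ _ I F).
  by move=> N; exact: (psum_measurable HM (fun i => mu i / (lam + mu i) * c i)).
move=> x /mem_itv01 x01; have := f_lambda_cvg x01; rewrite (_ : (fun m => _) = F ^~ x)//.
by apply/funext => N; rewrite FE.
Qed.

Variable eta : R.
Hypothesis eta0 : 0 <= eta.
Hypothesis Heta : forall x, 0 <= x <= 1 -> `|f_lambda PX mu phi f0 lam x - f0 x| <= eta.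

Let f_lambda_integr2 : integr (fun x => f_lambda PX mu phi f0 lam x ^+ 2).
Proof.
have [C C0 HC] := continuous01_bounded cf0.
apply: (@integr_bounded_sqr _ PX _ (eta + C)) => // x x01.
rewrite -(subrK (f0 x) (f_lambda _ _ _ _ _ x)); apply: le_trans (ler_normD _ _) _.
by apply: lerD; [exact: Heta|exact: HC].
Qed.

Let coef_f_lambda i : coef PX phi (f_lambda PX mu phi f0 lam) i = mu i / (lam + mu i) * c i.
Proof.
have [A HA] := acvg; have [C C0 HC] := kernel_diag_bounded HK.
have H1 : coef PX phi (F N) i @[N --> \oo] --> coef PX phi (f_lambda PX mu phi f0 lam) i.
  apply: (coef_cvg_unif HM).
  - by move=> N; exact: (psum_measurable HM (fun i => mu i / (lam + mu i) * c i)).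
  - by move=> N; exact: (psum_integr2 HM (fun i => mu i / (lam + mu i) * c i)).
  - exact: f_lambda_measurable.
  - exact: f_lambda_integr2.
  move=> e e0; have e1 : 0 < e ^+ 2 / C by rewrite divr_gt0// exprn_gt0.
  have /cvgrPdist_le/(_ _ e1) := HA.
  apply: filterS => N HN x x01.
  have := @cauchy_schwarz_tail _ a (fun i => Num.sqrt (mu i) * phi i x) _ C _ N HA
     (fun m => le_trans (mercer_diag_le HM m x01) (HC _ x01)) (f_lambda_cvg x01).
  rewrite -FE distrC => H2; rewrite -ler_sqr ?nnegrE ?(ltW e0)// real_normK ?num_real//.
  apply: le_trans H2 _; rewrite -ler_pdivlMr//; exact: le_trans (ler_norm _) HN.
have H2 : coef PX phi (F N) i @[N --> \oo] --> mu i / (lam + mu i) * c i.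
  apply: cvg_near_cst; near=> N; rewrite (coef_psum HM (fun i => mu i / (lam + mu i) * c i)).
  by rewrite ifT//; near: N; exists i.+1.
exact: (cvg_unique _ H1 H2).
Unshelve. all: by end_near. Qed.

(** Optimality of [f_lambda]: [lam |f_lambda|_K^2 = <f_lambda, f0 - f_lambda>].
    *)
Let energy m : lam * \sum_(i < m) a i ^+ 2 <= Num.sqrt A1 * eta.
Proof.
have A10 : 0 <= A1 by apply: Rintegral_ge0 => x _; exact: sqr_ge0.
pose dl x := f0 x - f_lambda PX mu phi f0 lam x.
have mdl : measurable_fun I dl by apply: measurable_funB => //; exact: f_lambda_measurable.
have dle x : 0 <= x <= 1 -> `|dl x| <= eta by move=> x01; rewrite distrC; exact: Heta.
have dI : integr (fun x => dl x ^+ 2) by exact: (@integr_bounded_sqr _ PX _ eta mdl dle).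
have cd i : coef PX phi dl i = lam / (lam + mu i) * c i.
  rewrite /dl (coefB HM i mf0 f_lambda_measurable If0 f_lambda_integr2).
  by rewrite coef_f_lambda -/(c i); field; rewrite gt_eqF.
have d2 : \sum_(i < m) coef PX phi dl i ^+ 2 <= eta ^+ 2.
  apply: le_trans (bessel HM m mdl dI) _.
  apply: (@le_trans _ _ (\int[PX]_(x in `[0, 1]) (eta ^+ 2))).
    apply: le_Rintegral => //; first exact: finite_measure_integrable_cst.
    move=> x /mem_itv01 x01; rewrite -(real_normK (num_real (dl x))) ler_sqr ?nnegrE//; exact: dle.
  exact: Rintegral_cst_le (sqr_ge0 _).
pose g i := mu i / (lam + mu i) * c i.
have g2 : \sum_(i < m) g i ^+ 2 <= A1.
  apply: le_trans _ (bessel HM m mf0 If0); apply: ler_sum => i _.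
  rewrite exprMn ler_piMl ?sqr_ge0// expr_le1// ?divr_ge0 ?(ltW (mu0 i)) ?(ltW (lm i))//.
  by rewrite ler_pdivrMr// mul1r lerDr ltW.
have -> : lam * \sum_(i < m) a i ^+ 2 = \sum_(i < m) g i * coef PX phi dl i.
  rewrite mulr_sumr; apply: eq_bigr => i _; rewrite cd /a /g exprMn expr_div_n sqr_sqrtr ?(ltW (mu0 i))//.
  by field; rewrite gt_eqF.
have H := cauchy_schwarz_sum (fun i : 'I_m => g i) (fun i : 'I_m => coef PX phi dl i).
have RH0 : 0 <= Num.sqrt A1 * eta by rewrite mulr_ge0// sqrtr_ge0.
apply: le_trans (ler_norm _) _.
rewrite -ler_sqr ?nnegrE// real_normK ?num_real// exprMn sqr_sqrtr//.
apply: le_trans H _; apply: ler_pM => //; apply: sumr_ge0 => i _; exact: sqr_ge0.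
Qed.

(** [f_lambda] is controlled by its norm in the reproducing kernel space, and
    [f0 - f_lambda] by its sup norm. *)
Lemma signal_bound n (x : 'I_n -> R) : (0 < n)%N -> (forall l, 0 <= x l <= 1) ->
  lam * bilin (ridge_inv K lam x) (fun l => f0 (x l)) (fun l => f0 (x l)) <=
  2 * (Num.sqrt A1 * eta) + 2 * eta ^+ 2.
Proof.
move=> n0 x01; set M := ridge_inv _ _ _.
pose g l := f_lambda PX mu phi f0 lam (x l); pose dl l := f0 (x l) - g l.
have Kp := fun v => kernel_sample_psd HK x01 v.
have Msym := ridge_sym lam (kernel_sample_sym HK x01).
have Mpsd := ridge_psd n0 lam0 Kp.
have -> : (fun l => f0 (x l)) = fun l => g l + dl l by apply/funext => l; rewrite /dl addrC subrK.
have H := bilin_sqrD_le Msym Mpsd g dl.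
have Hg : lam * bilin M g g <= Num.sqrt A1 * eta.
  rewrite mulrC -ler_pdivlMr//; apply: (@ridge_rkhs _ _ _ a) => //.
    by move=> m; rewrite ler_pdivlMr// mulrC; exact: energy.
  by move=> l; exact: f_lambda_cvg.
have Hd : lam * bilin M dl dl <= eta ^+ 2.
  have := ridge_le n0 lam0 Kp dl; rewrite -mulrA -/M => Hr.
  have : n%:R * (lam * bilin M dl dl) <= n%:R * eta ^+ 2.
    apply: le_trans Hr _; have -> : n%:R * eta ^+ 2 = \sum_(l < n) eta ^+ 2.
      by rewrite sumr_const card_ord mulr_natl.
    apply: ler_sum => l _; rewrite -(real_normK (num_real (dl l))) ler_sqr ?nnegrE//.
    by rewrite /dl distrC; exact: Heta.
  by rewrite ler_pM2l ?ltr0n.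
have : lam * bilin M (fun l => g l + dl l) (fun l => g l + dl l) <= lam * (2 * bilin M g g + 2 * bilin M dl dl).
  by rewrite ler_pM2l.
lra.
Qed.
End Signal.

(** * Concentration of the empirical Gram matrix *)

Section ModelProbability.
Context {R : realType} d (T : measurableType d) (P : probability T R)
  (PX : probability (measurableTypeR R) R) (f0 : R -> R) (sigma0 : R)
  (X Y eps : nat -> {RV P >-> R}).
Variables (K : R -> R -> R) (mu : nat -> R) (phi : nat -> R -> R).
Hypothesis cf0 : {within `[0, 1], continuous f0}.
Hypothesis HR : regression_model PX f0 sigma0 X Y eps.
Hypothesis HM : mercer_decomposition PX mu phi K.
Local Notation I := (`[0%R, 1%R]%classic : set R).
Local Notation integr f := (P.-integrable setT (EFin \o f)).
Local Notation "'Pstar' A" := ((P^*)%mu A) (at level 10, A at next level).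
Let mI : measurable (I : set (measurableTypeR R)). Proof. exact: measurable_itv. Qed.
Let mu0 i : 0 < mu i := mercer_gt0 HM i.

Lemma markov_outer (Z : T -> R) (e c : R) : integr Z -> 0 < e ->
  \int[P]_w `|Z w| <= c -> (Pstar [set w | (e <= `|Z w|)%R] <= (c / e)%:E)%E.
Proof.
move=> IZ e0 Hc.
have mZ : measurable_fun setT Z by exact: integr_measurable IZ.
have mA : measurable [set w | e <= `|Z w|].
  rewrite -[X in measurable X]setTI; apply: measurable_fun_ler => //.
  exact: measurableT_comp.
rewrite outer_measurable//.
have := markov_abs measurableT IZ e0; rewrite setTI => H; apply: le_trans H _.
by rewrite lee_fin ler_pM2r// invr_gt0.
Qed.

Section GramError.
Variables (n : nat) (lam kap : R).
Hypothesis n0 : (0 < n)%N.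
Hypothesis lam0 : 0 < lam.
Hypothesis Hkap : forall m x, 0 <= x <= 1 ->
  \sum_(i < m) shrunk mu phi lam i x ^+ 2 <= kap.
Let n0R : (0 : R) < n%:R. Proof. by rewrite ltr0n. Qed.
Let lm i : 0 < lam + mu i. Proof. by rewrite addr_gt0. Qed.
Let xs (w : T) (l : 'I_n) : R := X l w.
Let e i x := shrunk mu phi lam i x.
Let g i j x := e i x * e j x.
Let m i j : R := (i == j)%:R * (mu i / (lam + mu i)).
Let kap0 : 0 <= kap.
Proof.
by have := Hkap 0%N (x := 0); rewrite lexx ler01 big_ord0; apply.
Qed.

Let e_measurable i : measurable_fun I (e i).
Proof. by apply: measurable_funM => //; exact: (phi_measurable HM). Qed.

Let e2_le i x : 0 <= x <= 1 -> e i x ^+ 2 <= kap.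
Proof.
move=> x01; apply: le_trans (Hkap i.+1 x01); rewrite big_ord_recr/= lerDr.
by apply: sumr_ge0 => j _; exact: sqr_ge0.
Qed.

Let g_le i j x : 0 <= x <= 1 -> `|g i j x| <= kap.
Proof.
move=> x01; rewrite normrM; have := e2_le i x01; have := e2_le j x01.
rewrite -(real_normK (num_real (e i x))) -(real_normK (num_real (e j x))).
have := sqr_ge0 (`|e i x| - `|e j x|); lra.
Qed.

Let g_measurable i j : measurable_fun I (g i j).
Proof. exact: measurable_funM. Qed.

Let g_integr i j : PX.-integrable `[0, 1] (EFin \o g i j).
Proof.
apply: (@integr_bounded _ _ _ PX I mI _ kap); first exact: g_measurable.
by move=> x /mem_itv01; exact: g_le.
Qed.

Let g2_integr i j : PX.-integrable `[0, 1] (EFin \o (fun x => g i j x ^+ 2)).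
Proof.
by apply: (@integr_bounded_sqr _ PX _ kap) => // x; exact: g_le.
Qed.

Let g_mean i j : \int[PX]_(x in `[0, 1]) g i j x = m i j.
Proof.
transitivity (\int[PX]_(x in `[0, 1]) ((Num.sqrt (mu i / (lam + mu i)) * Num.sqrt (mu j / (lam + mu j))) * (phi i x * phi j x))).
  by apply: eq_Rintegral => x _; rewrite /g /e /shrunk mulrACA.
rewrite RintegralZl//; last exact: (integr_phi HM _ (phi_measurable HM i) (phi_integr2 HM i)).
rewrite -/(coef PX phi (phi i) j) (onb_orthonormal (mercer_basis HM)) /m.
case: eqP => [<-|_]; last by rewrite mul0r mulr0.
by rewrite mulr1 mul1r -expr2 sqr_sqrtr// divr_ge0// ltW.
Qed.

Let U i j l w := g i j (X l w) - m i j.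

Let U_facts i j l : [/\ integr (U i j l), integr (fun w => U i j l w ^+ 2),
  \int[P]_w U i j l w = 0 &
  \int[P]_w (U i j l w ^+ 2) <= \int[PX]_(x in `[0, 1]) (g i j x ^+ 2)].
Proof.
have [Ig Eg] := X_integral HR l (g_integr i j).
have [Ig2 Eg2] := X_integral HR l (g2_integr i j).
have Ic c : integr (fun=> c) by exact: finite_measure_integrable_cst.
have Rc c : \int[P]_w c = c by rewrite Rintegral_cst// [X in fine X](probability_setT P) mulr1.
have E w : U i j l w ^+ 2 = g i j (X l w) ^+ 2 - (2 * m i j) * g i j (X l w) + m i j ^+ 2.
  by rewrite /U; ring.
have I2m : integr (fun w => (2 * m i j) * g i j (X l w)) by exact: integrZ.
split.
- exact: integrB.
- rewrite (funext E); apply: integrD => //; exact: integrB.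
- by rewrite RintegralB// Rc Eg g_mean subrr.
- under eq_Rintegral do rewrite E.
  rewrite RintegralD//; last exact: integrB.
  rewrite RintegralB// RintegralZl// Rc Eg2 Eg g_mean.
  have := sqr_ge0 (m i j); lra.
Qed.

Let B i j w := gram_error mu phi lam (xs w) i j.

Let BE i j w : B i j w = n%:R^-1 * \sum_(l < n) U i j l w.
Proof.
rewrite /B /gram_error /U sumrB mulrBr; congr (_ - _).
by rewrite sumr_const card_ord -(mulr_natl (m i j)) [RHS]mulrA mulVf ?mul1r// gt_eqF.
Qed.

Let B2 i j : integr (fun w => B i j w ^+ 2) /\
  \int[P]_w (B i j w ^+ 2) <= n%:R^-1 * \int[PX]_(x in `[0, 1]) (g i j x ^+ 2).
Proof.
have [] := @second_moment_sum _ T R P n (U i j) (\int[PX]_(x in `[0, 1]) (g i j x ^+ 2)).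
- by move=> l _; have [] := U_facts i j l.
- by move=> l _; have [] := U_facts i j l.
- by move=> l _; have [] := U_facts i j l.
- by move=> l _; have [] := U_facts i j l.
- move=> l l' _ _ ll'; have mg : measurable_fun I (fun x => g i j x - m i j).
    by apply: measurable_funB => //; exact: g_measurable.
  exact: (X_independent_comp cf0 HR ll' mg mg).
move=> IS ES.
have E w : B i j w ^+ 2 = (n%:R^-1) ^+ 2 * (\sum_(l < n) U i j l w) ^+ 2.
  by rewrite BE exprMn.
split; first by rewrite (funext E); exact: integrZ.
under eq_Rintegral do rewrite E.
rewrite RintegralZl//; apply: (@le_trans _ _ ((n%:R^-1) ^+ 2 * (n%:R * \int[PX]_(x in `[0, 1]) (g i j x ^+ 2)))).
  by rewrite ler_wpM2l// sqr_ge0.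
by rewrite expr2 mulrA -(mulrA n%:R^-1) mulVf ?mulr1// gt_eqF.
Qed.

Let Z N w := \sum_(i < N) \sum_(j < N) B i j w ^+ 2.

Let Z_integr N : integr (Z N).
Proof.
apply: (integr_sum measurableT (f := fun i w => \sum_(j < N) B i j w ^+ 2)) => i _.
apply: (integr_sum measurableT (f := fun j w => B i j w ^+ 2)) => j _.
by have [] := B2 i j.
Qed.

Let Z_mean N : \int[P]_w Z N w <= kap ^+ 2 / n%:R.
Proof.
have Iij i : integr (fun w => \sum_(j < N) B i j w ^+ 2).
  apply: (integr_sum measurableT (f := fun j w => B i j w ^+ 2)) => j _.
  by have [] := B2 i j.
rewrite (Rintegral_sum measurableT (f := fun i w => \sum_(j < N) B i j w ^+ 2))//.
have Jij i : PX.-integrable `[0, 1] (EFin \o (fun x => \sum_(j < N) g i j x ^+ 2)).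
  by apply: (integr_sum mI (f := fun j x => g i j x ^+ 2)) => j _; exact: g2_integr.
apply: (@le_trans _ _ (n%:R^-1 * \int[PX]_(x in `[0, 1]) (\sum_(i < N) \sum_(j < N) g i j x ^+ 2))).
  rewrite (Rintegral_sum mI (f := fun i x => \sum_(j < N) g i j x ^+ 2))//.
  rewrite mulr_sumr; apply: ler_sum => i _.
  rewrite (Rintegral_sum measurableT (f := fun j w => B i j w ^+ 2)); last by move=> j _; have [] := B2 i j.
  rewrite (Rintegral_sum mI (f := fun j x => g i j x ^+ 2)); last by move=> j _; exact: g2_integr.
  by rewrite mulr_sumr; apply: ler_sum => j _; have [] := B2 i j.
rewrite mulrC ler_pM2r ?invr_gt0//.
apply: (@le_trans _ _ (\int[PX]_(x in `[0, 1]) (kap ^+ 2))).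
  apply: le_Rintegral => //.
  - apply: (integr_sum mI (f := fun i x => \sum_(j < N) g i j x ^+ 2)) => i _.
    exact: Jij.
  - exact: finite_measure_integrable_cst.
  move=> x /mem_itv01 x01; rewrite (_ : \sum_(i < N) _ = (\sum_(i < N) e i x ^+ 2) ^+ 2); last first.
    rewrite [RHS]expr2 mulr_suml; apply: eq_bigr => i _; rewrite mulr_sumr.
    by apply: eq_bigr => j _; rewrite /g exprMn.
  rewrite ler_sqr ?nnegrE//; first exact: Hkap.
  by apply: sumr_ge0 => i _; exact: sqr_ge0.
exact: Rintegral_cst_le (sqr_ge0 _).
Qed.

Let bad N := [set w | 4^-1 < Z N w].

Let Z_nd N N' w : (N <= N')%N -> Z N w <= Z N' w.
Proof.
move=> NN'; rewrite /Z.
rewrite -!(big_mkord predT (fun i => \sum_(j < _) B i j w ^+ 2)).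
rewrite [X in _ <= X](big_cat_nat _ NN')//=; apply: ler_wpDr.
  by apply: sumr_ge0 => i _; apply: sumr_ge0 => j _; exact: sqr_ge0.
apply: ler_sum => i _; rewrite -!(big_mkord predT (fun j => B i j w ^+ 2)).
rewrite [X in _ <= X](big_cat_nat _ NN')//= lerDl.
by apply: sumr_ge0 => j _; exact: sqr_ge0.
Qed.

Let bad_measurable N : measurable (bad N).
Proof.
rewrite -[X in measurable X]setTI; apply: measurable_fun_ltr => //.
exact: integr_measurable (Z_integr N).
Qed.

(** Chebyshev's inequality for the squared Frobenius norm. Its mean is at most
    [1/n] times the second moment of the rank one matrix of products [shrunk i
    (x) * shrunk j (x)], whose squared Frobenius norm is the square of the
    effective dimension at [x]. The truncations [N] increase, so that their bad
    events have a union of the same probability bound. *)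
Lemma gram_error_outer :
  (Pstar (~` [set w | (forall N, \sum_(i < N) \sum_(j < N) gram_error mu phi lam (xs w) i j ^+ 2 <= 4^-1)%R])
   <= (4 * (kap ^+ 2 / n%:R))%:E)%E.
Proof.
have -> : ~` [set w | (forall N, \sum_(i < N) \sum_(j < N) gram_error mu phi lam (xs w) i j ^+ 2 <= 4^-1)%R]
    = \bigcup_N bad N.
  apply/seteqP; split=> w.
    move=> /existsNP[N /negP]; rewrite -ltNge => H; by exists N.
  by move=> [N _ H] /(_ N); apply/negP; rewrite -ltNge.
rewrite outer_measurable; last exact: bigcupT_measurable.
have nd : nondecreasing_seq bad.
  by move=> N N' NN'; apply/subsetPset => w; rewrite /bad /= => H; exact: lt_le_trans H (Z_nd w NN').
have H := @nondecreasing_cvg_mu _ _ _ P _ bad_measurable (bigcupT_measurable _ bad_measurable) nd.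
have <- := cvg_lim _ H; last by [].
apply: lime_le; first by apply/cvg_ex; eexists; exact: H.
apply: nearW => N /=.
rewrite -(outer_measurable P (bad_measurable N)).
have Z0 w : 0 <= Z N w by apply: sumr_ge0 => i _; apply: sumr_ge0 => j _; exact: sqr_ge0.
apply: (@le_trans _ _ (Pstar [set w | (4^-1 <= `|Z N w|)%R])).
  by apply: outer_le => w; rewrite /bad /= => /ltW; rewrite ger0_norm.
have := @markov_outer (Z N) 4^-1 (kap ^+ 2 / n%:R) (Z_integr N).
rewrite (_ : kap ^+ 2 / n%:R / 4^-1 = 4 * (kap ^+ 2 / n%:R)); last by rewrite invrK mulrC.
rewrite invr_gt0; apply => //.
under eq_Rintegral do rewrite ger0_norm//.
exact: Z_mean.
Qed.
End GramError.
End ModelProbability.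

(** * The noise part of the variance estimator *)

Section Noise.
Context {R : realType} d (T : measurableType d) (P : probability T R)
  (PX : probability (measurableTypeR R) R) (f0 : R -> R) (sigma0 : R)
  (X Y eps : nat -> {RV P >-> R}).
Variables (K : R -> R -> R) (mu : nat -> R) (phi : nat -> R -> R).
Hypothesis s0 : 0 < sigma0.
Hypothesis cf0 : {within `[0, 1], continuous f0}.
Hypothesis HR : regression_model PX f0 sigma0 X Y eps.
Hypothesis HK : psd_kernel K.
Hypothesis HM : mercer_decomposition PX mu phi K.
Local Notation integr f := (P.-integrable setT (EFin \o f)).
Local Notation "'Pstar' A" := ((P^*)%mu A) (at level 10, A at next level).
Let X01 i w : 0 <= X i w <= 1. Proof. exact: (model_X01 HR). Qed.
Let mX i : measurable_fun setT (X i : T -> R). Proof. exact: measurable_funP. Qed.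

Lemma integr_cst c : integr (fun=> c). Proof. exact: finite_measure_integrable_cst. Qed.

Lemma Rintegral_prob_cst c : \int[P]_w c = c.
Proof. by rewrite Rintegral_cst// [X in fine X](probability_setT P) mulr1. Qed.

Lemma eps_mean i : integr (eps i) /\ \int[P]_w eps i w = 0.
Proof. by rewrite -(normal_mean s0); exact: (eps_integral HR i (normal_integr1 s0)). Qed.

Lemma eps_sqr_mean i : integr (fun w => eps i w ^+ 2) /\ \int[P]_w (eps i w ^+ 2) = sigma0 ^+ 2.
Proof. by rewrite -(normal_variance s0); exact: (eps_integral HR i (normal_integr2 s0)). Qed.

Lemma eps_pow4_mean i : integr (fun w => eps i w ^+ 4) /\
  \int[P]_w (eps i w ^+ 4) = \int[normal_prob 0 sigma0]_x (x ^+ 4).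
Proof. exact: (eps_integral HR i (normal_integr4 s0)). Qed.

Lemma noise_wlln n (e : R) : (0 < n)%N -> 0 < e ->
  (Pstar [set w | (e <= `|n%:R^-1 * \sum_(i < n) eps i w ^+ 2 - sigma0 ^+ 2|)%R] <=
   ((\int[normal_prob 0 sigma0]_x (x ^+ 4)) / n%:R / e ^+ 2)%:E)%E.
Proof.
move=> n0 e0; set M4 := Rintegral _ _ _; have n0R : (0 : R) < n%:R by rewrite ltr0n.
pose U l w := eps l w ^+ 2 - sigma0 ^+ 2.
have Ic := integr_cst.
have IU l : integr (U l) by apply: integrB => //; have [] := eps_sqr_mean l.
have EU l : \int[P]_w U l w = 0.
  by rewrite RintegralB ?(eps_sqr_mean l).1// (eps_sqr_mean l).2 Rintegral_prob_cst subrr.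
have E2 l w : U l w ^+ 2 = eps l w ^+ 4 - (2 * sigma0 ^+ 2) * eps l w ^+ 2 + sigma0 ^+ 4.
  by rewrite /U; ring.
have I2m l : integr (fun w => (2 * sigma0 ^+ 2) * eps l w ^+ 2).
  by apply: integrZ => //; have [] := eps_sqr_mean l.
have I42 l : integr (fun w => eps l w ^+ 4 - (2 * sigma0 ^+ 2) * eps l w ^+ 2).
  by apply: integrB => //; have [] := eps_pow4_mean l.
have IU2 l : integr (fun w => U l w ^+ 2).
  by rewrite (funext (E2 l)); exact: integrD.
have EU2 l : \int[P]_w (U l w ^+ 2) <= M4.
  under eq_Rintegral do rewrite E2.
  rewrite RintegralD// RintegralB ?(eps_pow4_mean l).1//.
  rewrite RintegralZl ?(eps_sqr_mean l).1// (eps_sqr_mean l).2 (eps_pow4_mean l).2 Rintegral_prob_cst -/M4.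
  have : 0 <= sigma0 ^+ 4 by rewrite exprn_even_ge0.
  have -> : sigma0 ^+ 4 = sigma0 ^+ 2 * sigma0 ^+ 2 by ring.
  lra.
have [IS ES] := @second_moment_sum _ T R P n U M4 (fun l _ => IU2 l) (fun l _ => IU l) (fun l _ => EU l)
  (fun l _ => EU2 l) ltac:(by move=> l l' _ _ ll'; have mg : measurable_fun setT (fun x : R => x ^+ 2 - sigma0 ^+ 2);
    [by apply: measurable_funB => //; exact: measurable_funX|
     exact: (independent2_comp mg mg (eps_independent cf0 HR ll'))]).
pose Z w := (n%:R^-1) ^+ 2 * (\sum_(l < n) U l w) ^+ 2.
have IZ : integr Z by exact: integrZ.
have ZE w : Z w = (n%:R^-1 * \sum_(i < n) eps i w ^+ 2 - sigma0 ^+ 2) ^+ 2.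
  rewrite /Z -exprMn /U sumrB sumr_const card_ord -(mulr_natl (sigma0 ^+ 2)); congr (_ ^+ 2).
  by field; rewrite gt_eqF.
have e2 : 0 < e ^+ 2 by rewrite exprn_gt0.
apply: le_trans (markov_outer (c := M4 / n%:R) IZ e2 _).
  apply: outer_le => w /= H; rewrite ZE normrX ler_sqr ?nnegrE//; exact: ltW.
have Z0 w : 0 <= Z w by rewrite mulr_ge0 ?sqr_ge0.
under eq_Rintegral do rewrite ger0_norm//.
rewrite /Z RintegralZl//; apply: (@le_trans _ _ (n%:R^-1 ^+ 2 * (n%:R * M4))).
  by rewrite ler_wpM2l// sqr_ge0.
by rewrite le_eqVlt; apply/orP; left; apply/eqP; field; rewrite gt_eqF.
Qed.

Section Trace.
Variables (n : nat) (lam : R).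
Hypothesis n0 : (0 < n)%N.
Hypothesis lam0 : 0 < lam.
Let n0R : (0 : R) < n%:R. Proof. by rewrite ltr0n. Qed.
Let xs (w : T) (l : 'I_n) : R := X l w.
Let M w := ridge_inv K lam (xs w).
Let c := n%:R * lam.
Let c0 : 0 < c. Proof. exact: mulr_gt0. Qed.
Let H w (i j : 'I_n) : R := (i == j)%:R - c * M w i j.
Let xs01 w l : 0 <= xs w l <= 1. Proof. exact: X01. Qed.
Let Kp w := fun v => kernel_sample_psd HK (xs01 w) v.
Let es (w : T) (l : 'I_n) : R := eps l w.

Let tau w := n%:R^-1 * \sum_i H w i i.
Let Z w := n%:R^-1 * \sum_i es w i ^+ 2 - lam * bilin (M w) (es w) (es w).

Let H_le w i j : `|H w i j| <= 2.
Proof.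
apply: le_trans (ler_normB _ _) _.
have := ridge_entry_le n0 lam0 (kernel_sample_sym HK (xs01 w)) (Kp w) i j.
rewrite -/c -/(M w) => H1; have -> : (2 : R) = 1 + 1 by [].
by apply: lerD => //; case: (i == j); rewrite ?normr1 ?normr0.
Qed.

Let Hii w i : 0 <= H w i i <= 1.
Proof.
rewrite /H eqxx.
have := ridge_entry_le n0 lam0 (kernel_sample_sym HK (xs01 w)) (Kp w) i i.
rewrite -/c -/(M w) ler_norml => /andP[_ H1]; rewrite subr_ge0 H1/= gerBl mulr_ge0 ?(ltW c0)//.
have := ridge_psd n0 lam0 (Kp w) (fun a => (a == i)%:R); rewrite -/(M w) /bilin (bigD1 i)//= [X in _ + X]big1 ?addr0; last first.
  by move=> a ai; rewrite big1// => b _; rewrite (negbTE ai) !mul0r.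
rewrite (bigD1 i)//= [X in _ + X]big1 ?addr0; last first.
  by move=> a ai; rewrite (negbTE ai) mulr0.
by rewrite !eqxx mul1r mulr1.
Qed.

Let tau01 w : 0 <= tau w <= 1.
Proof.
rewrite /tau mulr_ge0 ?invr_ge0 ?(ltW n0R)//=; last first.
  by apply: sumr_ge0 => i _; have /andP[] := Hii w i.
rewrite mulrC ler_pdivrMr// mul1r.
have -> : (n%:R : R) = \sum_(i < n) 1 by rewrite sumr_const card_ord.
by apply: ler_sum => i _; have /andP[] := Hii w i.
Qed.

Let ZE w : Z w = n%:R^-1 * \sum_i \sum_j H w i j * (es w i * es w j).
Proof.
have -> : \sum_i \sum_j H w i j * (es w i * es w j) = \sum_i es w i ^+ 2 - c * bilin (M w) (es w) (es w).
  rewrite /bilin mulr_sumr -sumrB; apply: eq_bigr => i _.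
  rewrite mulr_sumr /H; under eq_bigr do rewrite mulrBl; rewrite sumrB; congr (_ - _).
    rewrite (bigD1 i)//= big1 ?addr0 ?eqxx ?mul1r ?expr2// => j ji.
    by rewrite eq_sym (negbTE ji) mul0r.
  by apply: eq_bigr => j _; ring.
by rewrite mulrBr /c !mulrA mulVf ?mul1r// gt_eqF.
Qed.

Let Z_ge0 w : 0 <= Z w.
Proof.
rewrite /Z subr_ge0 -(ler_pM2l n0R) mulrA -/c [X in _ <= X]mulrA divff ?mul1r ?gt_eqF//.
exact: (ridge_le n0 lam0 (Kp w)).
Qed.

Let H_measurable d' (T' : measurableType d') (x : T' -> 'I_n -> R) i j :
  (forall l, measurable_fun setT (fun w => x w l)) -> (forall w l, 0 <= x w l <= 1) ->
  measurable_fun setT (fun w => (i == j)%:R - c * ridge_inv K lam (x w) i j).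
Proof.
move=> mx x01; apply: measurable_funB => //; apply: measurable_funM => //.
exact: (measurable_ridge HM HK).
Qed.

Let mH i j : measurable_fun setT (fun w => H w i j).
Proof. by apply: H_measurable => // l; exact: mX. Qed.

Let IH i j : integr (fun w => H w i j).
Proof. by apply: (@integr_bounded _ _ _ P setT measurableT _ 2) => // w _; exact: H_le. Qed.

(* [eps_i] is independent of the design together with the other noise
   variables, hence of [H i j * eps_j] when [j] differs from [i], and of [H i
   i]. *)
Let cross i j : integr (fun w => H w i j * (es w i * es w j)) /\
  \int[P]_w (H w i j * (es w i * es w j)) = if i == j then sigma0 ^+ 2 * \int[P]_w H w i i else 0.
Proof.
have mHo : measurable_fun setT ((fun w => H w i j) : g_sigma_algebraType (others X eps n i) -> R).
  apply: (@H_measurable _ (g_sigma_algebraType (others X eps n i)) xs) => // l.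
  exact: others_X.
case: eqP => [<-|/eqP ij].
  have mHi : measurable_fun setT ((fun w => H w i i) : g_sigma_algebraType (others X eps n i) -> R).
    apply: (@H_measurable _ (g_sigma_algebraType (others X eps n i)) xs) => // l.
    exact: others_X.
  have mg : measurable_fun setT (fun x : R => x ^+ 2) by exact: measurable_funX.
  have ind := eps_others_independent cf0 HR (ltn_ord i) mg mHi.
  have [I1 E1] := integr_indepM ind (eps_sqr_mean i).1 (IH i i).
  have E : (fun w => H w i i * (es w i * es w i)) = fun w => eps i w ^+ 2 * H w i i.
    by apply/funext => w; rewrite -expr2 mulrC.
  by rewrite E; split=> //; rewrite E1 (eps_sqr_mean i).2.
pose W w := H w i j * eps j w.
have mW : measurable_fun setT (W : g_sigma_algebraType (others X eps n i) -> R).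
  by apply: measurable_funM => //; apply: others_eps => //; apply: contraNneq ij => /val_inj ->.
have IW : integr W.
  exact: (@integrM_bounded _ _ _ P setT measurableT _ _ 2 (mH i j) (fun w _ => H_le w i j) (eps_mean j).1).
have mid : measurable_fun setT (@id R) by exact: measurable_id.
have ind := eps_others_independent cf0 HR (ltn_ord i) mid mW.
have [I1 E1] := integr_indepM ind (eps_mean i).1 IW.
have E : (fun w => H w i j * (es w i * es w j)) = fun w => eps i w * W w.
  by apply/funext => w; rewrite /W mulrCA.
by rewrite E; split=> //; rewrite E1 (eps_mean i).2 mul0r.
Qed.

Let inner i : integr (fun w => \sum_(j < n) H w i j * (es w i * es w j)) /\
  \int[P]_w (\sum_(j < n) H w i j * (es w i * es w j)) = sigma0 ^+ 2 * \int[P]_w H w i i.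
Proof.
pose F (j : nat) w := if insub j is Some j' then H w i j' * (es w i * es w j') else 0.
have FE (j : 'I_n) : F j = fun w => H w i j * (es w i * es w j).
  by apply/funext => w; rewrite /F valK.
have IF j : (j < n)%N -> integr (F j).
  by move=> jn; rewrite (FE (Ordinal jn)); have [] := cross i (Ordinal jn).
have E : (fun w => \sum_(j < n) H w i j * (es w i * es w j)) = fun w => \sum_(j < n) F j w.
  by apply/funext => w; apply: eq_bigr => j _; rewrite FE.
rewrite E; split; first exact: (integr_sum measurableT IF).
rewrite (Rintegral_sum measurableT IF) (bigD1 i)//= big1 ?addr0; last first.
  by move=> j ji; rewrite FE (cross i j).2 eq_sym (negbTE ji).
by rewrite FE (cross i i).2 eqxx.
Qed.

Let tau_integr : integr tau.
Proof.
apply: (@integr_bounded _ _ _ P setT measurableT _ 1).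
  apply: measurable_funM => //; apply: measurable_sum => i; exact: mH.
by move=> w _; have /andP[t0 t1] := tau01 w; rewrite ger0_norm.
Qed.

Let Z_mean : integr Z /\ \int[P]_w Z w = sigma0 ^+ 2 * \int[P]_w tau w.
Proof.
pose F (i : nat) w := if insub i is Some i' then \sum_(j < n) H w i' j * (es w i' * es w j) else 0.
have FE (i : 'I_n) : F i = fun w => \sum_(j < n) H w i j * (es w i * es w j).
  by apply/funext => w; rewrite /F valK.
have IF i : (i < n)%N -> integr (F i).
  by move=> im; rewrite (FE (Ordinal im)); have [] := inner (Ordinal im).
pose G (i : nat) w := if insub i is Some i' then H w i' i' else 0.
have GE (i : 'I_n) : G i = fun w => H w i i by apply/funext => w; rewrite /G valK.
have IG i : (i < n)%N -> integr (G i) by move=> im; rewrite (GE (Ordinal im)); exact: IH.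
have EZ : Z = fun w => n%:R^-1 * \sum_(i < n) F i w.
  by apply/funext => w; rewrite ZE; congr (_ * _); apply: eq_bigr => i _; rewrite FE.
have Et : tau = fun w => n%:R^-1 * \sum_(i < n) G i w.
  by apply/funext => w; congr (_ * _); apply: eq_bigr => i _; rewrite GE.
have ISF := integr_sum measurableT IF; have ISG := integr_sum measurableT IG.
rewrite EZ Et; split; first exact: integrZ.
rewrite !RintegralZl// (Rintegral_sum measurableT IF) (Rintegral_sum measurableT IG).
rewrite [RHS]mulrCA; congr (_ * _); rewrite mulr_sumr; apply: eq_bigr => i _.
by rewrite FE GE (inner i).2.
Qed.

(** Markov's inequality. The mean is [sigma0^2] times that of the normalized
    trace, which is at most 1, and at most [e] outside an event of probability
    [p]. *)
Lemma smoother_noise_outer (u : T -> 'I_n -> R) (e p dl : R) :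
  (forall w, ordered_eigenvalues (gram K (xs w)) (u w)) -> 0 < e -> 0 < dl ->
  (Pstar [set w | (e%:E <= `|(n%:R^-1 * \sum_(i < n) u w i / (n%:R * lam + u w i))%:E - 0|)%E] <= p%:E)%E ->
  (Pstar [set w | (dl <= n%:R^-1 * \sum_i es w i ^+ 2 - lam * bilin (M w) (es w) (es w))%R]
   <= (sigma0 ^+ 2 * (e + p) / dl)%:E)%E.
Proof.
move=> Hu e0 dl0 Hp.
have tE w : tau w = n%:R^-1 * \sum_(i < n) u w i / (n%:R * lam + u w i).
  by rewrite /tau /H; have [_ /(ridge_trace n0 lam0 (Kp w)) <-] := Hu w; congr (_ * _); apply: eq_bigr => i _; rewrite eqxx.
have mtau : measurable_fun setT tau by exact: integr_measurable tau_integr.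
pose A := [set w | e <= tau w].
have mA : measurable A.
  by rewrite -[X in measurable X]setTI; apply: measurable_fun_ler.
have PA : (P A <= p%:E)%E.
  rewrite -(outer_measurable P mA); apply: le_trans Hp; apply: outer_le => w Aw.
  have : (e%:E <= `|(tau w)%:E - 0|)%E.
    by rewrite sube0 /= lee_fin ger0_norm//; have /andP[] := tau01 w.
  by rewrite tE.
have IA : integr (\1_A : T -> R) by exact: integrable_indic.
have Et : \int[P]_w tau w <= e + p.
  apply: (@le_trans _ _ (\int[P]_w (e + \1_A w))).
    apply: le_Rintegral => //; first exact: integrD (integr_cst e) IA.
    move=> w _; rewrite indicE; case: (boolP (w \in A)) => wA.
      by have /andP[_ t1] := tau01 w; apply: le_trans t1 _; rewrite lerDr ltW.
    by rewrite addr0; move: wA; rewrite notin_setE /A /= => /negP; rewrite -ltNge => /ltW.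
  rewrite RintegralD//; last exact: integr_cst.
  rewrite Rintegral_prob_cst lerD2l -lee_fin -EFin_Rintegral// integral_indic// setIT.
  exact: PA.
have [IZ EZ] := Z_mean.
apply: le_trans (markov_outer (c := sigma0 ^+ 2 * (e + p)) IZ dl0 _).
  by apply: outer_le => w /= Hw; rewrite -/(Z w) ger0_norm.
under eq_Rintegral do rewrite ger0_norm//.
by rewrite EZ ler_wpM2l// sqr_ge0.
Qed.

End Trace.
End Noise.

(** * Consistency of the variance estimator *)

Section Asymptotics.
Context {R : realType}.
Local Open Scope ereal_scope.

Lemma ereal_cvg0P (a : nat -> \bar R) : (forall n, 0 <= a n) ->
  a @ \oo --> 0 <-> forall e : R, (0 < e)%R -> \forall n \near \oo, a n <= e%:E.
Proof.
move=> a0; split=> [H e e0|H].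
  have : nbhs (0 : \bar R) [set y | y < e%:E].
    by apply: open_nbhs_nbhs; split; [exact: open_ereal_lt_ereal|rewrite /= lte_fin].
  move=> /H Hn; near=> n; apply: ltW; near: n; exact: Hn.
apply/fine_cvgP; split.
  have := H 1%R ltr01; apply: filterS => n an.
  by rewrite ge0_fin_numE// (le_lt_trans an)// ltry.
apply/cvgrPdist_le => e e0; have := H e e0; apply: filterS => n an.
have fn : a n \is a fin_num by rewrite ge0_fin_numE// (le_lt_trans an)// ltry.
by rewrite /= sub0r normrN ger0_norm ?fine_ge0// -lee_fin fineK.
Unshelve. all: by end_near. Qed.

Lemma cvg_in_probP d (T : measurableType d) (P : probability T R) (Z : nat -> T -> \bar R) (c : \bar R) :
  cvg_in_prob P Z c <-> forall e p : R, (0 < e)%R -> (0 < p)%R ->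
    \forall n \near \oo, (P^*)%mu [set w | e%:E <= `|Z n w - c|] <= p%:E.
Proof.
split=> [H e p e0 p0|H e e0].
  have a0 n : 0 <= (P^*)%mu [set w | e%:E <= `|Z n w - c|] by exact: outer_measure_ge0.
  exact: (ereal_cvg0P a0).1 (H e e0) p p0.
have a0 n : 0 <= (P^*)%mu [set w | e%:E <= `|Z n w - c|] by exact: outer_measure_ge0.
by apply/(ereal_cvg0P a0) => p p0; exact: H.
Qed.

Lemma sup_norm_le (f : R -> R) (C : R) : sup_norm f <= C%:E <->
  forall x, (0 <= x <= 1)%R -> (`|f x| <= C)%R.
Proof.
split=> [H x x01|H].
  rewrite -lee_fin; apply: le_trans H; apply: ereal_sup_ubound.
  by exists x => //; rewrite /= in_itv.
apply: ge_ereal_sup => _ [x /= x01 <-]; rewrite lee_fin; apply: H.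
by move: x01; rewrite in_itv.
Qed.

Lemma sup_norm_ge0 (f : R -> R) : 0 <= sup_norm f.
Proof.
apply: (@le_trans _ _ `|f 0%R|%:E); first by rewrite lee_fin.
by apply: ereal_sup_ubound; exists 0%R => //; rewrite /= in_itv/= lexx ler01.
Qed.

Lemma near_inv_nat (e : R) : (0 < e)%R -> \forall n \near \oo, (n%:R^-1 <= e)%R.
Proof.
move=> e0; near=> n.
have n0 : (0 < n)%N by near: n; exists 1%N.
rewrite invf_ple ?posrE ?ltr0n//.
by near: n; exact: nbhs_infty_ger.
Unshelve. all: by end_near. Qed.
End Asymptotics.

Section VarianceEstimator.
Context {R : realType} d (T : measurableType d) (P : probability T R)
  (PX : probability (measurableTypeR R) R) (f0 : R -> R) (sigma0 : R)
  (X Y eps : nat -> {RV P >-> R}).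
Variables (K : R -> R -> R) (mu : nat -> R) (phi : nat -> R -> R).
Hypothesis s0 : 0 < sigma0.
Hypothesis cf0 : {within `[0, 1], continuous f0}.
Hypothesis HR : regression_model PX f0 sigma0 X Y eps.
Hypothesis HK : psd_kernel K.
Hypothesis HM : mercer_decomposition PX mu phi K.

(** The cross term of the quadratic form is absorbed by [k * b + A / k], by
    Cauchy-Schwarz and a weighted arithmetic-geometric mean inequality. *)
Lemma variance_decomposition n lam (x y e : 'I_n -> R) b A Z k :
  (0 < n)%N -> 0 < lam -> (forall l, 0 <= x l <= 1) ->
  (forall l, y l = f0 (x l) + e l) -> 0 < k ->
  lam * bilin (ridge_inv K lam x) (fun l => f0 (x l)) (fun l => f0 (x l)) <= b ->
  A = n%:R^-1 * \sum_i e i ^+ 2 ->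
  Z = A - lam * bilin (ridge_inv K lam x) e e ->
  `|sigma2_hat K lam x y - sigma0 ^+ 2| <= `|A - sigma0 ^+ 2| + `|Z| + (b + k * b + A / k).
Proof.
move=> n0 lam0 x01 Hy k0 Hb HA HZ; set M := ridge_inv _ _ _ in Hb HZ.
have Kp := fun v => kernel_sample_psd HK x01 v.
have Msym := ridge_sym lam (kernel_sample_sym HK x01).
have Mpsd := ridge_psd n0 lam0 Kp.
pose f l := f0 (x l); rewrite -/f in Hb.
have E : sigma2_hat K lam x y = lam * bilin M f f + 2 * (lam * bilin M f e) + lam * bilin M e e.
  rewrite /sigma2_hat -/M (bilinE M) (_ : y = fun l => f l + e l); last exact/funext.
  by rewrite (bilin_sqrD Msym); ring.
have n0R : (0 : R) < n%:R by rewrite ltr0n.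
have eA : lam * bilin M e e <= A.
  have := ridge_le n0 lam0 Kp e; rewrite -mulrA -/M HA => H.
  by rewrite -(ler_pM2l n0R) [X in _ <= X]mulrA divff ?gt_eqF// mul1r.
have f0' : 0 <= lam * bilin M f f by rewrite mulr_ge0 ?Mpsd// ltW.
have e0' : 0 <= lam * bilin M e e by rewrite mulr_ge0 ?Mpsd// ltW.
have CS : (lam * bilin M f e) ^+ 2 <= (lam * bilin M f f) * (lam * bilin M e e).
  rewrite exprMn [X in _ <= X]mulrACA -expr2 ler_pM2l ?exprn_gt0//.
  exact: bilin_cauchy_schwarz.
have cr : `|2 * (lam * bilin M f e)| <= k * b + A / k.
  have kb0 : 0 <= k * b by rewrite mulr_ge0 ?(ltW k0)// (le_trans f0').
  have Ak0 : 0 <= A / k by rewrite divr_ge0 ?(ltW k0)// (le_trans e0').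
  rewrite -ler_sqr ?nnegrE ?addr_ge0// real_normK ?num_real// exprMn.
  apply: (@le_trans _ _ (4 * ((k * b) * (A / k)))).
    have -> : (k * b) * (A / k) = b * A by field; rewrite gt_eqF.
    rewrite (_ : 2 ^+ 2 = 4 :> R); last by ring.
    rewrite ler_pM2l//; apply: le_trans CS _; exact: ler_pM.
  have := sqr_ge0 (k * b - A / k); lra.
rewrite E (_ : _ - sigma0 ^+ 2 = (A - sigma0 ^+ 2) - Z + (lam * bilin M f f + 2 * (lam * bilin M f e))); last first.
  by rewrite HZ; ring.
apply: le_trans (ler_normD _ _) _; apply: lerD; first exact: ler_normB.
apply: le_trans (ler_normD _ _) _; rewrite -addrA; apply: lerD => //.
by rewrite ger0_norm.
Qed.

Theorem variance_estimator_consistent (lambda : nat -> R) (u : forall n : nat, T -> 'I_n -> R) :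
  (forall n w, ordered_eigenvalues (gram K (fun i : 'I_n => X i w)) (u n w)) ->
  (forall n, 0 < lambda n) ->
  cvg_in_prob P
    (fun n w => (n%:R^-1 *
       \sum_(i < n) u n w i / (n%:R * lambda n + u n w i))%:E) 0%E ->
  (fun n => sup_norm (fun x => f_lambda PX mu phi f0 (lambda n) x - f0 x))
    @ \oo --> 0%E ->
  cvg_in_prob P (fun n w => (sigma2_hat K (lambda n) (fun i : 'I_n => X i w) (fun i : 'I_n => Y i w))%:E)
    (sigma0 ^+ 2)%:E.
Proof.
move=> Hu lam0 Htr Hsup; apply/cvg_in_probP => e p e0 p0.
have v0 : 0 < sigma0 ^+ 2 by rewrite exprn_gt0.
set v := sigma0 ^+ 2 in v0 *.
pose dl := Num.min (e / 8) v.
have dl0 : 0 < dl by rewrite lt_min divr_gt0.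
have dle : dl <= e / 8 by rewrite ge_min lexx.
have dlv : dl <= v by rewrite ge_min lexx orbT.
(* The weight [k] makes [A / k] small once [A <= 2 v]; the bound [b] on the
   signal then makes [b + k * b] small. *)
pose k := 16 * v / e; have k0 : 0 < k by rewrite divr_gt0// mulr_gt0.
pose b := e / (8 * (1 + k)).
have k10 : 0 < 1 + k by rewrite addr_gt0.
have b0 : 0 < b by rewrite divr_gt0// mulr_gt0.
set A1 := Num.sqrt (\int[PX]_(x in `[0, 1]) (f0 x ^+ 2)).
have A10 : 0 <= A1 := sqrtr_ge0 _.
pose eta := Num.min 1 (b / (2 * A1 + 2)).
have A20 : 0 < 2 * A1 + 2 by rewrite ltr_wpDl// mulr_ge0.
have eta0 : 0 < eta by rewrite lt_min ltr01 divr_gt0.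
have eta1 : eta <= 1 by rewrite ge_min lexx.
have etab : eta * (2 * A1 + 2) <= b by rewrite -ler_pdivlMr// ge_min lexx orbT.
set M4 := \int[normal_prob 0 sigma0]_x (x ^+ 4).
have M40 : 0 <= M4 by apply: Rintegral_ge0 => x _; rewrite exprn_even_ge0.
pose ee := p * dl / (4 * v).
have ee0 : 0 < ee by rewrite divr_gt0// mulr_gt0.
have Hs := (ereal_cvg0P (fun n => sup_norm_ge0 _)).1 Hsup _ eta0.
have Ht := (cvg_in_probP _ _ _).1 Htr _ _ ee0 ee0.
have q0 : 0 < p * dl ^+ 2 / (2 * (M4 + 1)).
  by rewrite divr_gt0// mulr_gt0// ?exprn_gt0// ltr_wpDl.
have Hn := near_inv_nat q0.
near=> n.
have n0 : (0 < n)%N by near: n; exists 1%N.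
have hsup : (sup_norm (fun x => (f_lambda PX mu phi f0 (lambda n) x - f0 x)%R) <= eta%:E)%E by near: n.
have htr : ((P^*)%mu [set w | (ee%:E <= `|(n%:R^-1 * \sum_(i < n) u n w i / (n%:R * lambda n + u n w i))%:E - 0|)%E] <= ee%:E)%E by near: n.
have hn : n%:R^-1 <= p * dl ^+ 2 / (2 * (M4 + 1)) by near: n.
have {}hsup := (sup_norm_le _ _).1 hsup.
have H1 := noise_wlln s0 cf0 HR n0 dl0.
have H2 := smoother_noise_outer s0 cf0 HR HK HM n0 (lam0 n) (Hu n) ee0 dl0 htr.
apply: (@le_trans _ _ ((P^*)%mu (
  [set w | (dl <= `|n%:R^-1 * \sum_(i < n) eps i w ^+ 2 - sigma0 ^+ 2|)%R] `|`
  [set w | (dl <= n%:R^-1 * \sum_(i < n) eps i w ^+ 2 - lambda n * bilin (ridge_inv K (lambda n) (fun i : 'I_n => X i w)) (fun i : 'I_n => eps i w) (fun i : 'I_n => eps i w))%R]))).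
  apply: outer_le => w Hw; apply: contrapT => /not_orP[/negP N1 /negP N2].
  move: N1 N2; rewrite -!ltNge => N1 N2.
  have X01 (l : 'I_n) : 0 <= X l w <= 1 by exact: (model_X01 HR).
  have sb := signal_bound HM HK cf0 (lam0 n) (ltW eta0) hsup n0 X01.
  have sb' : lambda n * bilin (ridge_inv K (lambda n) (fun i : 'I_n => X i w)) (fun l : 'I_n => f0 (X l w)) (fun l : 'I_n => f0 (X l w)) <= b.
    apply: le_trans sb _; apply: le_trans etab; rewrite -/A1.
    have : eta ^+ 2 <= eta by rewrite expr2 ger_pMl.
    lra.
  have vd := variance_decomposition n0 (lam0 n) X01 (fun l : 'I_n => model_Y HR l w) k0 sb' erefl erefl.
  set A := n%:R^-1 * _ in vd N1 N2.
  have Z0 : 0 <= A - lambda n * bilin (ridge_inv K (lambda n) (fun i : 'I_n => X i w)) (fun i : 'I_n => eps i w) (fun i : 'I_n => eps i w).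
    have n0R : (0 : R) < n%:R by rewrite ltr0n.
    have := ridge_le n0 (lam0 n) (fun v => kernel_sample_psd HK X01 v) (fun i : 'I_n => eps i w); rewrite -mulrA => H.
    by rewrite subr_ge0 -(ler_pM2l n0R) [X in _ <= X]mulrA divff ?gt_eqF// mul1r.
  move: vd; rewrite (ger0_norm Z0) -/v => vd.
  have : e <= `|sigma2_hat K (lambda n) (fun i : 'I_n => X i w) (fun i : 'I_n => Y i w) - v|.
    by rewrite -lee_fin.
  have Av : A <= 2 * v by have := ler_norm (A - v); move: N1; rewrite -/v; lra.
  have Ak : A / k <= e / 8.
    have -> : e / 8 = 2 * v / k by rewrite /k; field; rewrite !gt_eqF.
    by rewrite ler_pM2r// invr_gt0.
  have bk : b + k * b = e / 8 by rewrite /b; field; rewrite gt_eqF.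
  move: N1; rewrite -/v; lra.
apply: (@le_trans _ _ (p / 2 + p / 2)%:E); last by rewrite lee_fin; lra.
apply: outerU.
  apply: le_trans H1 _; rewrite lee_fin -/M4 ler_pdivrMr ?exprn_gt0//.
  apply: (@le_trans _ _ ((M4 + 1) * n%:R^-1)); first by rewrite ler_wpM2r ?invr_ge0// lerDl.
  rewrite mulrC -ler_pdivlMr ?ltr_wpDl//; apply: le_trans hn _.
  by rewrite le_eqVlt; apply/orP; left; apply/eqP; field; rewrite gt_eqF// ltr_wpDl.
apply: le_trans H2 _; rewrite lee_fin -/v le_eqVlt; apply/orP; left; apply/eqP.
by rewrite /ee; field; rewrite !gt_eqF.
Unshelve. all: by end_near. Qed.
End VarianceEstimator.

(** * Fluctuations of the posterior around its mean *)

Section Posterior.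
Context {R : realType} (PX : probability (measurableTypeR R) R).
Variables (mu : nat -> R) (phi : nat -> R -> R) (K : R -> R -> R) (k : nat).
Hypothesis HM : mercer_decomposition PX mu phi K.
Hypothesis HK : psd_kernel K.
Hypothesis CK : C2k01 k K.
Variables (C L : R).
Hypothesis L0 : 0 < L.
Hypothesis phiA : forall i x, 0 <= x <= 1 -> `|Dn k (phi i) x| <= C * i.+1%:R ^+ k.
Hypothesis phiB : forall i x x', 0 <= x <= 1 -> 0 <= x' <= 1 ->
  `|Dn k (phi i) x - Dn k (phi i) x'| <= L * i.+1%:R ^+ k.+1 * `|x - x'|.
Variables (n : nat) (lam : R) (x y : 'I_n -> R).
Hypothesis n0 : (0 < n)%N.
Hypothesis lam0 : 0 < lam.
Hypothesis x01 : forall l, 0 <= x l <= 1.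
Variables (W Wh : R).
Hypothesis HW : forall m t, 0 <= t <= 1 ->
  \sum_(i < m) mu i / (lam + mu i) * Dn k (phi i) t ^+ 2 <= W.
Hypothesis HWh : forall m, \sum_(i < m) i.+1%:R ^+ (2 * k.+1) * mu i / (lam + mu i) <= Wh.

Let mu0 i : 0 < mu i := mercer_gt0 HM i.
Let lm i : 0 < lam + mu i. Proof. by rewrite addr_gt0. Qed.
Let sq i : Num.sqrt (mu i) ^+ 2 = mu i. Proof. by rewrite sqr_sqrtr// ltW. Qed.
Local Notation psi i := (Dn k (phi i)).
Let M := ridge_inv K lam x.

Let mu_le i : mu i <= mu 0%N.
Proof. exact: (mercer_noninc HM). Qed.

Let S := (lam + mu 0%N) * Wh.

(* At fixed [lam], the effective dimension of order [k + 1] bounds the moments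
   of the eigenvalues that dominate the differentiated Mercer series. *)
Let weight_le m : \sum_(i < m) mu i * i.+1%:R ^+ (2 * k.+1) <= S.
Proof.
apply: (@le_trans _ _ ((lam + mu 0%N) * \sum_(i < m) i.+1%:R ^+ (2 * k.+1) * mu i / (lam + mu i))); last first.
  by rewrite ler_wpM2l// ltW.
rewrite mulr_sumr; apply: ler_sum => i _; rewrite mulrA ler_pdivlMr//.
have p0 : 0 <= mu i * i.+1%:R ^+ (2 * k.+1) by rewrite mulr_ge0 ?(ltW (mu0 i))// exprn_ge0.
have := ler_wpM2l p0 (_ : lam + mu i <= lam + mu 0%N); rewrite lerD2l => /(_ (mu_le i)).
lra.
Qed.

Let weight_le' m : \sum_(i < m) mu i * i.+1%:R ^+ (2 * k) <= S.
Proof.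
apply: le_trans (weight_le m); apply: ler_sum => i _; rewrite ler_pM2l//.
rewrite -!natrX ler_nat leq_pexp2l// leq_mul2l leqnSn.
by rewrite orbT.
Qed.

Let k01 := partial01_mercer HM HK CK phiA weight_le'.
Let k12 := partial12_mercer HM HK CK phiA weight_le'.

Lemma Dn_phi_incr_le t t' m : 0 <= t <= 1 -> 0 <= t' <= 1 ->
  \sum_(i < m) mu i * (psi i t - psi i t') ^+ 2 <= L ^+ 2 * (t - t') ^+ 2 * S.
Proof.
move=> t01 t'01; apply: (@le_trans _ _ (L ^+ 2 * (t - t') ^+ 2 * \sum_(i < m) mu i * i.+1%:R ^+ (2 * k.+1))); last first.
  by rewrite ler_wpM2l// mulr_ge0 ?sqr_ge0.
rewrite mulr_sumr; apply: ler_sum => i _; rewrite [X in _ <= X]mulrCA ler_pM2l//.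
have := phiB i t01 t'01; rewrite -(real_normK (num_real (psi i t - _))) => H.
apply: (@le_trans _ _ ((L * i.+1%:R ^+ k.+1 * `|t - t'|) ^+ 2)).
  by rewrite ler_sqr ?nnegrE// (le_trans (normr_ge0 _) H).
rewrite !exprMn real_normK ?num_real// mulnC exprM le_eqVlt; apply/orP; left; apply/eqP; ring.
Qed.

Lemma partial01_lipschitz z : 0 <= z <= 1 -> exists2 D : R, 0 < D &
  forall t t', 0 <= t <= 1 -> 0 <= t' <= 1 ->
    `|partial01 k K t z - partial01 k K t' z| <= D * `|t - t'|.
Proof.
move=> z01; pose D := Num.sqrt (L ^+ 2 * S * K z z) + 1.
have S0 : 0 <= S by have := weight_le 0%N; rewrite big_ord0.
exists D; first by rewrite ltr_wpDl// sqrtr_ge0.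
move=> t t' t01 t'01.
have H : \sum_(i < m) (Num.sqrt (mu i) * (psi i t - psi i t')) * (Num.sqrt (mu i) * phi i z) @[m --> \oo] -->
    partial01 k K t z - partial01 k K t' z.
  apply: (cvg_trans _ (cvgB (k01 t01 z01) (k01 t'01 z01))); apply: near_eq_cvg; apply: nearW => m.
  by rewrite !fctE -sumrB; apply: eq_bigr => i _; ring.
have K0 : 0 <= K z z by have := mercer_diag_le HM 0%N z01; rewrite big_ord0.
have := @cauchy_schwarz_lim _ (fun i => Num.sqrt (mu i) * (psi i t - psi i t')) (fun i => Num.sqrt (mu i) * phi i z)
  (L ^+ 2 * (t - t') ^+ 2 * S) (K z z) _ _ (fun m => mercer_diag_le HM m z01) H.
move=> H2; have {}H2 : (partial01 k K t z - partial01 k K t' z) ^+ 2 <= L ^+ 2 * (t - t') ^+ 2 * S * K z z.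
  apply: H2 => m; apply: le_trans (Dn_phi_incr_le m t01 t'01); rewrite le_eqVlt; apply/orP; left; apply/eqP.
  by apply: eq_bigr => i _; rewrite exprMn sq.
apply: (@le_trans _ _ (Num.sqrt (L ^+ 2 * S * K z z) * `|t - t'|)); last by rewrite ler_wpM2r// lerDl.
have B0 : 0 <= L ^+ 2 * S * K z z by rewrite mulr_ge0// mulr_ge0// sqr_ge0.
rewrite -ler_sqr ?nnegrE ?mulr_ge0 ?sqrtr_ge0// real_normK ?num_real//.
apply: le_trans H2 _; rewrite exprMn sqr_sqrtr// real_normK ?num_real//.
by rewrite le_eqVlt; apply/orP; left; apply/eqP; ring.
Qed.

Lemma lipschitz_continuous01 (h : R -> R) D : 0 < D ->
  (forall t t', 0 <= t <= 1 -> 0 <= t' <= 1 -> `|h t - h t'| <= D * `|t - t'|) ->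
  {within `[0, 1], continuous h}.
Proof.
move=> D0 H; apply/subspace_continuousP => t; rewrite /= in_itv/= => t01.
apply/cvgrPdist_le => e e0.
have eD : 0 < e / D by rewrite divr_gt0.
exists (e / D) => // t' /= tt'; rewrite in_itv/= => t'01; apply: le_trans (H _ _ t01 t'01) _.
by rewrite mulrC -ler_pdivlMr// ltW.
Qed.

(** Continuity is what extends bounds from dyadic points to the interval. *)
Lemma post_mean_continuous : {within `[0, 1], continuous (post_mean K lam x y k)}.
Proof.
have /choice[D HD] : forall l, exists D : R, 0 < D /\ forall t t', 0 <= t <= 1 -> 0 <= t' <= 1 ->
    `|partial01 k K t (x l) - partial01 k K t' (x l)| <= D * `|t - t'|.
  by move=> l; have [D D0 HD] := partial01_lipschitz (x01 l); exists D.
pose r := ridge_sol K lam x y.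
apply: (@lipschitz_continuous01 _ (\sum_l D l * `|r l| + 1)).
  by rewrite ltr_wpDl// sumr_ge0// => l _; rewrite mulr_ge0// ltW// (HD l).1.
move=> t t' t01 t'01; rewrite /post_mean !(bilinE M) !bilin_sol -sumrB.
apply: (@le_trans _ _ (\sum_l D l * `|r l| * `|t - t'|)).
  apply: le_trans (ler_norm_sum _ _ _) _; apply: ler_sum => l _.
  rewrite -mulrBl normrM mulrAC ler_wpM2r//; exact: (HD l).2.
by rewrite -mulr_suml ler_wpM2r// lerDl.
Qed.

Lemma post_covE s2 t t' : 0 <= t <= 1 -> 0 <= t' <= 1 ->
  post_cov K lam x k s2 t t' = s2 / n%:R * (lam^-1 * (partial12 k K t t' -
    bilin M (fun l => partial01 k K t (x l)) (fun l => partial01 k K t' (x l)))).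
Proof.
move=> t01 t'01; rewrite /post_cov (bilinE M) invfM.
rewrite (_ : (fun i => partial02 k K (x i) t') = fun l => partial01 k K t' (x l)); first by ring.
by apply/funext => l; exact: (partial02_partial01 HK CK).
Qed.

Variable s2 : R.
Hypothesis s20 : 0 <= s2.
Hypothesis HB : forall N, \sum_(i < N) \sum_(j < N) gram_error mu phi lam x i j ^+ 2 <= 4^-1.
Let V := post_cov K lam x k s2.
Let s2n : 0 <= s2 / n%:R. Proof. by rewrite divr_ge0// ltW. Qed.

Lemma post_var_bounds t : 0 <= t <= 1 -> 0 <= V t t <= s2 / n%:R * (2 * W).
Proof.
move=> t01; rewrite /V post_covE//.
have H1 := k12 t01 t01.
have H2 l := k01 t01 (x01 l).
have g0 := @posterior_variance_ge0 _ _ _ _ _ HM HK _ _ _ n0 lam0 x01 (fun i => psi i t) _ _ H1 H2.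
have g1 := @posterior_variance_le _ _ _ _ _ HM HK _ _ _ n0 lam0 x01 (fun i => psi i t) _ _ _ H1 H2 (fun m => HW m t01) HB.
by rewrite mulr_ge0//= ler_wpM2l.
Qed.

(** The variance of an increment is the posterior variance of the functional
    [f^(k)(t) - f^(k)(t')], to which the same comparison applies with the
    increments of [phi_i^(k)] as weights. *)
Lemma post_incr_bounds t t' : 0 <= t <= 1 -> 0 <= t' <= 1 ->
  0 <= V t t - V t t' - V t' t + V t' t' <= s2 / n%:R * (2 * (L ^+ 2 * Wh)) * (t - t') ^+ 2.
Proof.
move=> t01 t'01; rewrite /V !post_covE//.
have Msym : forall i j, M i j = M j i := ridge_sym lam (kernel_sample_sym HK x01).
pose kv l := partial01 k K t (x l) - partial01 k K t' (x l).
pose kap := partial12 k K t t - partial12 k K t t' - partial12 k K t' t + partial12 k K t' t'.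
have H1 : \sum_(i < m) (Num.sqrt (mu i) * (psi i t - psi i t')) * (Num.sqrt (mu i) * (psi i t - psi i t')) @[m --> \oo] --> kap.
  apply: (cvg_trans _ (cvgD (cvgB (cvgB (k12 t01 t01) (k12 t01 t'01)) (k12 t'01 t01)) (k12 t'01 t'01))); apply: near_eq_cvg; apply: nearW => m.
  by rewrite !fctE -!sumrB -big_split/=; apply: eq_bigr => i _; ring.
have H2 l : \sum_(i < m) (Num.sqrt (mu i) * (psi i t - psi i t')) * (Num.sqrt (mu i) * phi i (x l)) @[m --> \oo] --> kv l.
  apply: (cvg_trans _ (cvgB (k01 t01 (x01 l)) (k01 t'01 (x01 l)))); apply: near_eq_cvg; apply: nearW => m.
  by rewrite !fctE -!sumrB; apply: eq_bigr => i _; ring.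
have H3 m : \sum_(i < m) mu i / (lam + mu i) * (psi i t - psi i t') ^+ 2 <= L ^+ 2 * (t - t') ^+ 2 * Wh.
  apply: (@le_trans _ _ (L ^+ 2 * (t - t') ^+ 2 * \sum_(i < m) i.+1%:R ^+ (2 * k.+1) * mu i / (lam + mu i))); last first.
    by rewrite ler_wpM2l// mulr_ge0 ?sqr_ge0.
  rewrite mulr_sumr; apply: ler_sum => i _.
  have H := phiB i t01 t'01.
  have {}H : (psi i t - psi i t') ^+ 2 <= (L * i.+1%:R ^+ k.+1 * `|t - t'|) ^+ 2.
    by rewrite -(real_normK (num_real (psi i t - _))) ler_sqr ?nnegrE// (le_trans (normr_ge0 _) H).
  have ml : 0 <= mu i / (lam + mu i) by rewrite divr_ge0// ltW.
  have := ler_wpM2l ml H; rewrite !exprMn real_normK ?num_real// (mulnC 2) exprM => {}H.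
  by apply: le_trans H _; rewrite le_eqVlt; apply/orP; left; apply/eqP; ring.
have g0 := @posterior_variance_ge0 _ _ _ _ _ HM HK _ _ _ n0 lam0 x01 (fun i => psi i t - psi i t') _ _ H1 H2.
have g1 := @posterior_variance_le _ _ _ _ _ HM HK _ _ _ n0 lam0 x01 (fun i => psi i t - psi i t') _ _ _ H1 H2 H3 HB.
set kt := fun l => partial01 k K t (x l); set kt' := fun l => partial01 k K t' (x l).
have E : bilin M kv kv = bilin M kt kt - bilin M kt kt' - bilin M kt' kt + bilin M kt' kt'.
  rewrite (_ : kv = fun l => kt l + -1 * kt' l); last by apply/funext => l; rewrite mulN1r.
  by rewrite (bilin_sqrD Msym) !bilinZr (bilinZl Msym) (bilinC Msym kt' kt); ring.
have -> : s2 / n%:R * (lam^-1 * (partial12 k K t t - bilin M kt kt)) -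
  s2 / n%:R * (lam^-1 * (partial12 k K t t' - bilin M kt kt')) -
  s2 / n%:R * (lam^-1 * (partial12 k K t' t - bilin M kt' kt)) +
  s2 / n%:R * (lam^-1 * (partial12 k K t' t' - bilin M kt' kt')) =
  s2 / n%:R * (lam^-1 * (kap - bilin M kv kv)) by rewrite E /kap; ring.
rewrite mulr_ge0//=; apply: (@le_trans _ _ (s2 / n%:R * (2 * (L ^+ 2 * (t - t') ^+ 2 * Wh)))).
  by rewrite ler_wpM2l.
by rewrite le_eqVlt; apply/orP; left; apply/eqP; ring.
Qed.

Variables (dS : measure_display) (Sp : measurableType dS) (Qp : probability Sp R) (Z : R -> Sp -> R).
Hypothesis GP : gaussian_process Qp Z (post_mean K lam x y k) V.
Let m0 := post_mean K lam x y k.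

Lemma gp_marginal_tail t v a : 0 <= t <= 1 -> V t t <= v -> 0 < v -> 0 < a ->
  ((Qp^*)%mu [set s | (a <= `|Z t s - m0 t|)%R] <= (2 * expR (- (a ^+ 2 / (4 * v))))%:E)%E.
Proof.
move=> t01 Vv v0 a0; pose A := [set z | (a <= `|z - m0 t|)%R].
have mA : measurable A.
  rewrite -[X in measurable X]setTI; apply: measurable_fun_ler => //.
  by apply: measurableT_comp => //; exact: measurable_funB.
have := @gp_gaussian _ _ _ _ _ _ _ GP 1 (fun=> 1) (fun=> t) A (fun=> t01) mA.
rewrite !big_ord1 !mul1r (_ : (fun s => \sum_(i < 1) 1 * Z t s) = Z t); last first.
  by apply/funext => s; rewrite big_ord1 mul1r.
move=> E.
rewrite (_ : [set s | _] = Z t @^-1` A)// outer_measurable; last first.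
  by rewrite -[X in measurable X]setTI; apply: (gp_measurable GP t01).
rewrite [X in (X <= _)%E]E; apply: gaussian_tail => //.
by have /andP[] := post_var_bounds t01.
Qed.

Lemma gp_increment_tail t t' v a : 0 <= t <= 1 -> 0 <= t' <= 1 ->
  V t t - V t t' - V t' t + V t' t' <= v -> 0 < v -> 0 < a ->
  ((Qp^*)%mu [set s | (a <= `|(Z t s - m0 t) - (Z t' s - m0 t')|)%R] <= (2 * expR (- (a ^+ 2 / (4 * v))))%:E)%E.
Proof.
move=> t01 t'01 Vv v0 a0; pose A := [set z | (a <= `|z - (m0 t - m0 t')|)%R].
have mA : measurable A.
  rewrite -[X in measurable X]setTI; apply: measurable_fun_ler => //.
  by apply: measurableT_comp => //; exact: measurable_funB.
pose tt (i : 'I_2) := if i == 0 then t else t'; pose aa (i : 'I_2) : R := if i == 0 then 1 else -1.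
have tt01 i : 0 <= tt i <= 1 by rewrite /tt; case: ifP.
have := @gp_gaussian _ _ _ _ _ _ _ GP 2 aa tt A tt01 mA.
rewrite !big_ord_recl !big_ord0 !addr0.
rewrite (_ : (fun s => \sum_(i < 2) aa i * Z (tt i) s) = fun s => Z t s - Z t' s); last first.
  by apply/funext => s; rewrite !big_ord_recl big_ord0 addr0 /aa /tt /= mul1r mulN1r.
rewrite (_ : aa ord0 = 1)// (_ : aa (lift ord0 ord0) = -1)// (_ : tt ord0 = t)// (_ : tt (lift ord0 ord0) = t')//.
rewrite (_ : _ + _ + (_ + _) = V t t - V t t' - V t' t + V t' t'); last by ring.
rewrite (_ : 1 * _ + -1 * _ = m0 t - m0 t'); last by rewrite /m0; ring.
move=> E.
rewrite (_ : [set s | _] = (fun s => Z t s - Z t' s) @^-1` A); last first.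
  by apply/seteqP; split=> s; rewrite /A /= (_ : Z t s - m0 t - (Z t' s - m0 t') = Z t s - Z t' s - (m0 t - m0 t'))//; ring.
rewrite outer_measurable; last first.
  rewrite -[X in measurable X]setTI.
  have mf : measurable_fun setT (fun s => Z t s - Z t' s).
    by apply: measurable_funB; exact: (gp_measurable GP).
  exact: mf.
rewrite [X in (X <= _)%E]E; apply: gaussian_tail => //.
by have /andP[] := post_incr_bounds t01 t'01.
Qed.

Lemma gp_dyadic_deviation (v v' : R) j0 al be :
  0 < v -> s2 / n%:R * (2 * W) <= v -> 0 < v' -> s2 / n%:R * (2 * (L ^+ 2 * Wh)) <= v' ->
  0 < al -> 0 < be ->
  ((Qp^*)%mu [set s | exists j i, [/\ (j0 <= j)%N, (i <= 2 ^ j)%N &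
     (al + 4 * be < `|Z (dyadic j i) s - m0 (dyadic j i)|)%R]] <=
   ((2 ^+ j0 + 1) * (2 * expR (- (al ^+ 2 / (4 * v)))) + 36 * v' / (be ^+ 2 * 2 ^+ j0))%:E)%E.
Proof.
move=> v0 Hv v'0 Hv' al0 be0.
apply: (@chaining _ _ _ Qp (fun t s => Z t s - m0 t) v v') => //.
  move=> t a t01 a0; apply: gp_marginal_tail => //.
  by have /andP[_ H] := post_var_bounds t01; exact: le_trans Hv.
move=> t t' a t01 t'01 tt' a0; apply: gp_increment_tail => //.
  have /andP[_ H] := post_incr_bounds t01 t'01; apply: le_trans H _.
  by rewrite ler_wpM2r// sqr_ge0.
by rewrite mulr_gt0// exprn_gt0// subr_gt0.
Qed.
End Posterior.

(** * Posterior contraction *)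

Section PosteriorNorm.
Context {R : realType} (PX : probability (measurableTypeR R) R).
Implicit Types (h z m f : R -> R).
Local Notation I := (`[0%R, 1%R]%classic : set R).

Lemma continuous01B z m : {within `[0, 1], continuous z} -> {within `[0, 1], continuous m} ->
  {within `[0, 1], continuous (fun x => z x - m x)}.
Proof. by move=> cz cm x; apply: cvgB; [exact: cz|exact: cm]. Qed.

Lemma L2_normE h : {within `[0, 1], continuous h} ->
  L2_norm PX h = (Num.sqrt (\int[PX]_(x in `[0, 1]) (h x ^+ 2)))%:E.
Proof.
move=> ch; have I2 := continuous01_integr2 PX ch.
rewrite /L2_norm EFin_Rintegral// poweR_EFin powR12_sqrt//.
by apply: Rintegral_ge0 => x _; exact: sqr_ge0.
Qed.

(** For [p = 2] the constant 2 comes from [(u + v)^2 <= 2 u^2 + 2 v^2], which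
    avoids Minkowski's inequality. *)
Lemma pnorm_triangle p z m f a c : p = 2%:E \/ p = +oo%E ->
  {within `[0, 1], continuous z} -> {within `[0, 1], continuous m} ->
  {within `[0, 1], continuous f} ->
  (forall t, 0 <= t <= 1 -> `|z t - m t| <= a) ->
  (pnorm PX p (fun x => (m x - f x)%R) <= c%:E)%E ->
  (pnorm PX p (fun x => (z x - f x)%R) <= (2 * (a + c))%:E)%E.
Proof.
move=> hp cz cm cf Ha.
have a0 : 0 <= a by apply: le_trans (Ha 0 _); rewrite ?lexx ?ler01.
have tri t : z t - f t = (z t - m t) + (m t - f t) by ring.
case: hp => ->; rewrite /pnorm /=; last first.
  move=> /sup_norm_le Hc; apply/sup_norm_le => t t01.
  have H1 := Ha t t01; have H2 := Hc t t01.
  have := ler_normD (z t - m t) (m t - f t); rewrite -tri.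
  have := normr_ge0 (m t - f t); lra.
have czf := continuous01B cz cf; have cmf := continuous01B cm cf.
rewrite !L2_normE// !lee_fin => Hc.
have c0 : 0 <= c by apply: le_trans Hc; exact: sqrtr_ge0.
have i0 h : 0 <= \int[PX]_(x in `[0, 1]) (h x ^+ 2).
  by apply: Rintegral_ge0 => x _; exact: sqr_ge0.
have {}Hc : \int[PX]_(x in `[0, 1]) ((m x - f x) ^+ 2) <= c ^+ 2.
  by rewrite -(sqr_sqrtr (i0 (fun x => m x - f x))) ler_sqr ?nnegrE ?sqrtr_ge0.
have Icst : PX.-integrable `[0%R, 1%R] (EFin \o (fun=> 2 * a ^+ 2)).
  exact: finite_measure_integrable_cst.
have I2 := continuous01_integr2 PX cmf.
have Izf := continuous01_integr2 PX czf.
have H : \int[PX]_(x in `[0, 1]) ((z x - f x) ^+ 2) <= 2 * a ^+ 2 + 2 * c ^+ 2.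
  apply: (@le_trans _ _ (\int[PX]_(x in `[0, 1]) (2 * a ^+ 2 + 2 * (m x - f x) ^+ 2))).
    apply: le_Rintegral => //.
      by apply: integrD => //; exact: integrZ.
    move=> t /mem_itv01 t01; rewrite tri.
    have h1 : (z t - m t) ^+ 2 <= a ^+ 2.
      by rewrite -(real_normK (num_real (z t - _))) ler_sqr ?nnegrE// Ha.
    have := sqr_ge0 ((z t - m t) - (m t - f t)); lra.
  rewrite RintegralD//; last exact: integrZ.
  rewrite RintegralZl//; apply: lerD; last by rewrite ler_pM2l.
  by apply: Rintegral_cst_le => //; rewrite mulr_ge0 ?sqr_ge0.
rewrite -ler_sqr ?nnegrE ?sqrtr_ge0//; last by rewrite mulr_ge0// addr_ge0.
rewrite sqr_sqrtr//; apply: le_trans H _.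
have : 0 <= a * c by rewrite mulr_ge0.
have := sqr_ge0 a; have := sqr_ge0 c; lra.
Qed.

Lemma pnorm_ge0 p h : (0 <= pnorm PX p h)%E.
Proof.
rewrite /pnorm; case: ifP => _; first exact: sup_norm_ge0.
exact: poweR_ge0.
Qed.
End PosteriorNorm.

Section EffectiveDimension.
Context {R : realType}.
Variables (mu : nat -> R) (phi : nat -> R -> R) (lam : R).
Hypothesis mu0 : forall i, 0 < mu i.
Hypothesis lam0 : 0 < lam.

Lemma psum_le_nneseries (a : nat -> R) c N : (forall i, 0 <= a i) ->
  (\sum_(i <oo) (a i)%:E <= c%:E)%E -> \sum_(i < N) a i <= c.
Proof.
move=> a0 H; rewrite -lee_fin; apply: le_trans H.
apply: le_trans (nneseries_lim_ge N _); last by move=> i _ _; rewrite lee_fin.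
by rewrite sumEFin big_mkord.
Qed.

Let ratio0 i : 0 <= mu i / (lam + mu i).
Proof. by rewrite divr_ge0 ?addr_ge0// ltW. Qed.

Lemma kappa_tilde2_le m c : (kappa_tilde2 mu phi m lam <= c%:E)%E ->
  forall N x, 0 <= x <= 1 -> \sum_(i < N) mu i / (lam + mu i) * Dn m (phi i) x ^+ 2 <= c.
Proof.
move=> H N x x01.
apply: (@psum_le_nneseries (fun i => mu i / (lam + mu i) * Dn m (phi i) x ^+ 2)).
  by move=> i; rewrite mulr_ge0 ?sqr_ge0.
by apply: le_trans H; apply: ereal_sup_ubound; exists x => //=; rewrite in_itv.
Qed.

Lemma kappa_hat2_le m c : (kappa_hat2 mu m lam <= c%:E)%E ->
  forall N, \sum_(i < N) i.+1%:R ^+ (2 * m) * mu i / (lam + mu i) <= c.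
Proof.
move=> H N; apply: (@psum_le_nneseries (fun i => i.+1%:R ^+ (2 * m) * mu i / (lam + mu i))) => // i.
by rewrite -mulrA mulr_ge0// exprn_ge0.
Qed.
End EffectiveDimension.

Section Arithmetic.
Context {R : realType}.

Lemma up_log2_bounds n : (1 < n)%N ->
  (n%:R <= 2 ^+ up_log 2 n :> R) /\ (2 ^+ up_log 2 n <= 2 * n%:R :> R).
Proof.
move=> n1; split; first by rewrite -natrX ler_nat up_logP.
rewrite -natrX -natrM ler_nat.
have := up_log_gtn (isT : (1 < 2)%N) n1.
case: (up_log 2 n) => [|j] /=; first by rewrite expn0 => _; rewrite muln_gt0 (ltnW n1).
by rewrite expnS leq_pmul2l// => /ltnW.
Qed.

(** With a variance of order [e^2 / ln n], the Gaussian exponent is [M^2 ln n]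
    up to a constant. Large [M] makes it exceed [2 ln n], against the at most
    [2 n + 1] points of the grid. *)
Lemma deviation_bound_le (M e c1 c2 : R) n : (1 < n)%N -> 1 <= M -> 512 * c1 <= M ->
  0 < e -> 0 < c1 -> 0 < c2 ->
  (2 ^+ up_log 2 n + 1) * (2 * expR (- ((M * e / 8) ^+ 2 / (4 * (c1 * e ^+ 2 / ln n%:R))))) +
    36 * c2 / ((M * e / 32) ^+ 2 * 2 ^+ up_log 2 n) <=
  6 * n%:R^-1 + 192 ^+ 2 * c2 / (n%:R * e ^+ 2).
Proof.
move=> n1 M1 Mc e0 c10 c20.
have [J1 J2] := up_log2_bounds n1; set J := 2 ^+ _ in J1 J2 *.
have n1R : (1 : R) < n%:R by rewrite ltr1n.
have n0R : (0 : R) < n%:R by exact: lt_trans n1R.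
have l0 : 0 < ln (n%:R : R) by rewrite ln_gt0.
have M0 : 0 < M by exact: lt_le_trans M1.
have MM : M <= M ^+ 2 by rewrite expr2 ler_peMr// ltW.
apply: lerD.
  have E : (M * e / 8) ^+ 2 / (4 * (c1 * e ^+ 2 / ln n%:R)) = M ^+ 2 / (256 * c1) * ln n%:R.
    by field; rewrite !gt_eqF.
  have h : 2 * ln n%:R <= M ^+ 2 / (256 * c1) * ln n%:R :> R.
    rewrite ler_pM2r// ler_pdivlMr ?mulr_gt0//; lra.
  have hx : expR (- ((M * e / 8) ^+ 2 / (4 * (c1 * e ^+ 2 / ln n%:R)))) <= (n%:R ^+ 2)^-1.
    rewrite E expRN lef_pV2 ?posrE ?exprn_gt0 ?expR_gt0//.
    rewrite -[X in X ^+ 2 <= _](@lnK R)// -expRM_natr ler_expR mulrC //.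
  apply: (@le_trans _ _ ((3 * n%:R) * (2 * (n%:R ^+ 2)^-1))).
    by apply: ler_pM; rewrite ?mulr_ge0 ?expR_ge0 ?addr_ge0 ?exprn_ge0//; [lra|rewrite ler_pM2l].
  by rewrite le_eqVlt; apply/orP; left; apply/eqP; field; rewrite gt_eqF.
have J0 : 0 < J by exact: lt_le_trans J1.
have E : 36 * c2 / ((M * e / 32) ^+ 2 * J) = 192 ^+ 2 * c2 / (M ^+ 2 * (J * e ^+ 2)).
  by field; rewrite !gt_eqF.
rewrite E ler_pM2l ?mulr_gt0// lef_pV2 ?posrE ?mulr_gt0 ?exprn_gt0//.
apply: (@le_trans _ _ (J * e ^+ 2)); first by rewrite ler_pM2r ?exprn_gt0.
apply: ler_peMl; first by rewrite mulr_ge0 ?sqr_ge0 ?(ltW J0).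
exact: le_trans M1 MM.
Qed.

Lemma near_ln_ge1 : \forall n \near \oo, 1 <= ln (n%:R : R).
Proof.
near=> n; rewrite -[X in X <= _](@expRK R 1) ler_ln ?posrE ?expR_gt0//.
  by near: n; exact: nbhs_infty_ger.
by rewrite ltr0n; near: n; exists 1%N.
Unshelve. all: by end_near. Qed.
End Arithmetic.

Section PosteriorDeviation.
Context {R : realType} (PX : probability (measurableTypeR R) R).
Variables (mu : nat -> R) (phi : nat -> R -> R) (K : R -> R -> R) (k : nat).
Hypothesis HM : mercer_decomposition PX mu phi K.
Hypothesis HK : psd_kernel K.
Hypothesis CK : C2k01 k K.
Variables (C L : R).
Hypothesis L0 : 0 < L.
Hypothesis phiA : forall i x, 0 <= x <= 1 -> `|Dn k (phi i) x| <= C * i.+1%:R ^+ k.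
Hypothesis phiB : forall i x x', 0 <= x <= 1 -> 0 <= x' <= 1 ->
  `|Dn k (phi i) x - Dn k (phi i) x'| <= L * i.+1%:R ^+ k.+1 * `|x - x'|.

(** The thresholds [M e / 8] and [4 * (M e / 32)] of the chaining bound add up
    to [M e / 4]; together with the error [c e <= M e / 4] of the mean, and the
    factor 2 of the triangle inequality, they give [M e]. *)
Lemma posterior_deviation n lam (x y : 'I_n -> R) (sg C1 C2 e M c s2 : R) (p : \bar R) (f : R -> R)
    dS (Sp : measurableType dS) (Qp : probability Sp R) (Z : R -> Sp -> R) :
  (1 < n)%N -> 0 < lam -> (forall l, 0 <= x l <= 1) ->
  0 < sg -> 0 < C1 -> 0 < C2 -> 0 < e -> 1 <= M -> 4 * c <= M ->
  512 * (4 * sg * C1) <= M ->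
  (kappa_tilde2 mu phi k lam <= (C1 * (n%:R * e ^+ 2 / ln n%:R))%:E)%E ->
  (kappa_hat2 mu k.+1 lam <= (C2 * n%:R)%:E)%E ->
  0 <= s2 <= 2 * sg ->
  (forall N, \sum_(i < N) \sum_(j < N) gram_error mu phi lam x i j ^+ 2 <= 4^-1) ->
  p = 2%:E \/ p = +oo%E -> {within `[0, 1], continuous f} ->
  (pnorm PX p (fun t => (post_mean K lam x y k t - f t)%R) <= (c * e)%:E)%E ->
  gaussian_process Qp Z (post_mean K lam x y k) (post_cov K lam x k s2) ->
  ((Qp^*)%mu [set s | ((M * e)%:E < pnorm PX p (fun t => (Z t s - f t)%R))%E] <=
   (6 * n%:R^-1 + 192 ^+ 2 * (4 * sg * L ^+ 2 * C2) / (n%:R * e ^+ 2))%:E)%E.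
Proof.
move=> n1 lam0 x01 sg0 C10 C20 e0 M1 Mc Msg HW HWh /andP[s20 s2s] HB hp cf Hm GP.
have n0 : (0 < n)%N by exact: ltnW.
have n0R : (0 : R) < n%:R by rewrite ltr0n.
have l0 : 0 < ln (n%:R : R) by rewrite ln_gt0// ltr1n.
have M0 : 0 < M by exact: lt_le_trans M1.
have mu0 := mercer_gt0 HM.
have {}HW m t : 0 <= t <= 1 -> _ := kappa_tilde2_le mu0 lam0 HW m (x := t).
have {}HWh := kappa_hat2_le mu0 lam0 HWh.
have cm := post_mean_continuous (y := y) HM HK CK phiA phiB lam0 x01 HWh.
have al0 : 0 < M * e / 8 by rewrite divr_gt0// mulr_gt0.
have be0 : 0 < M * e / 32 by rewrite divr_gt0// mulr_gt0.
have c10 : 0 < 4 * sg * C1 by rewrite !mulr_gt0.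
have c20 : 0 < 4 * sg * L ^+ 2 * C2 by rewrite !mulr_gt0// exprn_gt0.
have v0 : 0 < 4 * sg * C1 * e ^+ 2 / ln n%:R by rewrite divr_gt0// mulr_gt0// exprn_gt0.
have s2n : s2 / n%:R <= 2 * sg / n%:R by rewrite ler_pM2r// invr_gt0.
have Hv : s2 / n%:R * (2 * (C1 * (n%:R * e ^+ 2 / ln n%:R))) <= 4 * sg * C1 * e ^+ 2 / ln n%:R.
  apply: (@le_trans _ _ (2 * sg / n%:R * (2 * (C1 * (n%:R * e ^+ 2 / ln n%:R))))).
    by rewrite ler_wpM2r// !mulr_ge0 ?invr_ge0 ?(ltW e0) ?(ltW C10) ?(ltW l0).
  by rewrite le_eqVlt; apply/orP; left; apply/eqP; field; rewrite !gt_eqF.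
have Hv' : s2 / n%:R * (2 * (L ^+ 2 * (C2 * n%:R))) <= 4 * sg * L ^+ 2 * C2.
  apply: (@le_trans _ _ (2 * sg / n%:R * (2 * (L ^+ 2 * (C2 * n%:R))))).
    by rewrite ler_wpM2r// !mulr_ge0 ?(ltW L0) ?(ltW C20).
  by rewrite le_eqVlt; apply/orP; left; apply/eqP; field; rewrite !gt_eqF.
have H := gp_dyadic_deviation HM HK CK phiA phiB n0 lam0 x01 HW HWh s20 HB GP
  (up_log 2 n) v0 Hv c20 Hv' al0 be0.
apply: (le_trans _ (le_trans H _)); last first.
  by rewrite lee_fin; exact: deviation_bound_le.
apply: outer_le => s /= Hs; apply: contrapT => nH.
have cZ : {within `[0, 1], continuous (Z ^~ s)} by exact: (gp_continuous GP).
have Hd t : 0 <= t <= 1 -> `|Z t s - post_mean K lam x y k t| <= M * e / 4.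
  have cz := continuous01B cZ cm.
  apply: (dyadic_dense cz (j0 := up_log 2 n)) => j i jj ij; rewrite leNgt; apply/negP => Hji.
  apply: nH; exists j, i; split => //; apply: le_lt_trans Hji.
  by rewrite le_eqVlt; apply/orP; left; apply/eqP; field.
have := pnorm_triangle hp cZ cm cf Hd Hm.
move=> /(lt_le_trans Hs); rewrite lte_fin ltNge => /negP; apply.
have : 4 * c * e <= M * e by rewrite ler_pM2r.
lra.
Qed.
End PosteriorDeviation.

Theorem theorem5 (R : realType)
  (* sample space, design law, data *)
  (d : measure_display) (T : measurableType d) (P : probability T R)
  (PX : probability (measurableTypeR R) R) (pX f0 : R -> R) (sigma0 : R)
  (X Y eps : nat -> {RV P >-> R})
  (* kernel, Mercer data, regularization, eigenvalues of K(X,X) *)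
  (K : R -> R -> R) (mu : nat -> R) (phi : nat -> R -> R)
  (r : R) (lambda : nat -> R)
  (u : forall n : nat, T -> 'I_n -> R) :
  let Xs := fun (n : nat) (w : T) (i : 'I_n) => X i w in
  let Ys := fun (n : nat) (w : T) (i : 'I_n) => Y i w in
  let s2hat := fun (n : nat) (w : T) =>
    sigma2_hat K (lambda n) (Xs n w) (Ys n w) in
  0 < sigma0 ->
  has_density01 PX pX ->
  {within `[0, 1], continuous f0} ->
  regression_model PX f0 sigma0 X Y eps ->
  psd_kernel K ->
  mercer_decomposition PX mu phi K ->
  (forall n w, ordered_eigenvalues (gram K (Xs n w)) (u n w)) ->
  0 < r <= 2^-1 ->
  (\sum_(i <oo) ((coef PX phi f0 i) ^+ 2 / (mu i `^ (2 * r)))%:E < +oo)%E ->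
  (forall n, 0 < lambda n) ->
  cvg_in_prob P
    (fun n w => (n%:R^-1 *
       \sum_(i < n) u n w i / (n%:R * lambda n + u n w i))%:E) 0%E ->
  (fun n => sup_norm (fun x => f_lambda PX mu phi f0 (lambda n) x - f0 x))
    @ \oo --> 0%E ->
  cvg_in_prob P (fun n w => (s2hat n w)%:E) (sigma0 ^+ 2)%:E /\
  (forall (k : nat) (epsn : nat -> R) (p : \bar R),
    Ck01 k f0 ->
    C2k01 k K ->
    epsn @ \oo --> 0 ->
    (fun n => n%:R * epsn n ^+ 2) @ \oo --> +oo ->
    (p = 2%:E \/ p = +oo%E) ->
    (* (A) *)
    (exists2 C : R, 0 < C & forall i : nat,
       (sup_norm (Dn k (phi i)) <= (C * i.+1%:R ^+ k)%:E)%E) ->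
    (* (B) *)
    (exists2 L : R, 0 < L & forall (i : nat) (x x' : R),
       0 <= x <= 1 -> 0 <= x' <= 1 ->
       `|Dn k (phi i) x - Dn k (phi i) x'| <=
         L * i.+1%:R ^+ k.+1 * `|x - x'|) ->
    (* (C) *)
    little_o (fun n => kappa_tilde2 mu phi 0 (lambda n))
             (fun n => Num.sqrt (n%:R / ln n%:R)) ->
    big_O (fun n => kappa_tilde2 mu phi k (lambda n))
          (fun n => n%:R * epsn n ^+ 2 / ln n%:R) ->
    big_O (fun n => kappa_hat2 mu k.+1 (lambda n)) (fun n => n%:R) ->
    (* (D) *)
    (exists2 C : R, 0 < C & with_prob_to_1 P (fun n => [set w |
       (pnorm PX p (fun x => post_mean K (lambda n) (Xs n w) (Ys n w) k x
                             - Dn k f0 x)%R <= (C * epsn n)%:E)%E])) ->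
    (* Under Q n w, the process Z n w has the law of the posterior of f^(k)
       given the first n observations, with plugged-in variance s2hat. *)
    forall (dS : measure_display) (S : measurableType dS)
      (Q : nat -> T -> probability S R) (Z : nat -> T -> R -> S -> R),
    (forall (n : nat) (w : T), (0 < n)%N ->
       gaussian_process (Q n w) (Z n w)
         (post_mean K (lambda n) (Xs n w) (Ys n w) k)
         (post_cov K (lambda n) (Xs n w) k (s2hat n w))) ->
    forall M : nat -> R, M @ \oo --> +oo ->
    cvg_in_prob P
      (fun n w => ((Q n w)^*)%mu [set s |
         ((M n * epsn n)%:E <
            pnorm PX p (fun x => Z n w x s - Dn k f0 x)%R)%E])
      0%E).
Proof.
move=> Xs Ys s2hat sg0 _ cf0 HR HK HM Hu _ _ lam0 Htr Hsup.
have consistent : cvg_in_prob P (fun n w => (s2hat n w)%:E) (sigma0 ^+ 2)%:E.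
  exact: (variance_estimator_consistent sg0 cf0 HR HK HM Hu).
split=> // k epsn p Cf CK eps0 neps hp [CA CA0 HA] [L L0 HB] Hk0 [C1 C10 Hkk] [C2 C20 Hkh]
  [CD CD0 HD] dS S Q Z GP M Moo.
have phiA i x : 0 <= x <= 1 -> `|Dn k (phi i) x| <= CA * i.+1%:R ^+ k.
  by have /sup_norm_le := HA i; apply.
have mu0 := mercer_gt0 HM.
have v0 : 0 < sigma0 ^+ 2 by rewrite exprn_gt0.
set v := sigma0 ^+ 2 in v0 consistent.
apply/cvg_in_probP => e q e0 q0.
(* chosen so that [4 * eta ^+ 2], the bound on the probability of a large Gram
   error once [ln n >= 1], is at most [q / 3] *)
pose eta := Num.min 1 (q / 12).
have eta0 : 0 < eta by rewrite lt_min ltr01 divr_gt0.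
have eta1 : eta <= 1 by rewrite ge_min lexx.
have etaq : eta <= q / 12 by rewrite ge_min lexx orbT.
have q3 : 0 < q / 3 by rewrite divr_gt0.
pose c2 := 4 * v * L ^+ 2 * C2.
have c20 : 0 < c2 by rewrite !mulr_gt0// exprn_gt0.
have e24 : 0 < e / 24 by rewrite divr_gt0.
have H0 := Hk0 _ eta0.
have H1 := (cvg_in_probP _ _ _).1 consistent _ _ v0 q3.
have H2 := (ereal_cvg0P (fun n => outer_measure_ge0 _ _)).1 HD _ q3.
have H3 := near_inv_nat e24.
have H4 := @near_ln_ge1 R.
have H5 := (cvgryPge _).1 neps (1 + 4 * 192 ^+ 2 * c2 / e).
have H6 := (cvgryPge _).1 Moo (1 + 4 * CD + 512 * (4 * v * C1)).
near=> n.
have n1 : (1 < n)%N by near: n; exists 2%N.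
have n0 : (0 < n)%N by exact: ltnW.
have n0R : (0 : R) < n%:R by rewrite ltr0n.
have h0 : (kappa_tilde2 mu phi 0 (lambda n) <= (eta * Num.sqrt (n%:R / ln n%:R))%:E)%E by near: n.
have hk : (kappa_tilde2 mu phi k (lambda n) <= (C1 * (n%:R * epsn n ^+ 2 / ln n%:R))%:E)%E by near: n.
have hh : (kappa_hat2 mu k.+1 (lambda n) <= (C2 * n%:R)%:E)%E by near: n.
have h1 : ((P^*)%mu [set w | (v%:E <= `|(s2hat n w)%:E - v%:E|)%E] <= (q / 3)%:E)%E by near: n.
have h2 : ((P^*)%mu (~` [set w | (pnorm PX p (fun x => post_mean K (lambda n) (Xs n w) (Ys n w) k x
                             - Dn k f0 x)%R <= (CD * epsn n)%:E)%E]) <= (q / 3)%:E)%E by near: n.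
have h3 : n%:R^-1 <= e / 24 by near: n.
have h4 : 1 <= ln (n%:R : R) by near: n.
have h5 : 1 + 4 * 192 ^+ 2 * c2 / e <= n%:R * epsn n ^+ 2 by near: n; exact: H5.
have h6 : 1 + 4 * CD + 512 * (4 * v * C1) <= M n by near: n; exact: H6.
set A := [set w | _] in h2.
have c10 : 0 < 512 * (4 * v * C1) by rewrite !mulr_gt0.
have ln0 : 0 < ln (n%:R : R) by exact: lt_le_trans h4.
have Hg := gram_error_outer cf0 HR HM n0 (lam0 n) (kap := eta * Num.sqrt (n%:R / ln n%:R)) _.
set G := ~` _ in Hg.
have {}Hg : ((P^*)%mu G <= (q / 3)%:E)%E.
  apply: le_trans (Hg _) _.
    move=> m x x01; have := kappa_tilde2_le mu0 (lam0 n) h0 m x01; apply: le_trans.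
    rewrite le_eqVlt; apply/orP; left; apply/eqP; apply: eq_bigr => i _.
    by rewrite /shrunk exprMn sqr_sqrtr// divr_ge0 ?addr_ge0// ltW.
  rewrite lee_fin exprMn sqr_sqrtr; last by rewrite divr_ge0// ltW.
  rewrite (_ : 4 * _ = 4 * eta ^+ 2 / ln n%:R); last by field; rewrite !gt_eqF.
  rewrite ler_pdivrMr//; apply: (@le_trans _ _ (q / 3 * 1)); last by rewrite ler_pM2l.
  have : eta ^+ 2 <= eta by rewrite expr2 ger_pMl.
  lra.
set B := [set w | _] in h1.
(* Outside three unlikely events, on the Gram matrix, on the variance estimator
   and on the posterior mean, the deviation bound is deterministic. *)
apply: (@le_trans _ _ ((P^*)%mu ((G `|` B) `|` ~` A))); last first.
  apply: (@le_trans _ _ (q / 3 + q / 3 + q / 3)%:E); last by rewrite lee_fin; lra.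
  by apply: outerU => //; exact: outerU.
apply: outer_le => w Hw; apply: contrapT => /not_orP[/not_orP[/contrapT wG nB] /contrapT wA].
have x01 (l : 'I_n) : 0 <= Xs n w l <= 1 by exact: (model_X01 HR).
have ne0 : 0 < n%:R * epsn n ^+ 2.
  by apply: lt_le_trans h5; rewrite ltr_wpDr// divr_ge0 ?(ltW e0)// !mulr_ge0// ltW.
have en0 : 0 < epsn n.
  rewrite lt_neqAle; apply/andP; split.
    by apply: contraTneq ne0 => <-; rewrite expr0n mulr0 ltxx.
  rewrite -(pmulr_rge0 _ CD0) -lee_fin; apply: le_trans wA; exact: pnorm_ge0.
have s2b : 0 <= s2hat n w <= 2 * v.
  apply/andP; split.
    rewrite /s2hat /sigma2_hat bilinE mulr_ge0 ?(ltW (lam0 n))//.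
    exact: (ridge_psd n0 (lam0 n) (fun a => kernel_sample_psd HK x01 a)).
  move/negP: nB; rewrite /B /= lee_fin -ltNge => nB.
  have := ler_norm (s2hat n w - v); lra.
have cf : {within `[0, 1], continuous (Dn k f0)} by exact: (Cf.2 k (leqnn k)).
have c40 : 0 < 4 * CD by rewrite mulr_gt0.
have M1 : 1 <= M n by move: h6 c10 c40; lra.
have MD : 4 * CD <= M n by move: h6 c10; lra.
have Mv : 512 * (4 * v * C1) <= M n by move: h6 c40; lra.
have := posterior_deviation HM HK CK L0 phiA HB n1 (lam0 n) x01 v0 C10 C20 en0 M1 MD Mv hk hh s2b wG hp cf wA (GP n w n0).
rewrite -/c2; move: Hw; rewrite /= sube0 gee0_abs; last exact: outer_measure_ge0.
move=> Hw /(le_trans Hw); rewrite lee_fin leNgt => /negP; apply.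
have : 192 ^+ 2 * c2 / (n%:R * epsn n ^+ 2) <= e / 4.
  rewrite ler_pdivrMr//; apply: (@le_trans _ _ (e / 4 * (4 * 192 ^+ 2 * c2 / e))).
    by rewrite le_eqVlt; apply/orP; left; apply/eqP; field; rewrite gt_eqF.
  rewrite ler_pM2l ?divr_gt0//; apply: le_trans h5; lra.
lra.
Unshelve. all: by end_near. Qed.
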